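(* Let $\xi\in(0,1)$ and let $\nu$ be either a real number with $0\le\nu<\frac12$ or a purely imaginary number. Let $\mathsf{K}_{\nu,\xi}$ be the correlation kernel of the point process $\mathbf{P}_{\nu,\xi}$ on $\mathbb{Z}_{>0}$ (see context). Then for all $x,y\in\mathbb{Z}_{>0}$ $$\mathsf{K}_{\nu,\xi}(x,y)=\frac{\cos(\pi\nu)}{\pi}\,\frac{\xi^{\frac{x+y}2}\,\Xi(x,y)}{\sqrt{x!\,y!\,(x-1)!\,(y-1)!}}\cdot\frac{\mathsf{A}(x)\mathsf{B}(y)-\mathsf{B}(x)\mathsf{A}(y)}{x^2-y^2},$$ where $\mathsf{B}(x)=\phi_1(x)$ and $\mathsf{A}(x)$ can be taken to be either of the following two functions: (1) $\mathsf{A}^{(1)}(x)=x\big(2\phi_0(x)-\phi_1(x)\big)$; (2) $\mathsf{A}^{(2)}(x)=\frac{x}{1+\xi}\big[2\widetilde\phi(x)-(1-\xi)\phi_1(x)\big]$. For $x=y$ the formula is understood according to L'Hospital's rule.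
   Context: $\mathbb{Z}_{>0}=\{1,2,\dots\}$. $\mathbf{P}_{\nu,\xi}$ is the probability measure on finite subsets of $\mathbb{Z}_{>0}$ given by $$\mathbf{P}_{\nu,\xi}(\{x_1,\dots,x_N\})=\mathit{const}\cdot\prod_{1\le i<j\le N}\Big(\frac{x_i-x_j}{x_i+x_j}\Big)^2\prod_{i=1}^N\psi_{\nu,\xi}(x_i),\qquad \psi_{\nu,\xi}(x)=\frac{\xi^x\cos(\pi\nu)}{2\pi}\frac{\Gamma(\frac12-\nu+x)\Gamma(\frac12+\nu+x)}{(x!)^2},$$ where $\mathit{const}$ is the normalizing constant (empty products equal $1$). This process is determinantal, i.e. the probability that the random configuration contains a given finite set $\{x_1,\dots,x_n\}$ of distinct points is $\det[\mathsf{K}_{\nu,\xi}(x_i,x_j)]_{i,j=1}^n$, with correlation kernel $\mathsf{K}_{\nu,\xi}=\mathsf{L}_{\nu,\xi}(1+\mathsf{L}_{\nu,\xi})^{-1}$, where $\mathsf{L}_{\nu,\xi}$ is the trace class operator in $\ell^2(\mathbb{Z}_{>0})$ with matrix $\mathsf{L}_{\nu,\xi}(x,y)=\frac{2\sqrt{xy\,\psi_{\nu,\xi}(x)\psi_{\nu,\xi}(y)}}{x+y}$. Notation: $\phi_i(x)={}_2F_1\big(-\frac12-\nu+i,-\frac12+\nu+i;x+i;\frac{\xi}{\xi-1}\big)$ for $i=0,1,2,\dots$, and $\widetilde\phi(x)={}_2F_1\big(\frac32+\nu,-\frac12-\nu;x;\frac{\xi}{\xi-1}\big)$, where ${}_2F_1$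 is the Gauss hypergeometric function (analytically continued to $\mathbb{C}\setminus[1,+\infty)$ in its argument); $\Xi(x,y)=\big\{\Gamma(\frac12-\nu+x)\Gamma(\frac12+\nu+x)\Gamma(\frac12-\nu+y)\Gamma(\frac12+\nu+y)\big\}^{1/2}$ (positive square root of a positive number). L'Hospital convention: $\mathsf{A},\mathsf{B}$ are regarded as functions of a real variable $x>0$ by the same formulas, and for $x=y$ the fraction $\frac{\mathsf{A}(x)\mathsf{B}(y)-\mathsf{B}(x)\mathsf{A}(y)}{x^2-y^2}$ means its limit as the real variable $y\to x$, i.e. $\frac{\mathsf{A}'(x)\mathsf{B}(x)-\mathsf{B}'(x)\mathsf{A}(x)}{2x}$. *)

(* Defs.v *)
From Stdlib Require Export Reals Factorial.
From Stdlib Require Import ClassicalEpsilon.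
From Coquelicot Require Export Coquelicot.

Open Scope R_scope.

(** * Complex special functions *)

Definition Ccos (z : C) : C :=
  (cos (Re z) * cosh (Im z), - (sin (Re z) * sinh (Im z))).

(* [t ^ z = exp (z ln t)] for a positive real base [t]. *)
Definition Rpowc (t : R) (z : C) : C :=
  (exp (Re z * ln t) * cos (Im z * ln t),
   exp (Re z * ln t) * sin (Im z * ln t)).

(* Pochhammer symbol [a (a + 1) ... (a + n - 1)]. *)
Fixpoint poch (a : C) (n : nat) : C :=
  match n with
  | O => 1%C
  | S m => (poch a m * (a + INR m))%C
  end.

(* Euler's limit [n! n^z / (z (z + 1) ... (z + n))], valid at every complex
   [z] that is not a pole. *)
Definition Gamma_seq (z : C) (n : nat) : C :=
  (INR (fact n) * Rpowc (INR n) z / poch z (S n))%C.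

Definition CGamma (z : C) : C :=
  (real (Lim_seq (fun n => Re (Gamma_seq z n))),
   real (Lim_seq (fun n => Im (Gamma_seq z n)))).

Definition analytic_at (F : C -> C) (z0 : C) : Prop :=
  exists (a : nat -> C) (r : R), 0 < r /\
    forall z : C, Cmod (z - z0)%C < r ->
      @is_pseries C_AbsRing C_NormedModule a (z - z0)%C (F z).

Definition hyp_coef (a b c : C) (n : nat) : C :=
  (poch a n * poch b n / (poch c n * INR (fact n)))%C.

(* [w] is the value at [z] of the analytic continuation of the hypergeometric
   series along the segment [[0, z]]. The domain [C \ [1, +oo)] is star-shaped
   about [0], so for [z] in it this is the value of the continuation of the
   series to that domain. *)
Definition is_hyp2F1 (a b c z w : C) : Prop :=
  exists F : C -> C,
    (forall t : R, 0 <= t <= 1 -> analytic_at F (t * z)%C) /\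
    (exists r : R, 0 < r /\
       forall u : C, Cmod u < r ->
         @is_pseries C_AbsRing C_NormedModule (hyp_coef a b c) u (F u)) /\
    F z = w.

Definition hyp2F1 (a b c z : C) : C :=
  epsilon (inhabits (RtoC 0)) (is_hyp2F1 a b c z).

(** * Operators on the complex Hilbert space l^2(Z_{>0})

    Points of Z_{>0} are the natural numbers [x >= 1]; the value of a vector
    or of a matrix at [0] is never used. *)

Definition Csum_pos (f : nat -> C) : C :=
  (Series (fun n => Re (f (S n))), Series (fun n => Im (f (S n)))).

Definition in_l2 (u : nat -> C) : Prop :=
  ex_series (fun n => Cmod (u (S n)) ^ 2).

Definition matrix_op (M : nat -> nat -> R) (u : nat -> C) (x : nat) : C :=
  Csum_pos (fun y => (M x y * u y)%C).

Definition one_plus (M : nat -> nat -> R) (u : nat -> C) (x : nat) : C :=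
  (u x + matrix_op M u x)%C.

Definition inverse_op (T : (nat -> C) -> nat -> C) (v : nat -> C) : nat -> C :=
  epsilon (inhabits (fun _ : nat => RtoC 0))
    (fun u => in_l2 u /\ forall x : nat, (1 <= x)%nat -> T u x = v x).

Definition basis_vec (y x : nat) : C := if Nat.eq_dec x y then 1%C else 0%C.

(** * The kernels *)

(* [Gamma (1/2 - nu + x) Gamma (1/2 + nu + x)]: for real [nu] in [[0, 1/2)] and
   for imaginary [nu] this complex number is real and positive, so that [Re]
   only changes its type; the same applies to [cos (PI nu)]. *)
Definition Gamma_prod (nu : C) (x : nat) : R :=
  Re (CGamma ((1/2)%R - nu + INR x) * CGamma ((1/2)%R + nu + INR x))%C.

Definition cos_pi (nu : C) : R := Re (Ccos (PI * nu)%C).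

Definition psi (nu : C) (xi : R) (x : nat) : R :=
  xi ^ x * cos_pi nu / (2 * PI) * (Gamma_prod nu x / INR (fact x) ^ 2).

Definition L_kernel (nu : C) (xi : R) (x y : nat) : R :=
  2 * sqrt (INR x * INR y * psi nu xi x * psi nu xi y) / (INR x + INR y).

(* Matrix entry at [(x, y)] of [L (1 + L)^{-1}]. *)
Definition K_kernel (nu : C) (xi : R) (x y : nat) : C :=
  matrix_op (L_kernel nu xi)
    (inverse_op (one_plus (L_kernel nu xi)) (basis_vec y)) x.

(** * The functions entering the integrable form of the kernel *)

Definition phi (nu : C) (xi : R) (i : nat) (x : R) : C :=
  hyp2F1 (- (1/2)%R - nu + INR i)%C (- (1/2)%R + nu + INR i)%C
         (x + INR i)%R (xi / (xi - 1))%R.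

Definition phi_tilde (nu : C) (xi : R) (x : R) : C :=
  hyp2F1 ((3/2)%R + nu)%C (- (1/2)%R - nu)%C x (xi / (xi - 1))%R.

Definition B_fun (nu : C) (xi : R) (x : R) : C := phi nu xi 1 x.

Definition A1_fun (nu : C) (xi : R) (x : R) : C :=
  (x * (2 * phi nu xi 0 x - phi nu xi 1 x))%C.

Definition A2_fun (nu : C) (xi : R) (x : R) : C :=
  ((x / (1 + xi))%R * (2 * phi_tilde nu xi x - (1 - xi)%R * phi nu xi 1 x))%C.

Definition Xi (nu : C) (x y : nat) : R :=
  sqrt (Gamma_prod nu x * Gamma_prod nu y).

Definition quotient (A B : R -> C) (x y : R) : C :=
  ((A x * B y - B x * A y) / (x ^ 2 - y ^ 2)%R)%C.

(* [q] is the value of [quotient A B x y], with L'Hospital's convention on the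
   diagonal: there it is the limit along real [t -> x], [t <> x]. *)
Definition is_quotient (A B : R -> C) (x y : R) (q : C) : Prop :=
  (x <> y -> q = quotient A B x y) /\
  (x = y -> filterlim (quotient A B x) (locally' x) (locally q)).

(* Main.v *)
Require Import Defs.
From Stdlib Require Import Reals Lra Lia ClassicalEpsilon.
From Coquelicot Require Import Coquelicot.
Open Scope R_scope.

(** Write z = xi/(xi - 1), beta = 1/4 - nu^2 (a positive real number for all
    admissible nu) and W_y = 2 y psi(y), so that L(x,y) is
    sqrt(W_x W_y)/(x + y).  If X denotes multiplication by the point, then
    X L + L X has rank one, so the commutator of X^2 with R = (1 + L)^(-1) has
    rank two: (x^2 - y^2) K(x,y) is a combination of the vectors R applied to
    sqrt(W) and to X sqrt(W).  After division by sqrt(W), the formula says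
    that, for some constant c, B and A solve
<<
      B(x) + sum_y W_y B(y)/(x + y) = 1,
      A(x) + sum_y W_y A(y)/(x + y) = x - c;
>>
    the constant drops out of A(x) B(y) - B(x) A(y).

    The first equation ([B_equation]) holds because 2F1(1/2 - nu, 1/2 + nu;
    x + 1; z), as a function of x, is 1 plus the sum of its polar parts at
    x = -1, -2, ..., and Euler's transformation identifies the residue at -y
    with -W_y B(y).  It is proved as an identity between finite sums
    ([phi_coef_convolution]), on the coefficients of the expansion in powers
    of xi; this expansion, unlike the one in z, converges for all
    0 < xi < 1 ([phi_coef_bound]).  Since W_y is a constant times xi^y, that
    identity is graded in xi, and weighting it by the degree gives the second
    equation ([A_equation]) for A = x B + 2 xi dB/dxi.  This A is A^(1), and
    A^(2) differs from it by a multiple of B ([A1_fun_eval], [A2_fun_eval]).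

    From the two equations to the kernel ([res_col_equation]): fix y, put
    k(x) = (A(x) B(y) - B(x) A(y))/(x^2 - y^2) for x <> y, and choose k(y) so
    that k(x) + sum_t W_t k(t)/(x + t) = 1/(x + y) holds for all real x <> y.
    A possible defect at x = y is removed by pairing with B and with A: the
    operator is symmetric, so the defect times B(y) and times A(y) both
    vanish, and A(y) = B(y) = 0 is excluded by contiguity relations in y
    ([AB_not_both_zero]).  Letting x tend to y in the equation shows that k(y)
    is the value prescribed by L'Hospital's rule ([quotient_limit]), without
    any derivative of A or B.  The columns obtained in this way are those of
    the operator K because 1 + L is injective: the matrix 1/(x + y) is
    positive semidefinite ([cauchy_injective]).

    Two evaluations connect this with the special functions.  The value of the
    continued 2F1 at z is the sum of a power series at xi: the substitution
    u -> u/(u - 1) maps the segment from 0 to z onto the segment from 0 to xi,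
    inside the disc of convergence, and an identity theorem along the segment
    gives uniqueness ([hyp2F1_eval]).  The product of the two Gamma values is
    pi/cos(pi nu) times (1/2 - nu)_x (1/2 + nu)_x; this rests on the product
    formula for the cosine, obtained from the integrals of
    cos(2 nu t) cos(t)^n ([factorial_quad_poch_limit], [gamma_product_lim]). *)

(** * The change of variable z = xi/(xi - 1) on coefficient sequences *)

(** Series lemmas state equations in the carrier of a normed module, where [ring] does not recognise the real numbers. *)
Ltac as_R := match goal with |- @eq _ ?a ?b => change (@eq R a b) end.

(** (-1)^j times the binomial coefficient (N + y - 1 choose N - j), which is the
    coefficient of xi^N in (1 - xi)^(-y) (xi/(xi - 1))^j.  This recursion makes sense for real y
    and gives the right value 0 when y = 0, j = 0 and N > 0. *)
Fixpoint pfaff_coef (y : R) (N j : nat) : R :=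
  match N, j with
  | O, O => 1
  | O, S _ => 0
  | S M, O => (INR M + y) / (INR M + 1) * pfaff_coef y M O
  | S M, S i => pfaff_coef y M (S i) - pfaff_coef y M i
  end.

(** If g is the sequence of coefficients of G, these are the coefficients of
    (1 - xi)^(-y) G(xi/(xi - 1)) in powers of xi. *)
Definition pfaff (y : R) (g : nat -> R) (N : nat) : R :=
  sum_f_R0 (fun j => pfaff_coef y N j * g j) N.

(** Multiplication of a power series by its variable. *)
Definition lag (g : nat -> R) (k : nat) : R :=
  match k with O => 0 | S i => g i end.

Lemma sumR_S (f : nat -> R) N : sum_f_R0 f (S N) = sum_f_R0 f N + f (S N).
Proof. reflexivity. Qed.

Lemma sumR_0 (f : nat -> R) : sum_f_R0 f O = f O.
Proof. reflexivity. Qed.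

Lemma sumR_shift (f : nat -> R) N :
  sum_f_R0 f (S N) = f O + sum_f_R0 (fun i => f (S i)) N.
Proof.
  induction N as [|N IH]; [reflexivity|].
  rewrite sumR_S, IH, (sumR_S _ N); ring.
Qed.

Lemma sumR_plus (f g : nat -> R) N :
  sum_f_R0 (fun i => f i + g i) N = sum_f_R0 f N + sum_f_R0 g N.
Proof. induction N as [|N IH]; [reflexivity|]. rewrite !sumR_S, IH; ring. Qed.

Lemma sumR_scal (c : R) (f : nat -> R) N :
  sum_f_R0 (fun i => c * f i) N = c * sum_f_R0 f N.
Proof. induction N as [|N IH]; [reflexivity|]. rewrite !sumR_S, IH; ring. Qed.

Lemma sumR_minus (f g : nat -> R) N :
  sum_f_R0 (fun i => f i - g i) N = sum_f_R0 f N - sum_f_R0 g N.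
Proof. induction N as [|N IH]; [reflexivity|]. rewrite !sumR_S, IH; ring. Qed.

Lemma sumR_ext_loc (f g : nat -> R) N :
  (forall k, (k <= N)%nat -> f k = g k) -> sum_f_R0 f N = sum_f_R0 g N.
Proof. exact (sum_eq f g N). Qed.

Lemma sumR_ext (f g : nat -> R) N :
  (forall k, f k = g k) -> sum_f_R0 f N = sum_f_R0 g N.
Proof. intros H; apply sumR_ext_loc; auto. Qed.

Lemma pfaff_coef_out y N : forall j, (N < j)%nat -> pfaff_coef y N j = 0.
Proof.
  induction N as [|N IH]; intros [|j] H; try lia; simpl; try reflexivity.
  rewrite !IH by lia; ring.
Qed.

(** Together with the defining recursion, this first-order relation in j is all that is needed about these binomial coefficients. *)
Lemma pfaff_coef_star y N : forall j,
  (INR j + y) * pfaff_coef y N (S j) = (INR j - INR N) * pfaff_coef y N j.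
Proof.
  induction N as [|N IH]; intros j.
  - destruct j; simpl; ring.
  - change (pfaff_coef y (S N) (S j)) with (pfaff_coef y N (S j) - pfaff_coef y N j).
    rewrite Rmult_minus_distr_l, IH.
    destruct j as [|j].
    + cbn [pfaff_coef]. rewrite S_INR. simpl (INR 0).
      pose proof (pos_INR N). field. lra.
    + change (pfaff_coef y (S N) (S j)) with (pfaff_coef y N (S j) - pfaff_coef y N j).
      rewrite !S_INR. pose proof (IH j) as H.
      transitivity ((INR j - INR N) * pfaff_coef y N (S j) - (INR j + y) * pfaff_coef y N (S j)); [ring|].
      rewrite H; ring.
Qed.

(** One factor -xi/(1 - xi) of (xi/(xi - 1))^(j+1) is absorbed into (1 - xi)^(-y). *)
Lemma pfaff_coef_raise y N : forall j, pfaff_coef (y + 1) N j = - pfaff_coef y (S N) (S j).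
Proof.
  induction N as [|N IH]; intros [|j].
  - simpl; ring.
  - simpl; ring.
  - change (pfaff_coef (y + 1) (S N) 0) with ((INR N + (y + 1)) / (INR N + 1) * pfaff_coef (y + 1) N 0).
    rewrite IH. change (pfaff_coef y (S (S N)) 1) with (pfaff_coef y (S N) 1 - pfaff_coef y (S N) 0).
    pose proof (pfaff_coef_star y (S N) 0) as H. rewrite S_INR in H. simpl (INR 0) in H.
    pose proof (pos_INR N).
    assert (H1 : pfaff_coef y (S N) 0 = - (y * pfaff_coef y (S N) 1) / (INR N + 1)).
    { apply Rmult_eq_reg_l with (INR N + 1); [|lra].
      transitivity (- ((0 - (INR N + 1)) * pfaff_coef y (S N) 0)); [ring|].
      rewrite <- H. field. lra. }
    rewrite H1. field. lra.
  - change (pfaff_coef (y + 1) (S N) (S j)) with (pfaff_coef (y + 1) N (S j) - pfaff_coef (y + 1) N j).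
    rewrite !IH. change (pfaff_coef y (S (S N)) (S (S j))) with (pfaff_coef y (S N) (S (S j)) - pfaff_coef y (S N) (S j)).
    ring.
Qed.

Lemma pfaff_coef_raise_n y : forall N j, pfaff_coef (INR y) N j = (-1) ^ y * pfaff_coef 0 (N + y) (j + y).
Proof.
  induction y as [|y IH]; intros N j.
  - rewrite !Nat.add_0_r. simpl. ring.
  - rewrite S_INR, pfaff_coef_raise, IH. simpl pow.
    replace (N + S y)%nat with (S N + y)%nat by lia.
    replace (j + S y)%nat with (S j + y)%nat by lia. ring.
Qed.

Lemma pfaff_coef_0_0 N : pfaff_coef 0 (S N) 0 = 0.
Proof.
  induction N as [|N IH].
  - simpl. field.
  - change (pfaff_coef 0 (S (S N)) 0) with ((INR (S N) + 0) / (INR (S N) + 1) * pfaff_coef 0 (S N) 0).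
    rewrite IH; ring.
Qed.

Lemma pfaff_bound y g N M : (N <= M)%nat ->
  sum_f_R0 (fun j => pfaff_coef y N j * g j) M = pfaff y g N.
Proof.
  induction 1 as [|M HM IH]; [reflexivity|].
  rewrite sumR_S, IH, pfaff_coef_out by lia; ring.
Qed.

Lemma pfaff_ext y f g N : (forall k, f k = g k) -> pfaff y f N = pfaff y g N.
Proof. intros H; apply sumR_ext; intros k; rewrite H; reflexivity. Qed.

Lemma pfaff_0 y g : pfaff y g 0 = g O.
Proof. unfold pfaff; rewrite sumR_0; simpl; ring. Qed.

Lemma pfaff_plus y f g N : pfaff y (fun k => f k + g k) N = pfaff y f N + pfaff y g N.
Proof.
  unfold pfaff; rewrite <- sumR_plus; apply sumR_ext; intros; ring.
Qed.

Lemma pfaff_minus y f g N : pfaff y (fun k => f k - g k) N = pfaff y f N - pfaff y g N.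
Proof.
  unfold pfaff; rewrite <- sumR_minus; apply sumR_ext; intros; ring.
Qed.

Lemma pfaff_scal y c g N : pfaff y (fun k => c * g k) N = c * pfaff y g N.
Proof.
  unfold pfaff; rewrite <- sumR_scal; apply sumR_ext; intros; ring.
Qed.

Lemma pfaff_lag_0 y g : pfaff y (lag g) 0 = 0.
Proof. apply pfaff_0. Qed.

Lemma pfaff_lag_S y g N : pfaff y (lag g) (S N) = pfaff y (lag g) N - pfaff y g N.
Proof.
  rewrite <- (pfaff_bound y (lag g) N (S N)) by lia.
  unfold pfaff; rewrite !sumR_shift. cbn [lag].
  rewrite !Rmult_0_r, !Rplus_0_l, <- sumR_minus.
  apply sumR_ext; intros k; cbn [pfaff_coef]; ring.
Qed.

(** The variable z becomes -xi/(1 - xi). *)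
Lemma pfaff_lag y g N : pfaff y (lag g) (S N) = - sum_f_R0 (pfaff y g) N.
Proof.
  induction N as [|N IH].
  - rewrite pfaff_lag_S, pfaff_lag_0, sumR_0; ring.
  - rewrite pfaff_lag_S, IH, sumR_S; ring.
Qed.

(** With D = xi d/dxi and theta = z d/dz, the operator D + t acts on the transformed series as
    (1 - z) theta + t - y z does on the original one; the sequence on the left is the coefficient form of the latter. *)
Lemma pfaff_theta y t g N :
  pfaff y (fun k => (INR k + t) * g k - lag (fun i => (INR i + y) * g i) k) N
  = (INR N + t) * pfaff y g N.
Proof.
  rewrite pfaff_minus.
  rewrite <- (pfaff_bound y (lag _) N (S N)) by lia.
  rewrite sumR_shift. cbn [lag]. rewrite Rmult_0_r, Rplus_0_l.
  unfold pfaff. rewrite <- sumR_scal, <- sumR_minus.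
  apply sumR_ext; intros k.
  pose proof (pfaff_coef_star y N k) as H.
  transitivity (pfaff_coef y N k * ((INR k + t) * g k) - ((INR k + y) * pfaff_coef y N (S k)) * g k); [ring|].
  rewrite H; ring.
Qed.

(** Coefficient form of D (D + x) r = - beta xi/(1 - xi)^2 r with D = xi d/dxi, which is the
    hypergeometric equation with a + b = 1, a b = beta, c = x + 1 in the variable xi.  The full sum
    comes from the double pole, after one difference in N. *)
Definition ode_rec (beta x : R) (r : nat -> R) : Prop :=
  forall N, INR (S N) * (INR (S N) + x) * r (S N)
    = INR N * (INR N + x) * r N - beta * sum_f_R0 r N.

(** The hypothesis is the equation in z, in which D (D + x) acts as multiplication by beta z (1 - z);
    [pfaff_theta] is applied twice, with t = x and then with t = 0. *)
Lemma pfaff_ode (beta x y : R) (e : nat -> R) :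
  (forall k,
     let v := fun k => (INR k + x) * e k - lag (fun i => (INR i + y) * e i) k in
     INR k * v k - lag (fun i => (INR i + y) * v i) k
     = beta * (lag e k - lag (lag e) k)) ->
  ode_rec beta x (pfaff y e).
Proof.
  intros H N.
  set (v := fun k => (INR k + x) * e k - lag (fun i => (INR i + y) * e i) k) in H.
  assert (Hu : forall M, pfaff y (fun k => beta * (lag e k - lag (lag e) k)) M
                         = INR M * (INR M + x) * pfaff y e M).
  { intros M. rewrite <- (pfaff_ext y _ _ M H).
    rewrite (pfaff_ext y _ (fun k => (INR k + 0) * v k - lag (fun i => (INR i + y) * v i) k))
      by (intros; rewrite Rplus_0_r; reflexivity).
    rewrite pfaff_theta. unfold v. rewrite pfaff_theta. ring. }
  rewrite <- !Hu, !pfaff_scal, !pfaff_minus, (pfaff_lag_S y (lag e)), pfaff_lag_S.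
  destruct N as [|N].
  - rewrite !pfaff_lag_0, sumR_0; ring.
  - rewrite pfaff_lag, sumR_S; ring.
Qed.

Lemma ode_rec_unique beta x r s :
  0 <= x -> ode_rec beta x r -> ode_rec beta x s -> r O = s O ->
  forall n, r n = s n.
Proof.
  intros Hx Hr Hs H0.
  assert (H : forall n, (forall m, (m <= n)%nat -> r m = s m)).
  { induction n as [|n IH]; intros m Hm.
    - replace m with O by lia; assumption.
    - destruct (Nat.eq_dec m (S n)) as [->|]; [|apply IH; lia].
      pose proof (pos_INR n).
      apply Rmult_eq_reg_l with (INR (S n) * (INR (S n) + x)).
      2:{ rewrite S_INR; apply Rmult_integral_contrapositive; lra. }
      rewrite Hr, Hs, (IH n) by lia.
      rewrite (sumR_ext_loc r s n) by (intros; apply IH; lia). reflexivity. }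
  intros n; apply (H n); lia.
Qed.

(** The product (a)_k (b)_k for a + b = 1 and a b = beta, that is, a, b = 1/2 - nu, 1/2 + nu.
    Working with beta keeps everything real and positive, also when nu is imaginary. *)
Fixpoint quad_poch (beta : R) (k : nat) : R :=
  match k with O => 1 | S m => quad_poch beta m * (INR m * INR m + INR m + beta) end.

(** The Pochhammer symbol of a real number. *)
Fixpoint rising (x : R) (k : nat) : R :=
  match k with O => 1 | S m => rising x m * (x + INR m) end.

Lemma rising_pos x k : 0 < x -> 0 < rising x k.
Proof.
  intros; induction k; simpl; [lra|].
  pose proof (pos_INR k); apply Rmult_lt_0_compat; lra.
Qed.

Lemma quad_poch_pos b k : 0 < b -> 0 < quad_poch b k.
Proof.
  intros; induction k; simpl; [lra|].
  pose proof (pos_INR k). apply Rmult_lt_0_compat; [lra|]. nra.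
Qed.

(** Coefficients of phi_1(x) in powers of z. *)
Definition phi1_hyp (beta x : R) (k : nat) : R :=
  quad_poch beta k / (rising (x + 1) k * INR (fact k)).

(** Coefficients of phi_1(x) in powers of xi. *)
Definition phi_coef (beta x : R) : nat -> R := pfaff 0 (phi1_hyp beta x).

Lemma phi1_hyp_S beta x k : 0 <= x ->
  INR (S k) * (INR (S k) + x) * phi1_hyp beta x (S k)
  = (INR k * INR k + INR k + beta) * phi1_hyp beta x k.
Proof.
  intros Hx; unfold phi1_hyp.
  assert (rising (x + 1) k <> 0) by (apply Rgt_not_eq, rising_pos; lra).
  pose proof (INR_fact_neq_0 k).
  rewrite fact_simpl, mult_INR. cbn [quad_poch rising]. rewrite S_INR.
  pose proof (pos_INR k). field. repeat split; lra.
Qed.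

Lemma phi_coef_rec beta x : 0 <= x -> ode_rec beta x (phi_coef beta x).
Proof.
  intros Hx; apply pfaff_ode; intros [|[|k]]; cbn [lag].
  - simpl (INR 0); ring.
  - pose proof (phi1_hyp_S beta x 0 Hx) as H. simpl (INR 0) in *. simpl (INR 1) in *.
    transitivity (1 * (1 + x) * phi1_hyp beta x 1 ); [ring|]. rewrite H; ring.
  - pose proof (phi1_hyp_S beta x k Hx) as H. pose proof (phi1_hyp_S beta x (S k) Hx) as H1.
    rewrite !S_INR in *.
    match goal with |- ?l = _ => transitivity
      (((INR k + 1 + 1) * (INR k + 1 + 1 + x) * phi1_hyp beta x (S (S k)))
       - ((INR k + 1 + 1) * (INR k + 1 + 0) * phi1_hyp beta x (S k))
       - ((INR k + 1) * (INR k + 1 + x) * phi1_hyp beta x (S k))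
       + (INR k + 1 + 0) * (INR k + 0) * phi1_hyp beta x k); [ring|] end.
    rewrite H1, H; ring.
Qed.

(** Coefficients in z of 2F1(a + y, b + y; y + 1; z), the function produced by the residue of phi_1 at the pole x = -y. *)
Definition euler_coef (beta : R) (y j : nat) : R :=
  quad_poch beta (y + j) * INR (fact y) / (quad_poch beta y * INR (fact (y + j)) * INR (fact j)).

Lemma euler_coef_S beta y k : 0 < beta ->
  INR (S k) * (INR (S k) + INR y) * euler_coef beta y (S k)
  = ((INR k + INR y) * (INR k + INR y + 1) + beta) * euler_coef beta y k.
Proof.
  intros Hb; unfold euler_coef.
  replace (y + S k)%nat with (S (y + k)) by lia.
  assert (quad_poch beta y <> 0) by (apply Rgt_not_eq, quad_poch_pos; lra).
  pose proof (INR_fact_neq_0 k). pose proof (INR_fact_neq_0 (y + k)).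
  pose proof (pos_INR k). pose proof (pos_INR y).
  rewrite !fact_simpl, !mult_INR. cbn [quad_poch]. rewrite !S_INR, !plus_INR.
  field. repeat split; lra.
Qed.

(** Euler's transformation: (1 - z)^y 2F1(a + y, b + y; y + 1; z) = 2F1(a, b; y + 1; z) when a + b = 1, written in the variable xi.
    Both sides satisfy the same recurrence. *)
Lemma pfaff_euler_coef beta y n : 0 < beta -> pfaff (INR y) (euler_coef beta y) n = phi_coef beta (INR y) n.
Proof.
  intros Hb. pose proof (pos_INR y) as Hy.
  apply (ode_rec_unique beta (INR y)); [assumption| |apply phi_coef_rec; assumption|].
  2:{ unfold phi_coef; rewrite !pfaff_0. unfold euler_coef, phi1_hyp. simpl.
      rewrite Nat.add_0_r. assert (quad_poch beta y <> 0) by (apply Rgt_not_eq, quad_poch_pos; lra).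
      pose proof (INR_fact_neq_0 y). field. split; assumption. }
  apply pfaff_ode; intros [|[|k]]; cbn [lag].
  - simpl (INR 0); ring.
  - pose proof (euler_coef_S beta y 0 Hb) as H. simpl (INR 0) in *. simpl (INR 1) in *.
    transitivity (1 * (1 + INR y) * euler_coef beta y 1 - INR y * euler_coef beta y 0 * (1 + INR y)); [ring|].
    rewrite H; ring.
  - pose proof (euler_coef_S beta y k Hb) as H. pose proof (euler_coef_S beta y (S k) Hb) as H1.
    rewrite !S_INR in *.
    set (s := INR k) in *. set (Y := INR y) in *.
    set (e0 := euler_coef beta y k) in *. set (e1 := euler_coef beta y (S k)) in *. set (e2 := euler_coef beta y (S (S k))) in *.
    transitivity ((s + 1 + 1) * (s + 1 + 1 + Y) * e2 - (s + 1 + 1) * (s + 1 + Y) * e1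
       - (s + 1 + Y) * (s + 1 + Y) * e1 + (s + 1 + Y) * (s + Y) * e0); [ring|].
    rewrite H1.
    transitivity (beta * e1 - (s + 1 + Y) * (s + Y) * e1 + (s + 1 + Y) * (s + Y) * e0
       + (s + Y) * (s + 1 + Y) * e1 - ((s + 1) * (s + 1 + Y) * e1)); [ring|].
    rewrite H; ring.
Qed.

(** * The convolution identity between the coefficients of B *)

(** The i-th coefficient in the partial fraction expansion of 1/((x + 1) ... (x + k + 1)). *)
Definition pf_coef (k i : nat) : R := (-1) ^ i / (INR (fact i) * INR (fact (k - i))).

(** Split the factor k + 1 as (k + 1 - i) + i; each part lowers one of the two factorials. *)
Lemma pf_coef_rec k (F : nat -> R) :
  (INR k + 1) * sum_f_R0 (fun i => pf_coef (S k) i * F i) (S k)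
  = sum_f_R0 (fun i => pf_coef k i * (F i - F (S i))) k.
Proof.
  assert (E : (INR k + 1) * sum_f_R0 (fun i => pf_coef (S k) i * F i) (S k)
    = sum_f_R0 (fun i => (INR (S k) - INR i) * pf_coef (S k) i * F i) (S k)
      + sum_f_R0 (fun i => INR i * pf_coef (S k) i * F i) (S k)).
  { rewrite <- sumR_scal, <- sumR_plus. apply sumR_ext; intros i. rewrite S_INR; ring. }
  rewrite E, sumR_S, (sumR_shift (fun i => INR i * _ * _)), Rminus_diag. simpl (INR 0).
  rewrite !Rmult_0_l, Rplus_0_r, Rplus_0_l, <- sumR_plus.
  apply sumR_ext_loc; intros i Hi.
  assert (H1 : (INR (S k) - INR i) * pf_coef (S k) i = pf_coef k i).
  { unfold pf_coef. replace (S k - i)%nat with (S (k - i)) by lia.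
    rewrite (fact_simpl (k - i)), mult_INR, <- minus_INR by lia.
    replace (S k - i)%nat with (S (k - i)) by lia.
    pose proof (INR_fact_neq_0 i). pose proof (INR_fact_neq_0 (k - i)).
    assert (INR (S (k - i)) <> 0) by (apply not_0_INR; lia). field; auto. }
  assert (H2 : INR (S i) * pf_coef (S k) (S i) = - pf_coef k i).
  { unfold pf_coef. replace (S k - S i)%nat with (k - i)%nat by lia.
    rewrite (fact_simpl i), mult_INR. simpl pow.
    pose proof (INR_fact_neq_0 i). pose proof (INR_fact_neq_0 (k - i)).
    assert (INR (S i) <> 0) by (apply not_0_INR; lia). field; auto. }
  rewrite H1, H2; ring.
Qed.

Lemma rising_shift x k : rising x (S k) = x * rising (x + 1) k.
Proof.
  induction k as [|k IH]; [simpl; ring|].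
  change (rising x (S (S k))) with (rising x (S k) * (x + INR (S k))).
  rewrite IH, S_INR. simpl rising. ring.
Qed.

Lemma partial_fractions k : forall x, 0 <= x ->
  sum_f_R0 (fun i => pf_coef k i * / (x + INR (S i))) k = / rising (x + 1) (S k).
Proof.
  induction k as [|k IH]; intros x Hx.
  - simpl. unfold pf_coef; simpl. field; lra.
  - pose proof (pos_INR k).
    apply Rmult_eq_reg_l with (INR k + 1); [|lra].
    rewrite (pf_coef_rec k (fun i => / (x + INR (S i)))).
    rewrite (sumR_ext _ (fun i => pf_coef k i * / (x + INR (S i))
                                   - pf_coef k i * / (x + 1 + INR (S i)))).
    2:{ intros i. rewrite (S_INR (S i)).
        replace (x + 1 + INR (S i)) with (x + (INR (S i) + 1)) by ring. ring. }
    rewrite sumR_minus, (IH x), (IH (x + 1)) by lra.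
    change (rising (x + 1) (S (S k))) with (rising (x + 1) (S k) * (x + 1 + INR (S k))).
    rewrite (rising_shift (x + 1)). simpl (rising (x + 1 + 1) (S k)).
    assert (rising (x + 1 + 1) k <> 0) by (apply Rgt_not_eq, rising_pos; lra).
    rewrite S_INR. field. repeat split; lra.
Qed.

Lemma sum_triangle (G : nat -> nat -> R) N :
  sum_f_R0 (fun k => sum_f_R0 (fun i => G i k) k) N
  = sum_f_R0 (fun i => sum_f_R0 (fun j => G i (i + j)%nat) (N - i)) N.
Proof.
  induction N as [|N IH]; [reflexivity|].
  rewrite (sumR_S (fun k => sum_f_R0 _ k)), IH, (sumR_S _ N).
  rewrite (sumR_S (fun i => sum_f_R0 (fun j => G i (i + j)%nat) (S N - i)) N), Nat.sub_diag.
  simpl (sum_f_R0 (fun j => G (S N) (S N + j)%nat) 0). rewrite Nat.add_0_r.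
  rewrite <- Rplus_assoc, <- sumR_plus. f_equal.
  apply sumR_ext_loc; intros i Hi.
  replace (S N - i)%nat with (S (N - i)) by lia. rewrite sumR_S.
  replace (i + S (N - i))%nat with (S N) by lia. reflexivity.
Qed.

(** The coefficient of xi^y in 2 y psi(y). *)
Definition weight_coef (beta : R) (y : nat) : R :=
  quad_poch beta y / (INR (fact (y - 1)) * INR (fact y)).

(** The equation for B in degree N + 1: expand 1/(x + 1)_k in partial fractions; the sum over k at a fixed pole -y is, up to
    the weight, the Euler-transformed series, hence phi_1(y). *)
Lemma phi_coef_convolution beta x N : 0 < beta -> 0 <= x ->
  phi_coef beta x (S N)
  + sum_f_R0 (fun i => weight_coef beta (S i) / (x + INR (S i)) * phi_coef beta (INR (S i)) (N - i)) N
  = 0.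
Proof.
  intros Hb Hx.
  unfold phi_coef at 1, pfaff. rewrite sumR_shift, pfaff_coef_0_0, Rmult_0_l, Rplus_0_l.
  rewrite (sumR_ext _ (fun k => sum_f_R0 (fun i =>
      pfaff_coef 0 (S N) (S k) * (quad_poch beta (S k) / INR (fact (S k)))
        * (pf_coef k i * / (x + INR (S i)))) k)).
  2:{ intros k. rewrite sumR_scal, partial_fractions by assumption. unfold phi1_hyp.
      assert (rising (x + 1) (S k) <> 0) by (apply Rgt_not_eq, rising_pos; lra).
      pose proof (INR_fact_neq_0 (S k)). field; auto. }
  (* Exchange the sums: the pole is -(i + 1), and j = k - i runs over the series attached to it. *)
  rewrite sum_triangle, <- sumR_plus.
  rewrite (sumR_ext_loc _ (fun _ => 0 * 0)).
  { rewrite sumR_scal; ring. }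
  intros i Hi.
  rewrite <- pfaff_euler_coef by assumption. unfold pfaff.
  rewrite <- sumR_scal, <- sumR_plus.
  rewrite (sumR_ext_loc _ (fun _ => 0 * 0)).
  { rewrite sumR_scal; ring. }
  intros j Hj.
  rewrite pfaff_coef_raise_n. replace (N - i + S i)%nat with (S N) by lia.
  replace (j + S i)%nat with (S (i + j)) by lia.
  unfold weight_coef, euler_coef, pf_coef. replace (S i - 1)%nat with i by lia.
  replace (i + j - i)%nat with j by lia.
  replace (S i + j)%nat with (S (i + j)) by lia.
  assert (quad_poch beta (S i) <> 0) by (apply Rgt_not_eq, quad_poch_pos; lra).
  pose proof (INR_fact_neq_0 (S i)). pose proof (INR_fact_neq_0 i).
  pose proof (INR_fact_neq_0 j). pose proof (INR_fact_neq_0 (S (i + j))).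
  assert (x + INR (S i) <> 0) by (rewrite S_INR; pose proof (pos_INR i); lra).
  change ((-1) ^ S i) with (-1 * (-1) ^ i). field; repeat split; auto.
Qed.

(** The weight of y has degree y in xi, so the total degree can be moved inside: replace x + 2 n by
    (y + 2 (n - y)) + (x + y); the last term cancels the denominator x + y and leaves a sum free of x. *)
Lemma Acoef_convolution beta x N : 0 < beta -> 0 <= x ->
  (x + 2 * INR (S N)) * phi_coef beta x (S N)
  + sum_f_R0 (fun i => weight_coef beta (S i) / (x + INR (S i))
       * ((INR (S i) + 2 * INR (N - i)) * phi_coef beta (INR (S i)) (N - i))) N
  = - sum_f_R0 (fun i => weight_coef beta (S i) * phi_coef beta (INR (S i)) (N - i)) N.
Proof.
  intros Hb Hx.
  pose proof (phi_coef_convolution beta x N Hb Hx) as H.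
  apply (f_equal (Rmult (x + 2 * INR (S N)))) in H.
  rewrite Rmult_0_r, Rmult_plus_distr_l, <- sumR_scal in H.
  rewrite (sumR_ext_loc _ (fun i =>
    (x + 2 * INR (S N)) * (weight_coef beta (S i) / (x + INR (S i)) * phi_coef beta (INR (S i)) (N - i))
    - weight_coef beta (S i) * phi_coef beta (INR (S i)) (N - i))).
  2:{ intros i Hi. rewrite minus_INR, !S_INR by assumption.
      assert (x + (INR i + 1) <> 0) by (pose proof (pos_INR i); lra).
      field; assumption. }
  rewrite sumR_minus. lra.
Qed.

Lemma pfaff_k (g : nat -> R) N :
  pfaff 0 (fun k => INR k * g k) (S N) = INR (S N) * pfaff 0 g (S N) - INR N * pfaff 0 g N.
Proof.
  assert (H : forall M, pfaff 0 (fun k => INR k * g k) M - pfaff 0 (lag (fun k => INR k * g k)) M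
                        = INR M * pfaff 0 g M).
  { intros M. pose proof (pfaff_theta 0 0 g M) as H. rewrite Rplus_0_r in H.
    rewrite <- H, <- pfaff_minus. apply pfaff_ext; intros [|k]; cbn [lag]; [|rewrite !Rplus_0_r]; ring. }
  pose proof (H (S N)) as H1. pose proof (H N) as H2. rewrite pfaff_lag_S in H1. lra.
Qed.

(** Contiguity between x + 1 and x, from (x + 1)_k (x + 1 + k) = (x + 1) (x + 2)_k on the coefficients in z. *)
Lemma phi_coef_lower beta x N : 0 <= x ->
  (x + 1) * phi_coef beta x (S N)
  = (x + 1) * phi_coef beta (x + 1) (S N)
    + (INR (S N) * phi_coef beta (x + 1) (S N) - INR N * phi_coef beta (x + 1) N).
Proof.
  intros Hx. unfold phi_coef at 3 4. rewrite <- pfaff_k. unfold phi_coef.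
  rewrite <- !pfaff_scal, <- pfaff_plus. apply pfaff_ext; intros k. unfold phi1_hyp.
  assert (rising (x + 1) k <> 0) by (apply Rgt_not_eq, rising_pos; lra).
  assert (rising (x + 1 + 1) k <> 0) by (apply Rgt_not_eq, rising_pos; lra).
  pose proof (INR_fact_neq_0 k).
  pose proof (rising_shift (x + 1) k) as E. simpl rising in E.
  apply Rmult_eq_reg_l with (rising (x + 1) k * rising (x + 1 + 1) k * INR (fact k)).
  2:{ repeat apply Rmult_integral_contrapositive_currified; assumption. }
  transitivity (quad_poch beta k * ((x + 1) * rising (x + 1 + 1) k)); [field; auto|].
  rewrite <- E. field; auto.
Qed.

Lemma phi_coef_lower_deriv beta x N : 0 <= x ->
  (x + 1) * INR (S N) * phi_coef beta x (S N)
  = x * INR N * phi_coef beta (x + 1) N - beta * sum_f_R0 (phi_coef beta (x + 1)) N.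
Proof.
  intros Hx.
  transitivity (INR (S N) * ((x + 1) * phi_coef beta x (S N))); [ring|].
  rewrite phi_coef_lower by assumption.
  pose proof (phi_coef_rec beta (x + 1) ltac:(lra) N) as E.
  transitivity (INR (S N) * (INR (S N) + (x + 1)) * phi_coef beta (x + 1) (S N)
                - INR (S N) * INR N * phi_coef beta (x + 1) N); [ring|].
  rewrite E, S_INR; ring.
Qed.

Lemma phi_coef_0 beta x : phi_coef beta x 0 = 1.
Proof. unfold phi_coef; rewrite pfaff_0. unfold phi1_hyp; simpl. field. Qed.

Lemma abs_sum_le (g : nat -> R) N : Rabs (sum_f_R0 g N) <= sum_f_R0 (fun k => Rabs (g k)) N.
Proof. apply Rsum_abs. Qed.

(** All radii below 1 are reached, uniformly in x: by [ode_rec] each coefficient is beta/n^2 times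
    a weighted sum of the previous ones, so the constant can increase only for the finitely many n at which n^2 is small compared with beta. *)
Lemma phi_coef_bound beta r : 0 < beta -> 1 < r ->
  exists K, 0 <= K /\ forall (x : R) n, 0 <= x -> Rabs (phi_coef beta x n) <= K * r ^ n.
Proof.
  intros Hb HR.
  (* If the partial sums up to degree n are at most K r^n, then n (n + x) times the n-th coefficient is at most q K r^n;
     Q bounds the growth of K in one step. *)
  set (q := beta / (r - 1)). assert (Hq : 0 < q) by (apply Rdiv_lt_0_compat; lra).
  assert (Hbq : beta = q * (r - 1)) by (unfold q; field; lra).
  set (Q := 1 + q).
  (* From degree M on, the factor 1/n^2 outweighs q and the constant no longer changes. *)
  destruct (INR_unbounded (q * r / (r - 1))) as [M HM].
  set (good := fun (x : R) (n : nat) (K : R) =>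
     sum_f_R0 (fun k => Rabs (phi_coef beta x k)) n <= K * r ^ n /\
     Rabs (INR n * (INR n + x) * phi_coef beta x n) <= q * K * r ^ n).
  assert (Hstep : forall x n K, 0 <= x -> 0 <= K -> good x n K ->
     Rabs (INR (S n) * (INR (S n) + x) * phi_coef beta x (S n)) <= q * K * r ^ S n /\
     Rabs (phi_coef beta x (S n)) * (INR (S n) * INR (S n)) <= q * K * r ^ S n).
  { intros x n K Hx HK [H1 H2].
    assert (A : Rabs (INR (S n) * (INR (S n) + x) * phi_coef beta x (S n)) <= q * K * r ^ S n).
    { rewrite (phi_coef_rec beta x Hx n).
      eapply Rle_trans; [apply Rabs_triang|]. rewrite Rabs_Ropp, (Rabs_mult beta), (Rabs_pos_eq beta) by lra.
      pose proof (abs_sum_le (phi_coef beta x) n).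
      assert (beta * Rabs (sum_f_R0 (phi_coef beta x) n) <= beta * (K * r ^ n))
        by (apply Rmult_le_compat_l; lra).
      simpl pow. assert (E : q * K * (r * r ^ n) = q * K * r ^ n + beta * (K * r ^ n)) by (rewrite Hbq; ring). lra. }
    split; [exact A|]. eapply Rle_trans; [|exact A].
    assert (0 < INR (S n)) by (apply lt_0_INR; lia).
    rewrite Rabs_mult, (Rmult_comm (Rabs (phi_coef _ _ _))). apply Rmult_le_compat_r; [apply Rabs_pos|].
    rewrite Rabs_pos_eq by nra. nra. }
  assert (Hmono : forall x n K K', K <= K' -> good x n K -> good x n K').
  { intros x n K K' HK [H1 H2]. assert (0 < r ^ n) by (apply pow_lt; lra).
    split; [apply Rle_trans with (1 := H1)|apply Rle_trans with (1 := H2)];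
    [|rewrite !Rmult_assoc; apply Rmult_le_compat_l; [lra|]];
    apply Rmult_le_compat_r; lra. }
  assert (HQ1 : 1 <= Q) by (unfold Q; lra).
  assert (Hgrow : forall x n, 0 <= x -> good x n (Q ^ n)).
  { intros x n Hx; induction n as [|n IH].
    - split; simpl; rewrite ?phi_coef_0, ?Rmult_0_l, ?Rabs_R0, ?Rabs_R1; lra.
    - pose proof (pow_R1_Rle Q n HQ1) as HQn.
      destruct (Hstep x n (Q ^ n) Hx ltac:(lra) IH) as [H1 H2]. destruct IH as [H3 H4].
      assert (HRn : 0 < r ^ n) by (apply pow_lt; lra).
      assert (Hp : 0 < Q ^ n * r ^ n) by (apply Rmult_lt_0_compat; lra).
      split.
      + rewrite sumR_S.
        assert (Rabs (phi_coef beta x (S n)) <= Rabs (phi_coef beta x (S n)) * (INR (S n) * INR (S n))).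
        { rewrite <- (Rmult_1_r (Rabs _)) at 1. apply Rmult_le_compat_l; [apply Rabs_pos|].
          assert (1 <= INR (S n)) by (rewrite S_INR; pose proof (pos_INR n); lra). nra. }
        simpl pow in *. unfold Q at 1. nra.
      + eapply Rle_trans; [exact H1|]. simpl pow in *.
        assert (0 < q * (Q ^ n * (r * r ^ n))) by (apply Rmult_lt_0_compat; [exact Hq|]; apply Rmult_lt_0_compat; [lra|]; apply Rmult_lt_0_compat; lra).
        replace (q * (Q * Q ^ n) * (r * r ^ n)) with (Q * (q * (Q ^ n * (r * r ^ n)))) by ring.
        replace (q * Q ^ n * (r * r ^ n)) with (q * (Q ^ n * (r * r ^ n))) by ring. nra. }
  exists (Q ^ M). split; [apply pow_le; lra|].
  assert (Hall : forall x n, 0 <= x -> good x n (Q ^ M)).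
  { intros x n Hx. destruct (Nat.le_gt_cases n M) as [Hn|Hn].
    - apply Hmono with (Q ^ n); [apply Rle_pow; auto|auto].
    - apply Nat.lt_le_incl in Hn. induction Hn as [|n Hn IH]; [auto|].
      pose proof (pow_R1_Rle Q M HQ1) as HQn.
      destruct (Hstep x n (Q ^ M) Hx ltac:(lra) IH) as [H1 H2]. split; [|exact H1].
      destruct IH as [H3 H4]. rewrite sumR_S.
      assert (HRn : 0 < r ^ n) by (apply pow_lt; lra).
      assert (Hn2 : INR M <= INR n) by (apply le_INR; lia).
      assert (Hbig : q * r <= (r - 1) * (INR (S n) * INR (S n))).
      { assert (q * r < INR M * (r - 1)).
        { apply Rmult_lt_reg_r with (/ (r - 1)); [apply Rinv_0_lt_compat; lra|].
          replace (INR M * (r - 1) * / (r - 1)) with (INR M) by (field; lra). exact HM. }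
        rewrite S_INR. pose proof (pos_INR n). nra. }
      assert (Hh : Rabs (phi_coef beta x (S n)) <= Q ^ M * r ^ n * (r - 1)).
      { assert (0 < INR (S n)) by (apply lt_0_INR; lia).
        apply Rmult_le_reg_r with (INR (S n) * INR (S n)); [nra|].
        eapply Rle_trans; [exact H2|]. simpl pow.
        assert (0 < Q ^ M * r ^ n) by (apply Rmult_lt_0_compat; lra). nra. }
      simpl pow. lra. }
  intros x n Hx. destruct (Hall x n Hx) as [H1 _].
  eapply Rle_trans; [|exact H1].
  destruct n; [simpl; lra|]. rewrite sumR_S.
  assert (0 <= sum_f_R0 (fun k => Rabs (phi_coef beta x k)) n)
    by (apply cond_pos_sum; intros; apply Rabs_pos). lra.
Qed.

(** * Double series, real and complex *)

Lemma is_series_fin (f : nat -> nat -> R) (l : nat -> R) J :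
  (forall j, is_series (f j) (l j)) ->
  is_series (fun i => sum_f_R0 (fun j => f j i) J) (sum_f_R0 l J).
Proof.
  intros H; induction J as [|J IH]; [apply H|].
  rewrite sumR_S. exact (is_series_plus _ _ _ _ IH (H (S J))).
Qed.

Lemma series_nonneg_bounded (u : nat -> R) M :
  (forall n, 0 <= u n) -> (forall n, sum_f_R0 u n <= M) ->
  ex_series u /\ Series u <= M.
Proof.
  intros Hu HM.
  assert (Hex : ex_finite_lim_seq (sum_n u)).
  { apply ex_finite_lim_seq_incr with M.
    - intros n; rewrite !sum_n_Reals, sumR_S; specialize (Hu (S n)); lra.
    - intros n; rewrite sum_n_Reals; apply HM. }
  destruct Hex as [l Hl].
  split; [exists l; exact Hl|].
  rewrite (is_series_unique u l Hl).
  apply (is_lim_seq_le (sum_n u) (fun _ => M) l M); [|exact Hl|apply is_lim_seq_const].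
  intros n; rewrite sum_n_Reals; apply HM.
Qed.

Lemma sum_le_series (u : nat -> R) n :
  (forall n, 0 <= u n) -> ex_series u -> sum_f_R0 u n <= Series u.
Proof.
  intros Hu [l Hl]. rewrite (is_series_unique u l Hl), <- sum_n_Reals.
  apply (is_lim_seq_incr_compare (sum_n u) l Hl).
  intros m; rewrite !sum_n_Reals, sumR_S; specialize (Hu (S m)); lra.
Qed.

Lemma term_le_series (u : nat -> R) n :
  (forall n, 0 <= u n) -> ex_series u -> u n <= Series u.
Proof.
  intros Hu Hex. eapply Rle_trans; [|exact (sum_le_series u n Hu Hex)].
  destruct n; [simpl; lra|]. rewrite sumR_S.
  pose proof (cond_pos_sum u n Hu); lra.
Qed.

Lemma ex_series_leR (u v : nat -> R) : (forall n, Rabs (u n) <= v n) -> ex_series v -> ex_series u.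
Proof. exact (@ex_series_le R_AbsRing R_CompleteNormedModule u v). Qed.

(** One inequality suffices: it can be applied again to the transposed family. *)
Lemma tonelli_half (b : nat -> nat -> R) :
  (forall i j, 0 <= b i j) -> (forall i, ex_series (b i)) ->
  ex_series (fun i => Series (b i)) ->
  (forall j, ex_series (fun i => b i j)) /\
  ex_series (fun j => Series (fun i => b i j)) /\
  Series (fun j => Series (fun i => b i j)) <= Series (fun i => Series (b i)).
Proof.
  intros Hb Hrow Hex.
  assert (Hcol : forall j, ex_series (fun i => b i j)).
  { intros j. apply (ex_series_leR _ (fun i => Series (b i))); [|exact Hex].
    intros i. cbv beta.
    rewrite Rabs_pos_eq by apply Hb. apply term_le_series; auto. }
  split; [exact Hcol|].
  apply series_nonneg_bounded.
  - intros j. destruct (Hcol j) as [l Hl].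
    eapply Rle_trans; [apply (Hb O j)|].
    apply (term_le_series (fun i => b i j) O); [intros; apply Hb|exists l; exact Hl].
  - intros J.
    assert (H : is_series (fun i => sum_f_R0 (fun j => b i j) J)
                          (sum_f_R0 (fun j => Series (fun i => b i j)) J)).
    { apply (is_series_fin (fun j i => b i j)). intros j; apply Series_correct, Hcol. }
    rewrite <- (is_series_unique _ _ H).
    apply Series_le; [|exact Hex].
    intros i; split; [apply cond_pos_sum; auto|apply sum_le_series; auto].
Qed.

Lemma tonelli (b : nat -> nat -> R) :
  (forall i j, 0 <= b i j) -> (forall i, ex_series (b i)) ->
  ex_series (fun i => Series (b i)) ->
  is_series (fun j => Series (fun i => b i j)) (Series (fun i => Series (b i))).
Proof.
  intros Hb Hrow Hex.
  destruct (tonelli_half b Hb Hrow Hex) as (H1 & H2 & H3).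
  destruct (tonelli_half (fun j i => b i j) (fun i j => Hb j i) H1 H2) as (_ & _ & H4).
  replace (Series (fun i => Series (b i))) with (Series (fun j => Series (fun i => b i j))).
  - apply Series_correct, H2.
  - apply Rle_antisym; assumption.
Qed.

Definition abs_summable2 (a : nat -> nat -> R) : Prop :=
  (forall i, ex_series (fun j => Rabs (a i j))) /\
  ex_series (fun i => Series (fun j => Rabs (a i j))).

Lemma fubini_cols (a : nat -> nat -> R) : abs_summable2 a ->
  abs_summable2 (fun j i => a i j).
Proof.
  intros [H1 H2].
  destruct (tonelli_half (fun i j => Rabs (a i j)) (fun _ _ => Rabs_pos _) H1 H2)
    as (H3 & H4 & _).
  split; assumption.
Qed.

Lemma abs_summable2_rows (a : nat -> nat -> R) : abs_summable2 a ->
  ex_series (fun i => Rabs (Series (a i))).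
Proof.
  intros [H1 H2].
  apply (ex_series_leR _ (fun i => Series (fun j => Rabs (a i j)))); [|exact H2].
  intros i. cbv beta.
  rewrite Rabs_Rabsolu. apply Series_Rabs, H1.
Qed.

Lemma fubini (a : nat -> nat -> R) : abs_summable2 a ->
  is_series (fun j => Series (fun i => a i j)) (Series (fun i => Series (a i))).
Proof.
  intros H. pose proof (fubini_cols a H) as Hc. destruct H as [H1 H2].
  set (p := fun i j => (Rabs (a i j) + a i j)).
  assert (Hp : forall i j, 0 <= p i j).
  { intros; unfold p. pose proof (Rle_abs (- a i j)). rewrite Rabs_Ropp in *. lra. }
  assert (Hrow : forall i, is_series (p i) (Series (fun j => Rabs (a i j)) + Series (a i))).
  { intros i. apply (is_series_plus (fun j => Rabs (a i j)) (a i)); apply Series_correct; auto.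
    apply ex_series_Rabs, H1. }
  assert (Hcol : forall j, is_series (fun i => p i j)
     (Series (fun i => Rabs (a i j)) + Series (fun i => a i j))).
  { intros j. apply (is_series_plus (fun i => Rabs (a i j)) (fun i => a i j)); apply Series_correct.
    - apply (proj1 Hc). - apply ex_series_Rabs, (proj1 Hc). }
  assert (Hrr : ex_series (fun i => Series (a i))).
  { apply ex_series_Rabs, (abs_summable2_rows a); split; assumption. }
  assert (HT := tonelli (fun i j => Rabs (a i j)) (fun _ _ => Rabs_pos _) H1 H2).
  assert (HP : is_series (fun j => Series (fun i => p i j)) (Series (fun i => Series (p i)))).
  { apply tonelli; [exact Hp| |].
    - intros i; eexists; apply Hrow.
    - eapply ex_series_ext; [intros i; symmetry; apply is_series_unique, Hrow|].
      apply (ex_series_plus (fun i => Series (fun j => Rabs (a i j)))); assumption. }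
  pose proof (is_series_minus _ _ _ _ HP HT) as HD.
  match type of HD with is_series _ ?l =>
    replace (Series (fun i => Series (a i))) with l end.
  - eapply is_series_ext; [|exact HD]. intros j.
    change (Series (fun i => p i j) - Series (fun i => Rabs (a i j)) = Series (fun i => a i j)).
    rewrite (is_series_unique _ _ (Hcol j)). ring.
  - change (Series (fun i => Series (p i)) - Series (fun i => Series (fun j => Rabs (a i j)))
            = Series (fun i => Series (a i))).
    rewrite (Series_ext (fun i => Series (p i))
               (fun i => Series (fun j => Rabs (a i j)) + Series (a i)))
      by (intros; apply is_series_unique, Hrow).
    rewrite Series_plus by assumption. ring.
Qed.

(** Componentwise form of convergence in C, so that the theory of real series applies to each part. *)
Definition is_cseries (f : nat -> C) (l : C) : Prop :=
  is_series (fun n => Re (f n)) (Re l) /\ is_series (fun n => Im (f n)) (Im l).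

Lemma Re_sum_n (f : nat -> C) n : Re (@sum_n C_AbelianMonoid f n) = sum_n (fun k => Re (f k)) n.
Proof.
  induction n as [|n IH]; [rewrite !sum_O; reflexivity|].
  rewrite !sum_Sn, <- IH. reflexivity.
Qed.

Lemma Im_sum_n (f : nat -> C) n : Im (@sum_n C_AbelianMonoid f n) = sum_n (fun k => Im (f k)) n.
Proof.
  induction n as [|n IH]; [rewrite !sum_O; reflexivity|].
  rewrite !sum_Sn, <- IH. reflexivity.
Qed.

Lemma is_cseries_iff (f : nat -> C) (l : C) :
  @is_series C_AbsRing C_NormedModule f l <-> is_cseries f l.
Proof.
  split.
  - intros H; split; unfold is_series in *.
    + apply filterlim_ext with (fun n => Re (@sum_n C_AbelianMonoid f n)); [intros; apply Re_sum_n|].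
      eapply filterlim_comp; [exact H|].
      intros P [d Hd]. exists d. intros y Hy. apply Hd, Hy.
    + apply filterlim_ext with (fun n => Im (@sum_n C_AbelianMonoid f n)); [intros; apply Im_sum_n|].
      eapply filterlim_comp; [exact H|].
      intros P [d Hd]. exists d. intros y Hy. apply Hd, Hy.
  - intros [H1 H2]. unfold is_series in *.
    intros P [d Hd].
    assert (B1 : locally (Re l) (ball (Re l) d)) by (exists d; auto).
    assert (B2 : locally (Im l) (ball (Im l) d)) by (exists d; auto).
    specialize (H1 _ B1). specialize (H2 _ B2).
    unfold filtermap in *.
    destruct H1 as [N1 H1]. destruct H2 as [N2 H2].
    exists (Nat.max N1 N2). intros n Hn. apply Hd. split.
    + specialize (H1 n ltac:(lia)). rewrite <- Re_sum_n in H1. exact H1.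
    + specialize (H2 n ltac:(lia)). rewrite <- Im_sum_n in H2. exact H2.
Qed.

Lemma is_cseries_unique f l l' : is_cseries f l -> is_cseries f l' -> l = l'.
Proof.
  intros [H1 H2] [H3 H4]. apply injective_projections.
  - change (Re l = Re l'). rewrite <- (is_series_unique _ _ H1). apply is_series_unique, H3.
  - change (Im l = Im l'). rewrite <- (is_series_unique _ _ H2). apply is_series_unique, H4.
Qed.

Lemma is_cseries_ext f g l : (forall n, f n = g n) -> is_cseries f l -> is_cseries g l.
Proof.
  intros H [H1 H2]; split.
  - exact (is_series_ext _ _ _ (fun n => f_equal Re (H n)) H1).
  - exact (is_series_ext _ _ _ (fun n => f_equal Im (H n)) H2).
Qed.

Lemma is_cseries_plus f g l m : is_cseries f l -> is_cseries g m ->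
  is_cseries (fun n => (f n + g n)%C) (l + m)%C.
Proof.
  intros [H1 H2] [H3 H4]; split.
  - exact (is_series_plus _ _ _ _ H1 H3). - exact (is_series_plus _ _ _ _ H2 H4).
Qed.

Lemma is_series_scalR (c : R) (f : nat -> R) l : is_series f l ->
  is_series (fun n => c * f n) (c * l).
Proof. intros H; exact (is_series_scal_l c f l H). Qed.

Lemma ex_series_scalR (c : R) (f : nat -> R) : ex_series f -> ex_series (fun n => c * f n).
Proof. intros [l H]; exists (c * l); apply is_series_scalR, H. Qed.

Lemma is_cseries_scal c f l : is_cseries f l ->
  is_cseries (fun n => (c * f n)%C) (c * l)%C.
Proof.
  intros [H1 H2]; split.
  - pose proof (is_series_minus _ _ _ _ (is_series_scalR (Re c) _ _ H1) (is_series_scalR (Im c) _ _ H2)) as H. exact H.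
  - pose proof (is_series_plus _ _ _ _ (is_series_scalR (Re c) _ _ H2) (is_series_scalR (Im c) _ _ H1)) as H. exact H.
Qed.

(** A total sum, meaningful for absolutely convergent series. *)
Definition Cser (f : nat -> C) : C := (Series (fun n => Re (f n)), Series (fun n => Im (f n))).

Lemma Re_le_Cmod z : Rabs (Re z) <= Cmod z.
Proof. exact (Rle_trans _ _ _ (Rmax_l _ _) (Rmax_Cmod z)). Qed.
Lemma Im_le_Cmod z : Rabs (Im z) <= Cmod z.
Proof. exact (Rle_trans _ _ _ (Rmax_r _ _) (Rmax_Cmod z)). Qed.

Lemma ex_series_dom (u v : nat -> R) : (forall n, Rabs (u n) <= v n) -> ex_series v ->
  ex_series (fun n => Rabs (u n)).
Proof.
  intros H Hv. apply (ex_series_leR _ v); [|exact Hv].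
  intros n; cbv beta; rewrite Rabs_Rabsolu; apply H.
Qed.

Lemma Cser_correct f : ex_series (fun n => Cmod (f n)) -> is_cseries f (Cser f).
Proof.
  intros H; split; apply Series_correct, ex_series_Rabs;
  (eapply ex_series_dom; [|exact H]); intros; [apply Re_le_Cmod|apply Im_le_Cmod].
Qed.

Lemma is_cseries_Cser f l : is_cseries f l -> Cser f = l.
Proof.
  intros [H1 H2]. unfold Cser. rewrite (is_series_unique _ _ H1), (is_series_unique _ _ H2).
  destruct l; reflexivity.
Qed.

Definition cabs_summable2 (a : nat -> nat -> C) : Prop :=
  abs_summable2 (fun i j => Cmod (a i j)).

Lemma abs_summable2_dom (a b : nat -> nat -> R) :
  (forall i j, Rabs (a i j) <= Rabs (b i j)) -> abs_summable2 b -> abs_summable2 a.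
Proof.
  intros H [H1 H2].
  assert (H3 : forall i, ex_series (fun j => Rabs (a i j))).
  { intros i. eapply ex_series_dom; [|apply (H1 i)]. intros; apply H. }
  split; [exact H3|].
  apply (ex_series_leR _ (fun i => Series (fun j => Rabs (b i j)))); [|exact H2].
  intros i. cbv beta.
  rewrite Rabs_pos_eq.
  - apply Series_le; [intros; split; [apply Rabs_pos|apply H]|apply H1].
  - eapply Rle_trans; [apply (Rabs_pos (a i O))|].
    apply (term_le_series (fun j => Rabs (a i j)) O); [intros; apply Rabs_pos|apply H3].
Qed.

Lemma cfubini (a : nat -> nat -> C) : cabs_summable2 a ->
  is_cseries (fun j => Cser (fun i => a i j)) (Cser (fun i => Cser (a i))).
Proof.
  intros H. split.
  - apply (fubini (fun i j => Re (a i j))).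
    eapply abs_summable2_dom; [|exact H]. intros; cbv beta.
    rewrite (Rabs_pos_eq (Cmod _)) by apply Cmod_ge_0. apply Re_le_Cmod.
  - apply (fubini (fun i j => Im (a i j))).
    eapply abs_summable2_dom; [|exact H]. intros; cbv beta.
    rewrite (Rabs_pos_eq (Cmod _)) by apply Cmod_ge_0. apply Im_le_Cmod.
Qed.

(** * Substituting a Moebius map into a power series *)

(** Coefficients of s/(1 - s) times a power series in s. *)
Definition lagsum (c : nat -> R) (k : nat) : R :=
  match k with O => 0 | S i => sum_f_R0 c i end.

Lemma is_cseries_RtoC (u : nat -> R) (l : R) :
  is_series u l -> is_cseries (fun n => RtoC (u n)) (RtoC l).
Proof.
  intros H; split; [exact H|].
  apply is_series_ext with (fun n => 0 * u n); [intros; apply Rmult_0_l|].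
  pose proof (is_series_scalR 0 u l H) as H0. rewrite (Rmult_0_l l) in H0. exact H0.
Qed.

Lemma is_cseries_RtoC_inv (u : nat -> R) (l : C) :
  is_cseries (fun n => RtoC (u n)) l -> is_series u (Re l).
Proof. intros [H _]; exact H. Qed.

Lemma is_cseries_shift (f : nat -> C) l :
  is_cseries (fun k => f (S k)) l -> is_cseries f (f O + l)%C.
Proof.
  intros [H1 H2]; split.
  - apply is_series_decr_1.
    match goal with |- is_series _ ?t => replace t with (Re l); [exact H1|] end.
    change (Re l = (Re (f O) + Re l) + - Re (f O)); ring.
  - apply is_series_decr_1.
    match goal with |- is_series _ ?t => replace t with (Im l); [exact H2|] end.
    change (Im l = (Im (f O) + Im l) + - Im (f O)); ring.
Qed.

Lemma one_minus_neq0 (s : C) : Cmod s < 1 -> (1 - s)%C <> 0.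
Proof.
  intros H E. assert (s = 1%C) by (replace s with (1 - (1 - s))%C by ring; rewrite E; ring).
  subst s. rewrite Cmod_1 in H. lra.
Qed.

Lemma ex_series_geomC (s : C) : Cmod s < 1 -> ex_series (fun k => Cmod (s ^ k)%C).
Proof.
  intros H. eapply ex_series_ext; [intros k; symmetry; apply Cmod_pow|].
  apply ex_series_geom. rewrite Rabs_pos_eq; [exact H|apply Cmod_ge_0].
Qed.

Lemma is_cseries_geom (s : C) : Cmod s < 1 -> is_cseries (fun k => s ^ k)%C (/ (1 - s))%C.
Proof.
  intros H. pose proof (Cser_correct _ (ex_series_geomC s H)) as HS.
  set (L := Cser (fun n => s ^ n)%C) in HS.
  assert (HS2 : is_cseries (fun k => s ^ k)%C (1 + s * L)%C).
  { apply (is_cseries_shift (fun k => s ^ k)%C). apply is_cseries_scal, HS. }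
  pose proof (is_cseries_unique _ _ _ HS HS2) as E.
  replace (/ (1 - s))%C with L; [exact HS|].
  pose proof (one_minus_neq0 s H) as Hn.
  assert (E1 : (L * (1 - s))%C = 1%C).
  { transitivity (L - s * L)%C; [ring|]. rewrite E at 1. ring. }
  transitivity (L * (1 - s) * / (1 - s))%C; [field; exact Hn|]. rewrite E1; ring.
Qed.

(** Indicator of m < k, used to write triangular sums as full double series. *)
Definition ind (m k : nat) : R := if Nat.ltb m k then 1 else 0.

Lemma is_cseries_tail (s : C) m : Cmod s < 1 ->
  is_cseries (fun k => ind m k * s ^ k)%C (s ^ S m / (1 - s))%C.
Proof.
  intros H. induction m as [|m IH].
  - replace (s ^ 1 / (1 - s))%C with (ind 0 0 * s ^ 0 + s * / (1 - s))%C
      by (unfold ind; simpl; field; apply one_minus_neq0, H).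
    apply (is_cseries_shift (fun k => ind 0 k * s ^ k)%C).
    eapply is_cseries_ext; [|apply is_cseries_scal, (is_cseries_geom s H)].
    intros n; unfold ind; simpl. ring.
  - replace (s ^ S (S m) / (1 - s))%C with (ind (S m) 0 * s ^ 0 + s * (s ^ S m / (1 - s)))%C
      by (unfold ind; simpl; field; apply one_minus_neq0, H).
    apply (is_cseries_shift (fun k => ind (S m) k * s ^ k)%C).
    eapply is_cseries_ext; [|apply is_cseries_scal, IH].
    intros n. cbv beta. change (ind (S m) (S n)) with (ind m n). rewrite Cpow_S. ring.
Qed.

Lemma is_series_tail (s : R) m : 0 <= s < 1 ->
  is_series (fun k => ind m k * s ^ k) (s ^ S m / (1 - s)).
Proof.
  intros H.
  assert (H1 : Cmod s < 1) by (rewrite Cmod_R, Rabs_pos_eq; lra).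
  pose proof (is_cseries_tail s m H1) as HT.
  replace (s ^ S m / (1 - s)) with (Re (s ^ S m / (1 - s))%C).
  - apply is_cseries_RtoC_inv. eapply is_cseries_ext; [|exact HT].
    intros n. cbv beta. rewrite RtoC_mult, RtoC_pow. reflexivity.
  - rewrite <- RtoC_pow, <- RtoC_minus, <- RtoC_div by lra. reflexivity.
Qed.

Lemma is_series_finite (u : nat -> R) N :
  (forall n, (N < n)%nat -> u n = 0) -> is_series u (sum_f_R0 u N).
Proof.
  intros H. unfold is_series.
  apply filterlim_ext_loc with (fun _ : nat => sum_f_R0 u N).
  - exists N. intros n Hn. rewrite sum_n_Reals. induction Hn as [|n Hn IH]; [reflexivity|].
    rewrite sumR_S, H by lia. rewrite <- IH. ring.
  - apply filterlim_const.
Qed.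

Lemma is_series_0 : is_series (fun _ : nat => 0) 0.
Proof. exact (is_series_finite (fun _ => 0) 0 (fun _ _ => eq_refl)). Qed.

Lemma is_series_ind (c : nat -> R) k : is_series (fun m => c m * ind m k) (lagsum c k).
Proof.
  destruct k as [|k].
  - replace (lagsum c 0) with (sum_f_R0 (fun m => c m * ind m 0) 0)
      by (unfold ind; simpl; ring).
    apply is_series_finite. intros; unfold ind; simpl; ring.
  - replace (lagsum c (S k)) with (sum_f_R0 (fun m => c m * ind m (S k)) k).
    + apply is_series_finite. intros n Hn. unfold ind.
      destruct (Nat.ltb_spec n (S k)); [lia|ring].
    + simpl. apply sumR_ext_loc. intros m Hm. unfold ind.
      destruct (Nat.ltb_spec m (S k)); [ring|lia].
Qed.

Lemma lag_series (c : nat -> R) (s p : C) : Cmod s < 1 ->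
  ex_series (fun k => Rabs (c k) * Cmod s ^ k) ->
  is_cseries (fun k => c k * s ^ k)%C p ->
  is_cseries (fun k => lagsum c k * s ^ k)%C (s / (1 - s) * p)%C.
Proof.
  intros Hs Habs Hp. pose proof (Cmod_ge_0 s) as Hs0.
  set (a := fun m k => (c m * (ind m k * s ^ k))%C).
  assert (Ha : forall m k, Rabs (Cmod (a m k)) = Rabs (c m) * (ind m k * Cmod s ^ k)).
  { intros m k. unfold a. rewrite Rabs_pos_eq by apply Cmod_ge_0.
    rewrite !Cmod_mult, !Cmod_R, Cmod_pow. f_equal. f_equal.
    unfold ind; destruct (m <? k)%nat; apply Rabs_pos_eq; lra. }
  assert (Hr : forall m, is_series (fun k => Rabs (Cmod (a m k)))
                 (Rabs (c m) * (Cmod s ^ S m / (1 - Cmod s)))).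
  { intros m. eapply is_series_ext; [intros; symmetry; apply Ha|].
    apply is_series_scalR, is_series_tail; lra. }
  assert (HF : cabs_summable2 a).
  { split; [intros m; eexists; apply Hr|].
    eapply ex_series_ext; [intros m; symmetry; apply is_series_unique, Hr|].
    destruct Habs as [l Hl]. exists (Cmod s / (1 - Cmod s) * l).
    eapply is_series_ext; [|apply is_series_scalR, Hl].
    intros n; simpl. field. lra. }
  pose proof (cfubini a HF) as H.
  assert (Hrow : forall m, Cser (a m) = (s / (1 - s) * (c m * s ^ m))%C).
  { intros m. apply is_cseries_Cser.
    replace (s / (1 - s) * (c m * s ^ m))%C with (c m * (s ^ S m / (1 - s)))%C
      by (rewrite Cpow_S; field; apply one_minus_neq0, Hs).
    apply is_cseries_scal, is_cseries_tail, Hs. }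
  assert (E : Cser (fun m => Cser (a m)) = (s / (1 - s) * p)%C).
  { apply is_cseries_Cser.
    eapply is_cseries_ext; [intros m; symmetry; apply Hrow|].
    apply is_cseries_scal, Hp. }
  rewrite E in H. eapply is_cseries_ext; [|exact H].
  intros k. apply is_cseries_Cser.
  replace (lagsum c k * s ^ k)%C with (s ^ k * lagsum c k)%C by ring.
  eapply is_cseries_ext; [|apply is_cseries_scal, is_cseries_RtoC, (is_series_ind c k)].
  intros m. unfold a. rewrite RtoC_mult. ring.
Qed.

Lemma lag_series_R (c : nat -> R) (s p : R) : 0 <= s < 1 ->
  (forall k, 0 <= c k) ->
  is_series (fun k => c k * s ^ k) p ->
  is_series (fun k => lagsum c k * s ^ k) (s / (1 - s) * p).
Proof.
  intros Hs Hc Hp.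
  assert (H1 : Cmod s < 1) by (rewrite Cmod_R, Rabs_pos_eq; lra).
  replace (s / (1 - s) * p) with (Re (s / (1 - s) * p)%C).
  2:{ rewrite <- RtoC_minus, <- RtoC_div, <- RtoC_mult by lra. reflexivity. }
  apply is_cseries_RtoC_inv.
  eapply is_cseries_ext.
  2:{ apply (lag_series c s p H1).
      - eexists. eapply is_series_ext; [|exact Hp]. intros k.
        rewrite Cmod_R, !Rabs_pos_eq by (auto; lra). reflexivity.
      - eapply is_cseries_ext; [|apply is_cseries_RtoC, Hp].
        intros k; cbv beta. rewrite RtoC_mult, RtoC_pow; reflexivity. }
  intros k; cbv beta. rewrite RtoC_mult, RtoC_pow; reflexivity.
Qed.

(** The coefficient of s^k in (w + e (1 - w) s/(1 - s))^n.  For e = -1 the base is (w - s)/(1 - s);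
    e = 1 gives the majorant used for absolute convergence. *)
Fixpoint moebius_coef (e w : R) (n k : nat) : R :=
  match n with
  | O => match k with O => 1 | S _ => 0 end
  | S m => w * moebius_coef e w m k + e * (1 - w) * lagsum (moebius_coef e w m) k
  end.

Lemma lagsum_abs (c d : nat -> R) k :
  (forall m, Rabs (c m) <= d m) -> Rabs (lagsum c k) <= lagsum d k.
Proof.
  intros H; destruct k as [|k]; simpl; [rewrite Rabs_R0; lra|].
  eapply Rle_trans; [apply Rsum_abs|]. apply sum_Rle; intros; apply H.
Qed.

Lemma moebius_coef_abs w n : 0 <= w <= 1 -> forall k, Rabs (moebius_coef (-1) w n k) <= moebius_coef 1 w n k.
Proof.
  intros Hw; induction n as [|n IH]; intros k.
  - destruct k; simpl; [rewrite Rabs_R1|rewrite Rabs_R0]; lra.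
  - simpl. eapply Rle_trans; [apply Rabs_triang|].
    rewrite !Rabs_mult, (Rabs_pos_eq w), (Rabs_pos_eq (1 - w)), (Rabs_left (-1)) by lra.
    pose proof (IH k). pose proof (lagsum_abs _ _ k IH).
    assert (w * Rabs (moebius_coef (-1) w n k) <= w * moebius_coef 1 w n k) by (apply Rmult_le_compat_l; lra).
    assert ((1 - w) * Rabs (lagsum (moebius_coef (-1) w n) k) <= (1 - w) * lagsum (moebius_coef 1 w n) k)
      by (apply Rmult_le_compat_l; lra).
    lra.
Qed.

Lemma moebius_coef_pos w n k : 0 <= w <= 1 -> 0 <= moebius_coef 1 w n k.
Proof. intros H; eapply Rle_trans; [apply Rabs_pos|apply moebius_coef_abs, H]. Qed.

Lemma moebius_coef_series_1 w s n : 0 <= w <= 1 -> 0 <= s < 1 ->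
  is_series (fun k => moebius_coef 1 w n k * s ^ k) ((w + (1 - w) * (s / (1 - s))) ^ n).
Proof.
  intros Hw Hs; induction n as [|n IH].
  - replace ((w + (1 - w) * (s / (1 - s))) ^ 0) with (sum_f_R0 (fun k => moebius_coef 1 w 0 k * s ^ k) 0)
      by (simpl; ring).
    apply is_series_finite. intros [|k] Hk; [lia|]. simpl; ring.
  - pose proof (lag_series_R _ s _ Hs (fun k => moebius_coef_pos w n k Hw) IH) as HL.
    pose proof (is_series_plus _ _ _ _ (is_series_scalR w _ _ IH) (is_series_scalR (1 - w) _ _ HL)) as H.
    match type of H with is_series _ ?l =>
      replace ((w + (1 - w) * (s / (1 - s))) ^ S n) with l end.
    + eapply is_series_ext; [|exact H]. intros k.
      change (w * (moebius_coef 1 w n k * s ^ k) + (1 - w) * (lagsum (moebius_coef 1 w n) k * s ^ k)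
              = moebius_coef 1 w (S n) k * s ^ k). simpl; ring.
    + change plus with Rplus. simpl. ring.
Qed.

Lemma moebius_coef_abs_summable w s n : 0 <= w <= 1 -> Cmod s < 1 ->
  ex_series (fun k => Rabs (moebius_coef (-1) w n k) * Cmod s ^ k).
Proof.
  intros Hw Hs. pose proof (Cmod_ge_0 s).
  apply ex_series_ext with (fun k => Rabs (moebius_coef (-1) w n k * Cmod s ^ k)).
  { intros k. rewrite Rabs_mult, (Rabs_pos_eq (_ ^ _)) by (apply pow_le; lra). reflexivity. }
  eapply ex_series_dom; [|eexists; apply (moebius_coef_series_1 w (Cmod s) n Hw); lra].
  intros k. rewrite Rabs_mult, (Rabs_pos_eq (_ ^ _)) by (apply pow_le; lra).
  apply Rmult_le_compat_r; [apply pow_le; lra|apply moebius_coef_abs, Hw].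
Qed.

Lemma moebius_coef_series w (s : C) n : 0 <= w <= 1 -> Cmod s < 1 ->
  is_cseries (fun k => moebius_coef (-1) w n k * s ^ k)%C (((w - s) / (1 - s)) ^ n)%C.
Proof.
  intros Hw Hs; induction n as [|n IH].
  - split.
    + replace (Re (((w - s) / (1 - s)) ^ 0)%C)
        with (sum_f_R0 (fun k => Re (moebius_coef (-1) w 0 k * s ^ k)%C) 0) by (simpl; ring).
      apply is_series_finite. intros [|k] Hk; [lia|]. simpl; ring.
    + replace (Im (((w - s) / (1 - s)) ^ 0)%C)
        with (sum_f_R0 (fun k => Im (moebius_coef (-1) w 0 k * s ^ k)%C) 0) by (simpl; ring).
      apply is_series_finite. intros [|k] Hk; [lia|]. simpl; ring.
  - pose proof (lag_series _ s _ Hs (moebius_coef_abs_summable w s n Hw Hs) IH) as HL.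
    pose proof (is_cseries_plus _ _ _ _ (is_cseries_scal w _ _ IH)
                  (is_cseries_scal (- (1 - w))%C _ _ HL)) as H.
    match type of H with is_cseries _ ?l =>
      replace (((w - s) / (1 - s)) ^ S n)%C with l end.
    + eapply is_cseries_ext; [|exact H]. intros k. cbv beta. cbn [moebius_coef].
      rewrite RtoC_plus, !RtoC_mult, RtoC_minus. replace (RtoC (-1)) with (-(1))%C.
      * ring. * rewrite <- RtoC_opp. f_equal; ring.
    + rewrite Cpow_S. pose proof (one_minus_neq0 s Hs). field; assumption.
Qed.

(** Expansion about a new centre: if G has coefficients g, then G((w - s)/(1 - s)) is a power series in s as long as the majorant of the
    inner map stays inside the disc of convergence of G. *)
Lemma moebius_subst (g : nat -> C) (w sg : R) (s : C) :
  0 <= w <= 1 -> Cmod s <= sg -> 0 < sg < 1 ->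
  ex_series (fun n => Cmod (g n) * (w + (1 - w) * (sg / (1 - sg))) ^ n) ->
  is_cseries (fun k => Cser (fun n => g n * moebius_coef (-1) w n k) * s ^ k)%C
             (Cser (fun n => g n * ((w - s) / (1 - s)) ^ n)%C).
Proof.
  intros Hw Hs Hsg Hg. pose proof (Cmod_ge_0 s) as Hs0.
  assert (Hs1 : Cmod s < 1) by lra.
  set (a := fun n k => (g n * (moebius_coef (-1) w n k * s ^ k))%C).
  set (R0 := w + (1 - w) * (sg / (1 - sg))) in *.
  set (R1 := w + (1 - w) * (Cmod s / (1 - Cmod s))).
  assert (HR : 0 <= R1 <= R0).
  { unfold R0, R1. assert (Cmod s / (1 - Cmod s) <= sg / (1 - sg)).
    { unfold Rdiv. apply Rmult_le_compat; try lra.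
      - left; apply Rinv_0_lt_compat; lra.
      - apply Rinv_le_contravar; lra. }
    assert (0 <= Cmod s / (1 - Cmod s)) by (apply Rdiv_le_0_compat; lra).
    nra. }
  assert (Ha : forall n k, Rabs (Cmod (a n k)) = Cmod (g n) * (Rabs (moebius_coef (-1) w n k) * Cmod s ^ k)).
  { intros. unfold a. rewrite Rabs_pos_eq by apply Cmod_ge_0.
    rewrite !Cmod_mult, !Cmod_R, Cmod_pow. reflexivity. }
  assert (Hrow : forall n, ex_series (fun k => Rabs (Cmod (a n k)))).
  { intros n. eapply ex_series_ext; [intros; symmetry; apply Ha|].
    apply ex_series_scalR. apply moebius_coef_abs_summable; assumption. }
  assert (HF : cabs_summable2 a).
  { split; [exact Hrow|].
    apply (ex_series_leR _ (fun n => Cmod (g n) * R0 ^ n)); [|exact Hg].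
    intros n. cbv beta.
    rewrite Rabs_pos_eq.
    2:{ eapply Rle_trans; [apply (Rabs_pos (Cmod (a n O)))|].
        apply (term_le_series (fun k => Rabs (Cmod (a n k))) O); [intros; apply Rabs_pos|apply Hrow]. }
    rewrite (Series_ext _ _ (Ha n)), Series_scal_l.
    apply Rmult_le_compat_l; [apply Cmod_ge_0|].
    apply Rle_trans with (R1 ^ n); [|apply pow_incr, HR].
    pose proof (moebius_coef_series_1 w (Cmod s) n Hw ltac:(lra)) as Hm.
    fold R1 in Hm. rewrite <- (is_series_unique _ _ Hm). apply Series_le; [|eexists; exact Hm].
    intros k. assert (0 <= Cmod s ^ k) by (apply pow_le; lra). split.
    - apply Rmult_le_pos; [apply Rabs_pos|assumption].
    - apply Rmult_le_compat_r; [assumption|apply moebius_coef_abs, Hw]. }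
  pose proof (cfubini a HF) as H.
  assert (E : Cser (fun n => Cser (a n)) = Cser (fun n => g n * ((w - s) / (1 - s)) ^ n)%C).
  { unfold Cser at 1 3. f_equal; apply Series_ext; intros n; f_equal;
    apply is_cseries_Cser, is_cseries_scal, moebius_coef_series; assumption. }
  rewrite E in H. eapply is_cseries_ext; [|exact H].
  intros k.
  assert (Hcol : ex_series (fun n => Cmod (g n * moebius_coef (-1) w n k)%C)).
  {
    apply (ex_series_leR _ (fun n => / sg ^ k * (Cmod (g n) * R0 ^ n))).
    2:{ apply ex_series_scalR, Hg. }
    intros n. cbv beta.
    rewrite Rabs_pos_eq, Cmod_mult, Cmod_R by apply Cmod_ge_0.
    assert (Hk : 0 < sg ^ k) by (apply pow_lt; lra).
    assert (Hm : moebius_coef 1 w n k * sg ^ k <= R0 ^ n).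
    { pose proof (moebius_coef_series_1 w sg n Hw ltac:(lra)) as Hm.
      fold R0 in Hm. rewrite <- (is_series_unique _ _ Hm).
      apply (term_le_series (fun k => moebius_coef 1 w n k * sg ^ k)); [|eexists; exact Hm].
      intros j. apply Rmult_le_pos; [apply moebius_coef_pos, Hw|apply pow_le; lra]. }
    pose proof (moebius_coef_abs w n Hw k).
    apply Rmult_le_reg_r with (sg ^ k); [exact Hk|].
    replace (/ sg ^ k * (Cmod (g n) * R0 ^ n) * sg ^ k) with (Cmod (g n) * R0 ^ n) by (field; lra).
    rewrite Rmult_assoc. apply Rmult_le_compat_l; [apply Cmod_ge_0|].
    eapply Rle_trans; [|exact Hm]. apply Rmult_le_compat_r; lra. }
  apply is_cseries_Cser.
  eapply is_cseries_ext; [|rewrite Cmult_comm; apply is_cseries_scal, Cser_correct, Hcol].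
  intros n; unfold a; cbv beta; ring.
Qed.

(** * Continuation of 2F1 along a segment *)

Lemma is_cpseries_iff (a : nat -> C) (u l : C) :
  @is_pseries C_AbsRing C_NormedModule a u l <-> is_cseries (fun k => a k * u ^ k)%C l.
Proof.
  unfold is_pseries. rewrite is_cseries_iff.
  assert (E : forall k, @scal C_AbsRing C_NormedModule (@pow_n C_AbsRing u k) (a k) = (a k * u ^ k)%C).
  { intros k. assert (E : @pow_n C_AbsRing u k = (u ^ k)%C).
    { induction k as [|k IH]; [reflexivity|]. simpl. rewrite IH. reflexivity. }
    rewrite E. apply Cmult_comm. }
  split; apply is_cseries_ext; intros; rewrite E; reflexivity.
Qed.

Lemma Re_mult_RtoC (c : C) (r : R) : Re (c * r)%C = Re c * r.
Proof. destruct c; simpl; ring. Qed.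

Lemma Im_mult_RtoC (c : C) (r : R) : Im (c * r)%C = Im c * r.
Proof. destruct c; simpl; ring. Qed.

(** Vanishing on one side of the centre is enough, by continuity; the identity theorem below only has one-sided information. *)
Lemma zero_left_0 (a : nat -> R) (eps : R) : Rbar_lt 0 (CV_radius a) -> 0 < eps ->
  (forall t, - eps < t < 0 -> PSeries a t = 0) -> a O = 0.
Proof.
  intros Ha He Hz.
  assert (Hc : continuity_pt (PSeries a) 0).
  { apply PSeries_continuity. rewrite Rabs_R0. exact Ha. }
  destruct (Req_dec (a O) 0) as [|Hne]; [assumption|exfalso].
  destruct (Hc (Rabs (a O)) (Rabs_pos_lt _ Hne)) as (d & Hd & Hcd).
  set (t := - (Rmin eps d / 2)).
  pose proof (Rmin_l eps d). pose proof (Rmin_r eps d).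
  assert (0 < Rmin eps d) by (apply Rmin_glb_lt; assumption).
  specialize (Hcd t). rewrite PSeries_0, Hz in Hcd by (unfold t; lra).
  simpl in Hcd. unfold R_dist in Hcd.
  rewrite Rminus_0_l, Rabs_Ropp in Hcd.
  apply (Rlt_irrefl (Rabs (a O))), Hcd. split.
  - split; [exact I|unfold t; lra].
  - rewrite Rminus_0_r. unfold t. rewrite Rabs_Ropp, Rabs_pos_eq; lra.
Qed.

Lemma zero_left (n : nat) : forall (a : nat -> R) (eps : R), Rbar_lt 0 (CV_radius a) -> 0 < eps ->
  (forall t, - eps < t < 0 -> Rbar_lt (Rabs t) (CV_radius a) /\ PSeries a t = 0) -> a n = 0.
Proof.
  induction n as [|n IH]; intros a eps Ha He Hz.
  - apply (zero_left_0 a eps); auto. apply Hz.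
  - change (PS_decr_1 a n = 0). apply (IH _ eps); rewrite ?CV_radius_decr_1; auto.
    intros t Ht. destruct (Hz t Ht) as [H1 H2]. split; [exact H1|].
    rewrite PSeries_decr_1, (zero_left_0 a eps) in H2; auto; [|apply Hz|apply CV_radius_inside, H1].
    apply Rmult_eq_reg_l with t; lra.
Qed.

Lemma real_identity (p : nat -> R) (D : R -> R) (r eps : R) : 0 < r -> 0 < eps ->
  (forall t, Rabs t < r -> is_series (fun k => p k * t ^ k) (D t)) ->
  (forall t, - eps < t < 0 -> D t = 0) ->
  forall t, Rabs t < r -> D t = 0.
Proof.
  intros Hr He Hs Hz.
  assert (Hps : forall t, Rabs t < r -> PSeries p t = D t).
  { intros t Ht. apply is_pseries_unique, is_pseries_R, Hs, Ht. }
  assert (HR : forall t, Rabs t < r -> Rbar_lt (Rabs t) (CV_radius p)).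
  { intros t Ht. apply Rbar_lt_le_trans with ((Rabs t + r) / 2); [simpl; lra|].
    apply Rbar_not_lt_le. intros Hlt.
    pose proof (Rabs_pos t) as H0.
    assert (E : Rabs ((Rabs t + r) / 2) = (Rabs t + r) / 2) by (apply Rabs_pos_eq; lra).
    apply (CV_disk_outside p ((Rabs t + r) / 2)); [rewrite E; exact Hlt|].
    apply ex_series_lim_0. eexists; apply Hs. rewrite E; lra. }
  assert (Hp : forall n, p n = 0).
  { intros n. pose proof (Rmin_l r eps). pose proof (Rmin_r r eps).
    apply (zero_left n p (Rmin r eps)).
    - replace (Finite 0) with (Finite (Rabs 0)) by (rewrite Rabs_R0; reflexivity).
      apply HR; rewrite Rabs_R0; exact Hr.
    - apply Rmin_glb_lt; assumption.
    - intros t Ht. assert (Rabs t < r) by (rewrite Rabs_left; lra).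
      split; [apply HR; assumption|]. rewrite Hps by assumption. apply Hz; lra. }
  intros t Ht. rewrite <- (is_series_unique _ _ (Hs t Ht)).
  apply is_series_unique.
  apply (is_series_ext (fun _ => 0)); [|exact is_series_0].
  intros n; rewrite Hp; as_R; ring.
Qed.

Lemma analytic_minus F G z0 : analytic_at F z0 -> analytic_at G z0 ->
  analytic_at (fun u => F u - G u)%C z0.
Proof.
  intros (a & r & Hr & Ha) (b & s & Hs & Hb).
  exists (fun k => a k - b k)%C, (Rmin r s). split; [apply Rmin_glb_lt; assumption|].
  intros z Hz. pose proof (Rmin_l r s). pose proof (Rmin_r r s).
  specialize (Ha z ltac:(lra)). specialize (Hb z ltac:(lra)).
  rewrite is_cpseries_iff in *.
  replace (F z - G z)%C with (F z + (-(1)) * G z)%C by ring.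
  eapply is_cseries_ext; [|apply (is_cseries_plus _ _ _ _ Ha (is_cseries_scal (-(1))%C _ _ Hb))].
  intros n; cbv beta; ring.
Qed.

(** On the segment only real parameters matter: if T is the supremum of the parameters up to which H vanishes, the two real
    power series of its components at T vanish on the left, hence on a neighbourhood. *)
Lemma segment_identity (H : C -> C) (z : C) (eps : R) : 0 < eps ->
  (forall t : R, 0 <= t <= 1 -> analytic_at H (t * z)%C) ->
  (forall u : C, Cmod u < eps -> H u = 0) ->
  H z = 0.
Proof.
  intros He Han Hz.
  set (D := fun t : R => H (t * z)%C).
  set (E := fun t => 0 <= t <= 1 /\ forall s, 0 <= s <= t -> D s = 0).
  assert (Hz0 : 0 < Cmod z + 1) by (pose proof (Cmod_ge_0 z); lra).
  (* A parameter up to which the points t z lie in the disc where H vanishes. *)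
  set (e0 := Rmin 1 (eps / 2 / (Cmod z + 1))).
  assert (He0 : 0 < e0).
  { apply Rmin_glb_lt; [lra|]. apply Rdiv_lt_0_compat; lra. }
  assert (Ee0 : E e0).
  { pose proof (Rmin_l 1 (eps / 2 / (Cmod z + 1))) as H1. pose proof (Rmin_r 1 (eps / 2 / (Cmod z + 1))) as H2.
    fold e0 in H1, H2. split; [lra|]. intros s Hs. apply Hz.
    rewrite Cmod_mult, Cmod_R, Rabs_pos_eq by lra.
    assert (s * (Cmod z + 1) <= eps / 2).
    { apply Rle_trans with (eps / 2 / (Cmod z + 1) * (Cmod z + 1)).
      - apply Rmult_le_compat_r; lra. - right; field; lra. }
    pose proof (Cmod_ge_0 z). nra. }
  destruct (completeness E) as [T [HT1 HT2]].
  { exists 1. intros t [Ht _]; lra. }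
  { exists e0; exact Ee0. }
  assert (HT0 : e0 <= T) by (apply HT1, Ee0).
  assert (HTle : T <= 1) by (apply HT2; intros t [Ht _]; lra).
  assert (Hbelow : forall s, 0 <= s < T -> D s = 0).
  { intros s Hs. destruct (classic (exists t, E t /\ s < t)) as [[t [[Ht1 Ht2] Ht3]]|Hn].
    - apply Ht2; lra.
    - exfalso. assert (T <= s); [|lra]. apply HT2. intros t Ht.
      apply Rnot_lt_le. intros Hlt. apply Hn. exists t; auto. }
  destruct (Han T ltac:(lra)) as (a & r & Hr & Ha).
  set (r' := r / (Cmod z + 1)).
  assert (Hr' : 0 < r') by (apply Rdiv_lt_0_compat; lra).
  assert (Hloc : forall t, Rabs t < r' -> is_cseries (fun k => (a k * z ^ k) * RtoC (t ^ k))%C (D (T + t))).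
  { intros t Ht. specialize (Ha ((T + t)%R * z)%C).
    replace ((T + t)%R * z - T * z)%C with (t * z)%C in Ha by (rewrite RtoC_plus; ring).
    rewrite Cmod_mult, Cmod_R in Ha.
    assert (Hlt : Rabs t * Cmod z < r).
    { apply Rle_lt_trans with (Rabs t * (Cmod z + 1)); [pose proof (Rabs_pos t); nra|].
      apply Rlt_le_trans with (r' * (Cmod z + 1)); [apply Rmult_lt_compat_r; lra|].
      right; unfold r'; field; lra. }
    specialize (Ha Hlt). rewrite is_cpseries_iff in Ha.
    eapply is_cseries_ext; [|exact Ha]. intros k. cbv beta.
    rewrite Cpow_mult_l, RtoC_pow. ring. }
  assert (Hzero : forall t, Rabs t < r' -> D (T + t) = 0).
  { intros t Ht. apply injective_projections.
    - apply (real_identity (fun k => Re (a k * z ^ k)%C) (fun t => Re (D (T + t))) r' T Hr' ltac:(lra)); [|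
        intros s Hs; rewrite Hbelow by lra; reflexivity|exact Ht].
      intros s Hs. destruct (Hloc s Hs) as [H1 _].
      eapply is_series_ext; [|exact H1]. intros k. cbv beta. rewrite Re_mult_RtoC; reflexivity.
    - apply (real_identity (fun k => Im (a k * z ^ k)%C) (fun t => Im (D (T + t))) r' T Hr' ltac:(lra)); [|
        intros s Hs; rewrite Hbelow by lra; reflexivity|exact Ht].
      intros s Hs. destruct (Hloc s Hs) as [_ H1].
      eapply is_series_ext; [|exact H1]. intros k. cbv beta. rewrite Im_mult_RtoC; reflexivity. }
  assert (HT : T = 1).
  { destruct (Req_dec T 1) as [|Hne]; [assumption|exfalso].
    set (d := Rmin (r' / 2) (1 - T)).
    pose proof (Rmin_l (r' / 2) (1 - T)) as H1. pose proof (Rmin_r (r' / 2) (1 - T)) as H2. fold d in H1, H2.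
    assert (Hd : 0 < d) by (apply Rmin_glb_lt; lra).
    assert (Ed : E (T + d)).
    { split; [lra|]. intros s Hs. destruct (Rlt_le_dec s T); [apply Hbelow; lra|].
      replace s with (T + (s - T)) by ring. apply Hzero. rewrite Rabs_pos_eq; lra. }
    pose proof (HT1 _ Ed). lra. }
  specialize (Hzero 0). rewrite Rabs_R0 in Hzero. specialize (Hzero Hr').
  rewrite HT, Rplus_0_r in Hzero. unfold D in Hzero. rewrite Cmult_1_l in Hzero. exact Hzero.
Qed.

Lemma is_hyp2F1_unique a b c z w1 w2 :
  is_hyp2F1 a b c z w1 -> is_hyp2F1 a b c z w2 -> w1 = w2.
Proof.
  intros (F & HF1 & (r & Hr & HF2) & <-) (G & HG1 & (s & Hs & HG2) & <-).
  assert (E : (F z - G z)%C = 0).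
  { apply (segment_identity (fun u => F u - G u)%C z (Rmin r s)).
    - apply Rmin_glb_lt; assumption.
    - intros t Ht; apply analytic_minus; auto.
    - intros u Hu. pose proof (Rmin_l r s). pose proof (Rmin_r r s).
      specialize (HF2 u ltac:(lra)). specialize (HG2 u ltac:(lra)).
      rewrite is_cpseries_iff in *. rewrite (is_cseries_unique _ _ _ HF2 HG2). ring. }
  replace (F z) with (F z - G z + G z)%C by ring. rewrite E; ring.
Qed.

(** [pfaff] with y = 0 on complex sequences. *)
Definition cpfaff (f : nat -> C) (N : nat) : C :=
  (pfaff 0 (fun k => Re (f k)) N, pfaff 0 (fun k => Im (f k)) N).

(** At the centre 0 the inner map is s/(s - 1), so the substitution is [pfaff] with y = 0. *)
Lemma moebius_coef_0 n : forall k, moebius_coef (-1) 0 n k = pfaff_coef 0 k n.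
Proof.
  induction n as [|n IH]; intros k.
  - destruct k as [|k]; [reflexivity|]. rewrite pfaff_coef_0_0. reflexivity.
  - simpl moebius_coef. induction k as [|k IHk].
    + simpl; ring.
    + change (pfaff_coef 0 (S k) (S n)) with (pfaff_coef 0 k (S n) - pfaff_coef 0 k n).
      rewrite <- IHk, <- IH. destruct k; simpl; ring.
Qed.

Lemma is_series_pfaff (f : nat -> R) k : is_series (fun n => f n * moebius_coef (-1) 0 n k) (pfaff 0 f k).
Proof.
  apply is_series_ext with (fun n => pfaff_coef 0 k n * f n).
  - intros n; as_R; rewrite moebius_coef_0; ring.
  - apply is_series_finite. intros n Hn; rewrite pfaff_coef_out by assumption; ring.
Qed.

Lemma Cser_cpfaff (f : nat -> C) k : Cser (fun n => f n * moebius_coef (-1) 0 n k)%C = cpfaff f k.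
Proof.
  apply is_cseries_Cser. split.
  - eapply is_series_ext; [|apply (is_series_pfaff (fun n => Re (f n)) k)]. intros n; rewrite Re_mult_RtoC; reflexivity.
  - eapply is_series_ext; [|apply (is_series_pfaff (fun n => Im (f n)) k)]. intros n; rewrite Im_mult_RtoC; reflexivity.
Qed.

Lemma ex_series_pow_le (g : nat -> C) r s : 0 <= r <= s ->
  ex_series (fun n => Cmod (g n) * s ^ n) -> ex_series (fun n => Cmod (g n) * r ^ n).
Proof.
  intros Hrs Hs.
  apply (ex_series_leR _ (fun n => Cmod (g n) * s ^ n)); [|exact Hs].
  intros n. cbv beta.
  pose proof (Cmod_ge_0 (g n)). rewrite Rabs_pos_eq.
  - apply Rmult_le_compat_l; [assumption|]. apply pow_incr; assumption.
  - apply Rmult_le_pos; [assumption|apply pow_le; lra].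
Qed.

Lemma sg_frac sg t : 0 <= sg -> sg <= 1 / 2 -> 2 * sg <= t -> sg / (1 - sg) <= t.
Proof.
  intros H0 H1 H2. apply Rle_trans with (2 * sg); [|exact H2].
  apply Rmult_le_reg_r with (1 - sg); [lra|]. unfold Rdiv.
  rewrite Rmult_assoc, Rinv_l by lra. nra.
Qed.

Lemma u_minus_1 (u : C) : Cmod u < 1 -> (u - 1)%C <> 0.
Proof.
  intros H E. apply (one_minus_neq0 u H). replace (1 - u)%C with (- (u - 1))%C by ring.
  rewrite E. ring.
Qed.

(** The function u -> sum of g_n (u/(u - 1))^n is the continuation.  Near a point u0 of the segment, put s = (u - u0)/(1 - u0) and
    w = u0/(u0 - 1); then u/(u - 1) = (w - s)/(1 - s).  Near 0, the involution u -> u/(u - 1) leads back to the hypergeometric series. *)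
Lemma hyp2F1_eval (a b c : C) (xi rho s0 : R) :
  0 < xi < rho -> rho < 1 -> 0 < s0 ->
  ex_series (fun n => Cmod (hyp_coef a b c n) * s0 ^ n) ->
  ex_series (fun n => Cmod (cpfaff (hyp_coef a b c) n) * rho ^ n) ->
  is_cseries (fun n => cpfaff (hyp_coef a b c) n * RtoC (xi ^ n))%C
             (hyp2F1 a b c (xi / (xi - 1))%R).
Proof.
  intros Hxi Hrho Hs0 Hf Hg.
  set (f := hyp_coef a b c) in *. set (g := cpfaff f) in *.
  set (z := xi / (xi - 1)).
  set (F := fun u : C => Cser (fun n => g n * (u / (u - 1)) ^ n)%C).
  assert (Hz : z < 0).
  { unfold z. assert (0 < xi / (1 - xi)) by (apply Rdiv_lt_0_compat; lra).
    replace (xi / (xi - 1)) with (- (xi / (1 - xi))) by (field; lra). lra. }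
  assert (Hzxi : z * (xi - 1) = xi) by (unfold z; field; lra).
  assert (HF : is_hyp2F1 a b c z (F z)).
  { exists F. split; [|split; [|reflexivity]].
    - intros t Ht. rewrite <- RtoC_mult. set (u0 := t * z).
      assert (Hu0 : z <= u0 <= 0) by (unfold u0; nra).
      set (w0 := u0 / (u0 - 1)).
      assert (Hw0e : w0 * (u0 - 1) = u0) by (unfold w0; field; lra).
      assert (Hw0 : 0 <= w0 <= xi) by (split; nra).
      set (sg := (rho - xi) / 2).
      exists (fun k => Cser (fun n => g n * moebius_coef (-1) w0 n k) * / RtoC ((1 - u0) ^ k))%C, sg.
      split; [unfold sg; lra|]. intros u Hu. rewrite is_cpseries_iff.
      assert (Hne0 : 1 - u0 <> 0) by lra.
      assert (HneC : (1 - u0)%C <> 0) by (rewrite <- RtoC_minus; intros E; apply Hne0, RtoC_inj, E).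
      set (s := ((u - u0) / (1 - u0))%C).
      assert (Hs : Cmod s <= sg).
      { unfold s. unfold Cdiv. rewrite Cmod_mult, Cmod_inv by exact HneC.
        rewrite <- RtoC_minus, Cmod_R, Rabs_pos_eq by lra.
        apply Rle_trans with (Cmod (u - u0)%C); [|lra].
        rewrite <- (Rmult_1_r (Cmod (u - u0)%C)) at 2.
        apply Rmult_le_compat_l; [apply Cmod_ge_0|].
        rewrite <- Rinv_1. apply Rinv_le_contravar; lra. }
      assert (Hs1 : Cmod s < 1) by (unfold sg in Hs; lra).
      pose proof (one_minus_neq0 s Hs1) as Hns.
      assert (Hw : (u / (u - 1))%C = ((w0 - s) / (1 - s))%C).
      { assert (E1 : (1 - s)%C = ((1 - u) / (1 - u0))%C) by (unfold s; field; exact HneC).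
        assert (Hnu : (1 - u)%C <> 0).
        { intros E. apply Hns. rewrite E1, E. unfold Cdiv. ring. }
        assert (E2 : RtoC w0 = (- u0 / (1 - u0))%C).
        { unfold w0. rewrite <- RtoC_opp, <- RtoC_minus, <- RtoC_div by lra. f_equal. field. lra. }
        assert (Hnu' : (u - 1)%C <> 0).
        { intros E. apply Hnu. replace (1 - u)%C with (- (u - 1))%C by ring. rewrite E; ring. }
        rewrite E1, E2. unfold s. field. repeat split; assumption. }
      unfold F. rewrite Hw.
      eapply is_cseries_ext; [|apply (moebius_subst g w0 sg s)].
      + intros k. cbv beta. unfold s. unfold Cdiv. rewrite Cpow_mult_l, Cpow_inv by exact HneC.
        rewrite RtoC_pow, RtoC_minus. ring.
      + lra.
      + exact Hs.
      + unfold sg; lra.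
      + apply ex_series_pow_le with rho; [|exact Hg].
        assert (0 <= sg / (1 - sg)) by (apply Rdiv_le_0_compat; unfold sg; lra).
        assert (sg / (1 - sg) <= rho - xi) by (apply sg_frac; unfold sg; lra).
        split; nra.
    - set (sg := Rmin s0 1 / 2).
      pose proof (Rmin_l s0 1). pose proof (Rmin_r s0 1).
      assert (0 < Rmin s0 1) by (apply Rmin_glb_lt; lra).
      exists (sg / 2). split; [unfold sg; lra|]. intros u Hu. rewrite is_cpseries_iff.
      fold f. assert (Hu1 : Cmod u < 1) by (unfold sg in *; lra).
      pose proof (Cmod_ge_0 u).
      pose proof (u_minus_1 u Hu1) as Hnu.
      assert (Hw : Cmod (u / (u - 1))%C <= sg).
      { unfold Cdiv. rewrite Cmod_mult, Cmod_inv by exact Hnu.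
        assert (Hm : 1 - Cmod u <= Cmod (u - 1)%C).
        { pose proof (Cmod_triangle (u - 1)%C (- u)%C) as H3.
          replace (u - 1 + - u)%C with (-(1))%C in H3 by ring. rewrite !Cmod_opp, Cmod_1 in H3. lra. }
        apply Rle_trans with (Cmod u / (1 - Cmod u)).
        - apply Rmult_le_compat_l; [assumption|]. apply Rinv_le_contravar; lra.
        - apply sg_frac; unfold sg in *; lra. }
      pose proof (moebius_subst f 0 sg (u / (u - 1))%C ltac:(lra) Hw ltac:(unfold sg; lra)) as HM.
      assert (Hone : (1 - u / (u - 1))%C <> 0) by (apply one_minus_neq0; unfold sg in *; lra).
      assert (E : ((0 - u / (u - 1)) / (1 - u / (u - 1)))%C = u).
      { field. split; [exact Hnu|].
        replace (u - 1 - u)%C with (-(1))%C by ring. intros E.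
        apply C1_nz. replace (RtoC 1) with (- (- (1)))%C by ring. rewrite E; ring. }
      rewrite E in HM.
      assert (HS : ex_series (fun n => Cmod (f n) * (0 + (1 - 0) * (sg / (1 - sg))) ^ n)).
      { apply ex_series_pow_le with s0; [|exact Hf].
        assert (0 <= sg / (1 - sg)) by (apply Rdiv_le_0_compat; unfold sg; lra).
        assert (sg / (1 - sg) <= s0) by (apply sg_frac; unfold sg; lra). lra. }
      specialize (HM HS).
      assert (EF : F u = Cser (fun n => f n * u ^ n)%C).
      { unfold F. apply is_cseries_Cser. eapply is_cseries_ext; [|exact HM].
        intros n. cbv beta. rewrite Cser_cpfaff. reflexivity. }
      rewrite EF. apply Cser_correct.
      apply ex_series_ext with (fun n => Cmod (f n) * Cmod u ^ n).
      { intros n; rewrite Cmod_mult, Cmod_pow; reflexivity. }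
      apply ex_series_pow_le with s0; [|exact Hf]. unfold sg in *; lra. }
  assert (E : hyp2F1 a b c z = F z).
  { apply (is_hyp2F1_unique a b c z); [|exact HF].
    unfold hyp2F1. apply epsilon_spec. exists (F z); exact HF. }
  rewrite E. unfold F.
  assert (Exi : (z / (z - 1))%C = RtoC xi).
  { rewrite <- RtoC_minus, <- RtoC_div by lra. f_equal. unfold z. field. split; lra. }
  rewrite Exi.
  eapply is_cseries_ext; [|apply Cser_correct].
  - intros n; cbv beta. rewrite RtoC_pow; reflexivity.
  - apply ex_series_ext with (fun n => Cmod (g n) * xi ^ n).
    { intros n; rewrite Cmod_mult, Cmod_pow, Cmod_R, Rabs_pos_eq by lra; reflexivity. }
    apply ex_series_pow_le with rho; [lra|exact Hg].
Qed.

(** * The functions phi_1, phi_0 and phi-tilde as power series in xi *)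

(** Polynomial factors are absorbed by a slightly larger ratio; this is used for the convergence of all weighted sums. *)
Lemma poly_geom xi : 0 < xi < 1 ->
  exists K th, 0 <= K /\ 0 < th < 1 /\ forall n, (1 + INR n) ^ 2 * xi ^ n <= K * th ^ n.
Proof.
  intros Hxi. set (d := (1 - xi) / 4). set (r := 1 + d).
  assert (Hd : 0 < d) by (unfold d; lra).
  assert (Hid : 0 < / d) by (apply Rinv_0_lt_compat, Hd).
  assert (Hxid : xi = 1 - 4 * d) by (unfold d; lra).
  exists ((1 + / d) ^ 2), (r * r * xi).
  split; [apply pow_le; lra|]. split.
  { split; [unfold r; nra|]. rewrite Hxid. unfold r. assert (d < 1 / 4) by (unfold d; lra). nra. }
  intros n.
  assert (Hr1 : 1 <= r ^ n) by (apply pow_R1_Rle; unfold r; lra).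
  assert (Hn : 1 + INR n <= (1 + / d) * r ^ n).
  { pose proof (poly n d Hd) as Hp. fold r in Hp.
    assert (INR n <= / d * r ^ n); [|lra].
    apply Rmult_le_reg_l with d; [exact Hd|]. rewrite <- Rmult_assoc, Rinv_r by lra. lra. }
  rewrite !Rpow_mult_distr.
  assert (Hx0 : 0 <= xi ^ n) by (apply pow_le; lra).
  replace ((1 + / d) ^ 2 * (r ^ n * r ^ n * xi ^ n)) with (((1 + / d) * r ^ n) ^ 2 * xi ^ n) by ring.
  apply Rmult_le_compat_r; [assumption|]. apply pow_incr. pose proof (pos_INR n). lra.
Qed.

Lemma phi_coef_geom beta xi : 0 < beta -> 0 < xi < 1 ->
  exists K th, 0 <= K /\ 0 < th < 1 /\ forall x n, 0 <= x ->
    (1 + INR n) * Rabs (phi_coef beta x n) * xi ^ n <= K * th ^ n.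
Proof.
  intros Hb Hxi. set (r := 2 / (1 + xi)).
  assert (Hr : r * (1 + xi) = 2) by (unfold r; field; lra).
  destruct (phi_coef_bound beta r Hb ltac:(nra)) as (K & HK & HB).
  destruct (poly_geom (r * xi) ltac:(nra)) as (K' & th & HK' & Hth & HP).
  exists (K * K'), th. split; [apply Rmult_le_pos; assumption|]. split; [exact Hth|].
  intros x n Hx. specialize (HB x n Hx). specialize (HP n). rewrite Rpow_mult_distr in HP.
  assert (H0 : 0 <= xi ^ n) by (apply pow_le; lra). pose proof (pos_INR n).
  apply Rle_trans with ((1 + INR n) ^ 2 * (K * r ^ n) * xi ^ n).
  - apply Rmult_le_compat_r; [exact H0|].
    apply Rmult_le_compat; [lra|apply Rabs_pos|nra|exact HB].
  - replace ((1 + INR n) ^ 2 * (K * r ^ n) * xi ^ n) with (K * ((1 + INR n) ^ 2 * (r ^ n * xi ^ n))) by ring.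
    rewrite Rmult_assoc. apply Rmult_le_compat_l; assumption.
Qed.

Lemma ex_series_geom_bound (u : nat -> R) K th : 0 < th < 1 ->
  (forall n, Rabs (u n) <= K * th ^ n) -> ex_series (fun n => Rabs (u n)).
Proof.
  intros Hth H. apply (ex_series_dom u (fun n => K * th ^ n) H).
  apply ex_series_scalR, ex_series_geom. rewrite Rabs_pos_eq; lra.
Qed.

(** Shown below to be phi_1(x). *)
Definition Bser (beta xi x : R) : R := Series (fun n => phi_coef beta x n * xi ^ n).
(** The derivative xi d/dxi of [Bser]. *)
Definition Dser (beta xi x : R) : R := Series (fun n => INR n * phi_coef beta x n * xi ^ n).

Lemma Bser_abs beta xi x : 0 < beta -> 0 < xi < 1 -> 0 <= x ->
  ex_series (fun n => Rabs (phi_coef beta x n * xi ^ n)).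
Proof.
  intros Hb Hxi Hx. destruct (phi_coef_geom beta xi Hb Hxi) as (K & th & HK & Hth & H).
  apply (ex_series_geom_bound _ K th Hth). intros n.
  eapply Rle_trans; [|apply (H x n Hx)].
  assert (0 <= xi ^ n) by (apply pow_le; lra).
  rewrite Rabs_mult, (Rabs_pos_eq (_ ^ _)) by assumption.
  apply Rmult_le_compat_r; [assumption|].
  pose proof (pos_INR n). pose proof (Rabs_pos (phi_coef beta x n)). nra.
Qed.

Lemma Dser_abs beta xi x : 0 < beta -> 0 < xi < 1 -> 0 <= x ->
  ex_series (fun n => Rabs (INR n * phi_coef beta x n * xi ^ n)).
Proof.
  intros Hb Hxi Hx. destruct (phi_coef_geom beta xi Hb Hxi) as (K & th & HK & Hth & H).
  apply (ex_series_geom_bound _ K th Hth). intros n.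
  eapply Rle_trans; [|apply (H x n Hx)].
  assert (0 <= xi ^ n) by (apply pow_le; lra). pose proof (pos_INR n).
  rewrite !Rabs_mult, (Rabs_pos_eq (_ ^ _)), (Rabs_pos_eq (INR n)) by assumption.
  apply Rmult_le_compat_r; [assumption|].
  pose proof (Rabs_pos (phi_coef beta x n)). nra.
Qed.

(** The sequence u represents a series in xi that converges absolutely at some larger rho; the margin is what [hyp2F1_eval] requires. *)
Definition pser (rho xi : R) (u : nat -> C) (v : C) : Prop :=
  ex_series (fun n => Cmod (u n) * rho ^ n) /\ is_cseries (fun n => u n * RtoC (xi ^ n))%C v.

Lemma pser_ext rho xi u u' v : (forall n, u n = u' n) -> pser rho xi u v -> pser rho xi u' v.
Proof.
  intros H [H1 H2]; split.
  - eapply ex_series_ext; [|exact H1]. intros n; cbv beta; rewrite H; reflexivity.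
  - eapply is_cseries_ext; [|exact H2]. intros n; cbv beta; rewrite H; reflexivity.
Qed.

Lemma pser_scal rho xi c u v : pser rho xi u v -> pser rho xi (fun n => c * u n)%C (c * v)%C.
Proof.
  intros [H1 H2]; split.
  - eapply ex_series_ext; [|apply (ex_series_scalR (Cmod c)), H1].
    intros n; cbv beta. rewrite Cmod_mult, Rmult_assoc; reflexivity.
  - eapply is_cseries_ext; [|apply (is_cseries_scal c), H2]. intros n; cbv beta; ring.
Qed.

Lemma pser_plus rho xi u u' v v' : 0 < rho -> pser rho xi u v -> pser rho xi u' v' ->
  pser rho xi (fun n => u n + u' n)%C (v + v')%C.
Proof.
  intros Hr [H1 H2] [H3 H4]; split.
  - apply (ex_series_leR _
      (fun n => plus (Cmod (u n) * rho ^ n) (Cmod (u' n) * rho ^ n))).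
    2:{ apply (ex_series_plus (fun n => Cmod (u n) * rho ^ n)); assumption. }
    intros n. change (Rabs (Cmod (u n + u' n)%C * rho ^ n) <= Cmod (u n) * rho ^ n + Cmod (u' n) * rho ^ n).
    assert (0 < rho ^ n) by (apply pow_lt; assumption).
    rewrite Rabs_pos_eq by (apply Rmult_le_pos; [apply Cmod_ge_0|lra]).
    rewrite <- Rmult_plus_distr_r. apply Rmult_le_compat_r; [lra|apply Cmod_triangle].
  - eapply is_cseries_ext; [|apply (is_cseries_plus _ _ _ _ H2 H4)]. intros n; cbv beta; ring.
Qed.

Definition clag (u : nat -> C) (k : nat) : C := match k with O => 0 | S i => u i end.

Lemma pser_clag rho xi u v : pser rho xi u v -> pser rho xi (clag u) (xi * v)%C.
Proof.
  intros [H1 H2]; split.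
  - apply ex_series_incr_1.
    eapply ex_series_ext; [|apply (ex_series_scalR rho), H1].
    intros n; as_R. simpl. ring.
  - replace (xi * v)%C with (clag u 0 * RtoC (xi ^ 0) + xi * v)%C by (simpl; ring).
    apply (is_cseries_shift (fun n => clag u n * RtoC (xi ^ n))%C).
    eapply is_cseries_ext; [|apply (is_cseries_scal xi), H2].
    intros n; cbv beta. cbn [clag]. simpl pow. rewrite RtoC_mult. ring.
Qed.

Lemma pser_lagsum rho xi (u : nat -> R) v : 0 < xi < rho -> rho < 1 ->
  pser rho xi (fun n => RtoC (u n)) v ->
  pser rho xi (fun n => RtoC (lagsum u n)) (xi / (1 - xi) * v)%C.
Proof.
  intros Hxi Hr [H1 H2].
  assert (H1' : ex_series (fun k => Rabs (u k) * rho ^ k)).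
  { eapply ex_series_ext; [|exact H1]. intros n; cbv beta; rewrite Cmod_R; reflexivity. }
  split.
  - destruct H1' as [l Hl].
    pose proof (lag_series_R (fun k => Rabs (u k)) rho l ltac:(lra) (fun k => Rabs_pos _) Hl) as HL.
    apply (ex_series_leR _ (fun k => lagsum (fun k => Rabs (u k)) k * rho ^ k));
      [|eexists; exact HL].
    intros n. cbv beta.
    assert (0 < rho ^ n) by (apply pow_lt; lra).
    rewrite Rabs_pos_eq by (apply Rmult_le_pos; [apply Cmod_ge_0|lra]).
    rewrite Cmod_R. apply Rmult_le_compat_r; [lra|]. apply lagsum_abs. intros; apply Rle_refl.
  - assert (Hm : Cmod xi < 1) by (rewrite Cmod_R, Rabs_pos_eq; lra).
    eapply is_cseries_ext; [|apply (lag_series u xi v Hm)].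
    + intros n; cbv beta; rewrite RtoC_pow; reflexivity.
    + rewrite Cmod_R, Rabs_pos_eq by lra.
      apply (ex_series_leR _ (fun k => Rabs (u k) * rho ^ k)); [|exact H1'].
      intros n. cbv beta.
      assert (0 <= xi ^ n) by (apply pow_le; lra).
      rewrite Rabs_pos_eq by (apply Rmult_le_pos; [apply Rabs_pos|assumption]).
      apply Rmult_le_compat_l; [apply Rabs_pos|]. apply pow_incr; lra.
    + eapply is_cseries_ext; [|exact H2]. intros n; cbv beta; rewrite RtoC_pow; reflexivity.
Qed.

Lemma pser_h beta rho xi x : 0 < beta -> 0 < xi < rho -> rho < 1 -> 0 <= x ->
  pser rho xi (fun n => RtoC (phi_coef beta x n)) (Bser beta xi x).
Proof.
  intros Hb Hxi Hr Hx; split.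
  - eapply ex_series_ext; [|apply (Bser_abs beta rho x)]; try lra.
    intros n; cbv beta. rewrite Cmod_R, Rabs_mult, (Rabs_pos_eq (_ ^ _)) by (apply pow_le; lra).
    reflexivity.
  - eapply is_cseries_ext; [|apply is_cseries_RtoC, Series_correct, ex_series_Rabs, (Bser_abs beta xi x)]; try lra.
    intros n; cbv beta. rewrite RtoC_mult; reflexivity.
Qed.

Lemma pser_nh beta rho xi x : 0 < beta -> 0 < xi < rho -> rho < 1 -> 0 <= x ->
  pser rho xi (fun n => RtoC (INR n * phi_coef beta x n)) (Dser beta xi x).
Proof.
  intros Hb Hxi Hr Hx; split.
  - eapply ex_series_ext; [|apply (Dser_abs beta rho x)]; try lra.
    intros n; cbv beta. rewrite Cmod_R, (Rabs_mult (_ * _)), (Rabs_pos_eq (_ ^ _)) by (apply pow_le; lra).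
    reflexivity.
  - eapply is_cseries_ext; [|apply is_cseries_RtoC, Series_correct, ex_series_Rabs, (Dser_abs beta xi x)]; try lra.
    intros n; cbv beta. rewrite RtoC_mult; reflexivity.
Qed.

Lemma hyp_coef_radius (a b : C) (c : R) : 0 < c ->
  exists s0, 0 < s0 /\ ex_series (fun n => Cmod (hyp_coef a b c n) * s0 ^ n).
Proof.
  intros Hc.
  set (Q := (1 + Cmod a) * (1 + Cmod b / c)).
  pose proof (Cmod_ge_0 a) as Ha. pose proof (Cmod_ge_0 b) as Hb.
  assert (Hbc : 0 <= Cmod b / c) by (apply Rdiv_le_0_compat; lra).
  assert (HQ : 1 <= Q) by (unfold Q; nra).
  assert (Hpoch : forall n, poch (RtoC c) n <> 0).
  { induction n as [|n IH]; [exact C1_nz|]. simpl. apply Cmult_neq_0; [exact IH|].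
    rewrite <- RtoC_plus. intros E. apply RtoC_inj in E. pose proof (pos_INR n); lra. }
  assert (HB : forall n, Cmod (hyp_coef a b c n) <= Q ^ n).
  { induction n as [|n IH].
    - unfold hyp_coef. simpl. replace (1 * 1 / (1 * 1))%C with (RtoC 1) by (field; exact C1_nz).
      rewrite Cmod_1; lra.
    - assert (E : hyp_coef a b c (S n) = (hyp_coef a b c n * ((a + INR n) * (b + INR n) / RtoC ((c + INR n) * (INR n + 1))%R))%C).
      { pose proof (pos_INR n).
        assert (Hn1 : RtoC (INR (fact n)) <> 0) by (intros E; apply RtoC_inj in E; apply (INR_fact_neq_0 n E)).
        assert (Hn2 : (RtoC (INR n) + 1)%C <> 0) by (rewrite <- RtoC_plus; intros E; apply RtoC_inj in E; lra).
        assert (Hn3 : (c + RtoC (INR n))%C <> 0) by (rewrite <- RtoC_plus; intros E; apply RtoC_inj in E; lra).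
        unfold hyp_coef. rewrite fact_simpl, mult_INR, S_INR, !RtoC_mult, !RtoC_plus. cbn [poch].
        field. repeat split; auto. }
      rewrite E, Cmod_mult. simpl. rewrite Rmult_comm. apply Rmult_le_compat; try apply Cmod_ge_0; [|exact IH].
      pose proof (pos_INR n).
      assert (Hpos : 0 < (c + INR n) * (INR n + 1)) by (apply Rmult_lt_0_compat; lra).
      unfold Cdiv. rewrite !Cmod_mult, Cmod_inv, Cmod_R, Rabs_pos_eq; [|lra|intros E'; apply RtoC_inj in E'; lra].
      apply Rmult_le_reg_r with ((c + INR n) * (INR n + 1)); [exact Hpos|].
      rewrite Rmult_assoc, Rinv_l, Rmult_1_r by lra.
      assert (H1 : Cmod (a + INR n) <= (1 + Cmod a) * (INR n + 1)).
      { eapply Rle_trans; [apply Cmod_triangle|]. rewrite Cmod_R, Rabs_pos_eq by lra. nra. }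
      assert (H2 : Cmod (b + INR n) <= (1 + Cmod b / c) * (c + INR n)).
      { eapply Rle_trans; [apply Cmod_triangle|]. rewrite Cmod_R, Rabs_pos_eq by lra.
        assert (Cmod b / c * c = Cmod b) by (field; lra). nra. }
      unfold Q. replace ((1 + Cmod a) * (1 + Cmod b / c) * ((c + INR n) * (INR n + 1)))
        with (((1 + Cmod a) * (INR n + 1)) * ((1 + Cmod b / c) * (c + INR n))) by ring.
      apply Rmult_le_compat; try apply Cmod_ge_0; assumption. }
  exists (/ (2 * Q)). split; [apply Rinv_0_lt_compat; lra|].
  apply (ex_series_leR _ (fun n => (1 / 2) ^ n)).
  2:{ apply ex_series_geom. rewrite Rabs_pos_eq; lra. }
  intros n. cbv beta.
  assert (Hi : 0 < (/ (2 * Q)) ^ n) by (apply pow_lt, Rinv_0_lt_compat; lra).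
  rewrite Rabs_pos_eq by (apply Rmult_le_pos; [apply Cmod_ge_0|lra]).
  apply Rle_trans with (Q ^ n * (/ (2 * Q)) ^ n); [apply Rmult_le_compat_r; [lra|apply HB]|].
  right. rewrite <- Rpow_mult_distr. f_equal. field. lra.
Qed.

Lemma hyp2F1_pser (a b : C) (c xi rho : R) (v : C) : 0 < c -> 0 < xi < rho -> rho < 1 ->
  pser rho xi (cpfaff (hyp_coef a b c)) v ->
  hyp2F1 a b c (xi / (xi - 1))%R = v.
Proof.
  intros Hc Hxi Hr [H1 H2].
  destruct (hyp_coef_radius a b c Hc) as (s0 & Hs0 & Hs).
  pose proof (hyp2F1_eval a b c xi rho s0 Hxi Hr Hs0 Hs H1) as HE.
  exact (is_cseries_unique _ _ _ HE H2).
Qed.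

Lemma pfaff_zero N : pfaff 0 (fun _ => 0) N = 0.
Proof.
  rewrite (pfaff_ext 0 _ (fun _ => 0 * 0)) by (intros; ring).
  rewrite pfaff_scal. ring.
Qed.

Lemma cpfaff_RtoC (f : nat -> C) (g : nat -> R) : (forall k, f k = RtoC (g k)) ->
  forall n, cpfaff f n = RtoC (pfaff 0 g n).
Proof.
  intros H n. unfold cpfaff, RtoC. f_equal.
  - apply pfaff_ext; intros k; rewrite H; reflexivity.
  - transitivity (pfaff 0 (fun _ => 0) n); [|apply pfaff_zero].
    apply pfaff_ext; intros k; rewrite H; reflexivity.
Qed.

Lemma poch_rising (c : R) k : poch (RtoC c) k = RtoC (rising c k).
Proof. induction k as [|k IH]; [reflexivity|]. simpl. rewrite IH, RtoC_mult, RtoC_plus; reflexivity. Qed.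

Section Phi.
Variables (nu : C) (beta : R).
Hypothesis Hnu : (nu * nu)%C = RtoC (1 / 4 - beta).
Hypothesis Hb : 0 < beta.

Definition param_a (i : nat) : C := (- (1/2)%R - nu + INR i)%C.
Definition param_b (i : nat) : C := (- (1/2)%R + nu + INR i)%C.

Lemma half_C : (RtoC (1 / 2) + RtoC (1 / 2))%C = RtoC 1.
Proof. rewrite <- RtoC_plus. f_equal. lra. Qed.

Lemma param_shift i k : ((param_a i + INR k) * (param_b i + INR k))%C
  = RtoC ((INR k + INR i - 1 / 2) ^ 2 - (1 / 4 - beta)).
Proof.
  rewrite RtoC_minus, <- Hnu, RtoC_pow, RtoC_minus, RtoC_plus. unfold param_a, param_b. ring.
Qed.

Lemma poch_phi1 k : (poch (param_a 1) k * poch (param_b 1) k)%C = RtoC (quad_poch beta k).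
Proof.
  induction k as [|k IH]; [simpl; ring|].
  cbn [poch quad_poch]. rewrite RtoC_mult, <- IH.
  transitivity (poch (param_a 1) k * poch (param_b 1) k * ((param_a 1 + INR k) * (param_b 1 + INR k)))%C; [ring|].
  rewrite param_shift. f_equal. f_equal. simpl (INR 1). field.
Qed.

Lemma poch_phi0 k : (poch (param_a 0) (S k) * poch (param_b 0) (S k))%C = RtoC (beta * quad_poch beta k).
Proof.
  induction k as [|k IH].
  - transitivity ((param_a 0 + INR 0) * (param_b 0 + INR 0))%C; [simpl; ring|].
    rewrite param_shift. f_equal. simpl. field.
  - set (m := S k) in *.
    change (poch (param_a 0) m * (param_a 0 + INR m) * (poch (param_b 0) m * (param_b 0 + INR m)) = RtoC (beta * quad_poch beta m))%C.
    transitivity (poch (param_a 0) m * poch (param_b 0) m * ((param_a 0 + INR m) * (param_b 0 + INR m)))%C; [ring|].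
    rewrite IH, param_shift, <- RtoC_mult. f_equal. unfold m. cbn [quad_poch]. rewrite S_INR. simpl (INR 0). field.
Qed.

Lemma hyp_coef_1 x k : 0 <= x -> hyp_coef (param_a 1) (param_b 1) (x + INR 1)%R k = RtoC (phi1_hyp beta x k).
Proof.
  intros Hx. unfold hyp_coef. rewrite poch_phi1, poch_rising. unfold phi1_hyp. simpl (INR 1).
  assert (rising (x + 1) k <> 0) by (apply Rgt_not_eq, rising_pos; lra).
  pose proof (INR_fact_neq_0 k).
  rewrite <- RtoC_mult, <- RtoC_div; [reflexivity|].
  apply Rmult_integral_contrapositive_currified; assumption.
Qed.

(** The coefficients of phi_0(x) in z, in the form f + (1 - z) theta f/x with f the series of phi_1(x); the shape matches
    [pfaff_theta], so that phi_0 = phi_1 + (xi d/dxi phi_1)/x. *)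
Definition phi0_hyp (x : R) (k : nat) : R :=
  phi1_hyp beta x k + / x * ((INR k + 0) * phi1_hyp beta x k - lag (fun i => (INR i + 0) * phi1_hyp beta x i) k).

Lemma hyp_coef_0 x k : 0 < x -> hyp_coef (param_a 0) (param_b 0) (x + INR 0)%R k = RtoC (phi0_hyp x k).
Proof.
  intros Hx. unfold hyp_coef. rewrite poch_rising. simpl (INR 0). rewrite Rplus_0_r.
  destruct k as [|k].
  - unfold phi0_hyp, phi1_hyp. simpl. rewrite <- !RtoC_mult, <- RtoC_div by lra. f_equal. field. lra.
  - rewrite poch_phi0, rising_shift. unfold phi0_hyp. cbn [lag].
    pose proof (phi1_hyp_S beta x k ltac:(lra)) as E. rewrite S_INR in *. pose proof (pos_INR k).
    replace (phi1_hyp beta x (S k) + / x * ((INR k + 1 + 0) * phi1_hyp beta x (S k) - (INR k + 0) * phi1_hyp beta x k))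
      with (/ x * / (INR k + 1) * ((INR k + 1) * (INR k + 1 + x) * phi1_hyp beta x (S k))
            - / x * INR k * phi1_hyp beta x k) by (field; lra).
    rewrite E. unfold phi1_hyp. rewrite fact_simpl, mult_INR, S_INR.
    assert (rising (x + 1) k <> 0) by (apply Rgt_not_eq, rising_pos; lra).
    pose proof (INR_fact_neq_0 k).
    rewrite <- RtoC_mult, <- RtoC_div.
    + f_equal. field. repeat split; lra.
    + repeat apply Rmult_integral_contrapositive_currified; lra.
Qed.

Lemma pfaff_phi0_hyp x n : pfaff 0 (phi0_hyp x) n = phi_coef beta x n + / x * (INR n * phi_coef beta x n).
Proof.
  unfold phi0_hyp. rewrite pfaff_plus, pfaff_scal, pfaff_theta. unfold phi_coef. ring.
Qed.

Variable xi : R.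
Hypothesis Hxi : 0 < xi < 1.

Let rho := (1 + xi) / 2.

Lemma phi_1_eval x : 0 <= x -> phi nu xi 1 x = RtoC (Bser beta xi x).
Proof.
  intros Hx. unfold phi. simpl (INR 1) at 3.
  apply (hyp2F1_pser _ _ (x + 1) xi rho); try (unfold rho; lra).
  apply pser_ext with (fun n => RtoC (phi_coef beta x n)).
  - intros n. symmetry. apply cpfaff_RtoC. intros k. apply hyp_coef_1, Hx.
  - apply pser_h; unfold rho; lra.
Qed.

Lemma pser_phi0 x : 0 < x ->
  pser rho xi (fun n => RtoC (pfaff 0 (phi0_hyp x) n)) (Bser beta xi x + / x * Dser beta xi x)%R.
Proof.
  intros Hx. rewrite RtoC_plus, RtoC_mult.
  apply pser_ext with (fun n => RtoC (phi_coef beta x n) + RtoC (/ x) * RtoC (INR n * phi_coef beta x n))%C.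
  - intros n. rewrite pfaff_phi0_hyp, RtoC_plus, (RtoC_mult (/ x)). reflexivity.
  - apply pser_plus; [unfold rho; lra|apply pser_h|apply pser_scal, pser_nh]; unfold rho; lra.
Qed.

Lemma phi_0_eval x : 0 < x -> phi nu xi 0 x = RtoC (Bser beta xi x + / x * Dser beta xi x).
Proof.
  intros Hx. unfold phi.
  apply (hyp2F1_pser _ _ (x + INR 0) xi rho); try (simpl; unfold rho; lra).
  eapply pser_ext; [|apply pser_phi0, Hx].
  intros n. symmetry. apply cpfaff_RtoC. intros k. apply hyp_coef_0, Hx.
Qed.

Lemma pser_lag (g : nat -> R) v : pser rho xi (fun n => RtoC (pfaff 0 g n)) v ->
  pser rho xi (fun n => RtoC (pfaff 0 (lag g) n)) (- (xi / (1 - xi)) * v)%C.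
Proof.
  intros H.
  replace (- (xi / (1 - xi)) * v)%C with (- (1) * (xi / (1 - xi) * v))%C by ring.
  eapply pser_ext; [|apply (pser_scal _ _ (-(1))%C), pser_lagsum, H]; try (unfold rho; lra).
  intros [|n]; cbv beta.
  - rewrite pfaff_lag_0. simpl. ring.
  - rewrite pfaff_lag. simpl. rewrite RtoC_opp. ring.
Qed.

Lemma poch_shift a k : poch a (S k) = (a * poch (a + 1) k)%C.
Proof.
  induction k as [|k IH]; [simpl; ring|].
  change (poch a (S (S k))) with (poch a (S k) * (a + INR (S k)))%C.
  rewrite IH, S_INR, RtoC_plus. cbn [poch]. ring.
Qed.

Lemma param_1 : (param_a 1 * param_b 1)%C = RtoC beta.
Proof.
  pose proof (param_shift 1 0) as E. simpl (INR 0) in E. rewrite !Cplus_0_r in E. rewrite E.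
  f_equal. simpl. field.
Qed.

Lemma poch_tilde k :
  (poch ((3/2)%R + nu) (S k) * poch (param_a 0) (S k))%C
  = (- ((param_b 1 + INR k) * (param_b 1 + INR k + 1)) * quad_poch beta k)%C.
Proof.
  assert (Eb : ((3/2)%R + nu)%C = (param_b 1 + 1)%C).
  { unfold param_b. simpl (INR 1). replace (3/2) with (- (1/2) + 1 + 1) by field.
    rewrite !RtoC_plus, RtoC_opp. ring. }
  assert (Ea : param_a 0 = (- param_b 1)%C).
  { unfold param_a, param_b. simpl (INR 0). simpl (INR 1). rewrite <- half_C. ring. }
  assert (Ea1 : (param_a 0 + 1)%C = param_a 1) by (unfold param_a; simpl (INR 0); simpl (INR 1); ring).
  assert (Hb1 : param_b 1 <> 0).
  { intros E. pose proof param_1 as E1. rewrite E, Cmult_0_r in E1. apply RtoC_inj in E1. lra. }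
  pose proof (poch_shift (param_b 1) (S k)) as E1. cbn [poch] in E1. rewrite <- Eb in E1.
  pose proof (poch_shift (param_a 0) k) as E2. rewrite Ea1 in E2. rewrite E2, Ea.
  fold (poch ((3/2)%R + nu) (S k)) in E1.
  rewrite <- poch_phi1.
  transitivity (- (param_b 1 * (poch ((3/2)%R + nu) k * ((3/2)%R + nu + INR k))) * poch (param_a 1) k)%C;
    [cbn [poch]; ring|].
  rewrite <- E1, S_INR, RtoC_plus. ring.
Qed.

(** The part of the coefficients of phi-tilde that is free of nu; see [hyp_coef_tilde]. *)
Definition phit_hyp (x : R) (k : nat) : R :=
  phi0_hyp x k - / x * lag (fun i => INR i * phi1_hyp beta x i) k.

(** Separating the part proportional to 1 + 2 nu leaves real sequences, to which the real transform applies. *)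
Lemma hyp_coef_tilde x k : 0 < x ->
  hyp_coef ((3/2)%R + nu)%C (param_a 0) x k
  = (RtoC (phit_hyp x k) + - ((1 + 2 * nu) / x) * RtoC (lag (phi1_hyp beta x) k))%C.
Proof.
  intros Hx. assert (HxC : RtoC x <> 0) by (intros E; apply RtoC_inj in E; lra).
  destruct k as [|k].
  - unfold hyp_coef, phit_hyp, phi0_hyp, phi1_hyp. simpl.
    replace (1 / (1 * 1) + / x * ((0 + 0) * (1 / (1 * 1)) - 0) - / x * 0) with 1 by (field; lra).
    field. repeat split; solve [assumption | exact C1_nz].
  - unfold hyp_coef. rewrite poch_tilde, poch_rising. unfold phit_hyp. cbn [lag].
    assert (E0 : phi0_hyp x (S k) = / x * / (INR k + 1) * beta * phi1_hyp beta x k).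
    { unfold phi0_hyp. cbn [lag]. pose proof (phi1_hyp_S beta x k ltac:(lra)) as E.
      rewrite S_INR in *. pose proof (pos_INR k).
      replace (phi1_hyp beta x (S k) + / x * ((INR k + 1 + 0) * phi1_hyp beta x (S k) - (INR k + 0) * phi1_hyp beta x k))
      with (/ x * / (INR k + 1) * ((INR k + 1) * (INR k + 1 + x) * phi1_hyp beta x (S k))
            - / x * INR k * phi1_hyp beta x k) by (field; lra).
      rewrite E. field. lra. }
    rewrite E0, rising_shift. unfold phi1_hyp. rewrite fact_simpl, mult_INR, S_INR.
    assert (H1 : rising (x + 1) k <> 0) by (apply Rgt_not_eq, rising_pos; lra).
    pose proof (INR_fact_neq_0 k) as H2. pose proof (pos_INR k) as H3.
    assert (H1C : RtoC (rising (x + 1) k) <> 0) by (intros E; apply RtoC_inj in E; auto).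
    assert (H2C : RtoC (INR (fact k)) <> 0) by (intros E; apply RtoC_inj in E; auto).
    assert (H3C : (RtoC (INR k) + 1)%C <> 0) by (rewrite <- RtoC_plus; intros E; apply RtoC_inj in E; lra).
    assert (H4 : rising (x + 1) k * INR (fact k) <> 0) by (apply Rmult_integral_contrapositive_currified; assumption).
    assert (Hbb : ((param_b 1 + INR k) * (param_b 1 + INR k + 1))%C
                  = (INR k * (INR k + 1) - beta + (1 + 2 * nu) * (INR k + 1))%C).
    { rewrite <- param_1. unfold param_a, param_b. simpl (INR 1). rewrite <- half_C. ring. }
    rewrite Hbb.
    rewrite RtoC_minus, !RtoC_mult, !RtoC_div by assumption.
    rewrite !RtoC_mult, !RtoC_inv, RtoC_plus by lra.
    field. repeat split; assumption.
Qed.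

Lemma pser_theta x : 0 <= x ->
  pser rho xi (fun n => RtoC (pfaff 0 (fun i => INR i * phi1_hyp beta x i) n)) ((1 - xi) * Dser beta xi x)%C.
Proof.
  intros Hx.
  replace ((1 - xi) * Dser beta xi x)%C
    with (Dser beta xi x + - (1) * (xi * Dser beta xi x))%C by ring.
  eapply pser_ext; [|apply pser_plus; [|apply (pser_nh beta rho xi x)|apply pser_scal, pser_clag, (pser_nh beta rho xi x)]];
    try (unfold rho; lra).
  intros [|n]; cbv beta; cbn [clag].
  - rewrite pfaff_0. simpl (INR 0). rewrite !Rmult_0_l. ring.
  - rewrite pfaff_k, RtoC_minus. unfold phi_coef. ring.
Qed.

Lemma phi_tilde_eval x : 0 < x ->
  phi_tilde nu xi x
  = (RtoC (Bser beta xi x + / x * Dser beta xi x + xi / x * Dser beta xi x)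
     + (1 + 2 * nu) / x * (xi / (1 - xi)) * Bser beta xi x)%C.
Proof.
  intros Hx. assert (HxC : RtoC x <> 0) by (intros E; apply RtoC_inj in E; lra).
  assert (HxiC : (1 - xi)%C <> 0) by (rewrite <- RtoC_minus; intros E; apply RtoC_inj in E; lra).
  unfold phi_tilde.
  replace (- (1/2)%R - nu)%C with (param_a 0) by (unfold param_a; simpl (INR 0); ring).
  apply (hyp2F1_pser _ _ x xi rho); try (unfold rho; lra).
  pose proof (pser_phi0 x Hx) as H1.
  pose proof (pser_lag _ _ (pser_theta x ltac:(lra))) as H2.
  assert (H3 : pser rho xi (fun n => RtoC (pfaff 0 (lag (phi1_hyp beta x)) n)) (- (xi / (1 - xi)) * Bser beta xi x)%C).
  { apply pser_lag. apply pser_h; unfold rho; lra. }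
  match goal with |- pser _ _ _ ?v => replace v with
    (RtoC (Bser beta xi x + / x * Dser beta xi x)%R
     + (- / x * (- (xi / (1 - xi)) * ((1 - xi) * Dser beta xi x))
        + - ((1 + 2 * nu) / x) * (- (xi / (1 - xi)) * Bser beta xi x)))%C end.
  2:{ rewrite !RtoC_plus, !RtoC_mult, RtoC_div, RtoC_inv by lra. field. split; assumption. }
  eapply pser_ext; [|apply pser_plus; [|exact H1|apply pser_plus; [|apply pser_scal, H2|apply pser_scal, H3]]];
    try (unfold rho; lra).
  intros n. cbv beta. unfold cpfaff.
  set (k2 := (- ((1 + 2 * nu) / x))%C).
  assert (Hk : forall k, hyp_coef ((3/2)%R + nu)%C (param_a 0) x k
     = (phit_hyp x k + Re k2 * lag (phi1_hyp beta x) k, Im k2 * lag (phi1_hyp beta x) k)).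
  { intros k. rewrite (hyp_coef_tilde x k Hx). fold k2. unfold RtoC, Cplus, Cmult; simpl. f_equal; unfold Re, Im; ring. }
  rewrite (pfaff_ext 0 (fun k => Re _) (fun k => phit_hyp x k + Re k2 * lag (phi1_hyp beta x) k))
    by (intros k; rewrite Hk; reflexivity).
  rewrite (pfaff_ext 0 (fun k => Im _) (fun k => Im k2 * lag (phi1_hyp beta x) k))
    by (intros k; rewrite Hk; reflexivity).
  rewrite pfaff_plus, !pfaff_scal. unfold phit_hyp. rewrite pfaff_minus, pfaff_scal.
  rewrite <- RtoC_inv by lra. clearbody k2.
  apply injective_projections; unfold Re, Im; simpl; ring.
Qed.

(** The function A^(1), written through phi_1 and its derivative in xi. *)
Definition Aser (x : R) : R := x * Bser beta xi x + 2 * Dser beta xi x.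

Lemma B_fun_eval x : 0 <= x -> B_fun nu xi x = RtoC (Bser beta xi x).
Proof. apply phi_1_eval. Qed.

Lemma A1_fun_eval x : 0 < x -> A1_fun nu xi x = RtoC (Aser x).
Proof.
  intros Hx. unfold A1_fun. rewrite phi_0_eval, phi_1_eval by lra.
  replace (RtoC 2 * RtoC (Bser beta xi x + / x * Dser beta xi x) - Bser beta xi x)%C
    with (RtoC (2 * (Bser beta xi x + / x * Dser beta xi x) - Bser beta xi x))
    by (rewrite RtoC_minus, RtoC_mult; reflexivity).
  rewrite <- RtoC_mult. f_equal. unfold Aser. field. lra.
Qed.

(** The second choice of A is the first one plus a multiple of B, hence gives the same antisymmetric combination. *)
Lemma A2_fun_eval x : 0 < x ->
  A2_fun nu xi x
  = (Aser x + 2 * (1 + 2 * nu) * xi / ((1 - xi) * (1 + xi)) * Bser beta xi x)%C.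
Proof.
  intros Hx. unfold A2_fun. rewrite phi_tilde_eval, phi_1_eval by lra.
  assert (HxC : RtoC x <> 0) by (intros E; apply RtoC_inj in E; lra).
  assert (HxiC : (1 - xi)%C <> 0) by (rewrite <- RtoC_minus; intros E; apply RtoC_inj in E; lra).
  assert (HxiC' : (1 + xi)%C <> 0) by (rewrite <- RtoC_plus; intros E; apply RtoC_inj in E; lra).
  unfold Aser.
  rewrite !RtoC_plus, !RtoC_mult, !RtoC_div, RtoC_inv, RtoC_minus, !RtoC_plus by lra.
  field. repeat split; assumption.
Qed.

End Phi.

(** * Convergence of the Euler limit for Gamma *)

Lemma is_derive_continuity_pt (f : R -> R) x l : is_derive f x l -> continuity_pt f x.
Proof.
  intros H. apply derivable_continuous_pt. exists l. apply is_derive_Reals, H.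
Qed.

Lemma taylor2 (f f1 f2 : R -> R) (b M t : R) :
  (forall s, is_derive f s (f1 s)) -> (forall s, is_derive f1 s (f2 s)) ->
  (forall s, 0 <= s <= b -> Rabs (f2 s) <= M) -> 0 <= t <= b ->
  Rabs (f t - f 0 - f1 0 * t) <= M * t ^ 2.
Proof.
  intros H1 H2 HM Ht.
  assert (HM0 : 0 <= M) by (eapply Rle_trans; [apply Rabs_pos|apply (HM 0); lra]).
  assert (Hf1 : forall s, 0 <= s <= t -> Rabs (f1 s - f1 0) <= M * t).
  { intros s Hs. destruct (MVT_gen f1 0 s f2) as (c & Hc & E).
    - intros; apply H2. - intros x _; apply (is_derive_continuity_pt f1 x (f2 x)), H2.
    - rewrite Rmin_left, Rmax_right in Hc by lra. rewrite E, Rabs_mult, Rminus_0_r, (Rabs_pos_eq s) by lra.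
      apply Rmult_le_compat; try lra; [apply Rabs_pos|apply HM; lra]. }
  destruct (MVT_gen (fun s => f s - f1 0 * s) 0 t (fun s => f1 s - f1 0)) as (c & Hc & E).
  - intros s _. auto_derive; [eexists; apply H1|]. rewrite (is_derive_unique (fun x : R => f x) s _ (H1 s)); ring.
  - intros s _. apply (is_derive_continuity_pt _ s (f1 s - f1 0)).
    auto_derive; [eexists; apply H1|]. rewrite (is_derive_unique (fun x : R => f x) s _ (H1 s)); ring.
  - rewrite Rmin_left, Rmax_right in Hc by lra.
    replace (f t - f 0 - f1 0 * t) with ((f1 c - f1 0) * (t - 0)) by (rewrite <- E; ring).
    rewrite Rabs_mult, Rminus_0_r, (Rabs_pos_eq t) by lra.
    replace (M * t ^ 2) with (M * t * t) by ring.
    apply Rmult_le_compat_r; [lra|]. apply Hf1, Hc.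
Qed.

(** exp(z l) for real l, in the real form in which powers of real numbers are written. *)
Definition cexp_line (z : C) (l : R) : C :=
  (exp (Re z * l) * cos (Im z * l), exp (Re z * l) * sin (Im z * l)).

Lemma cexp_line_plus z l m : cexp_line z (l + m) = (cexp_line z l * cexp_line z m)%C.
Proof.
  unfold cexp_line, Cmult; simpl. rewrite !Rmult_plus_distr_l, exp_plus, cos_plus, sin_plus.
  f_equal; ring.
Qed.

Lemma cexp_line_mult z w l : (cexp_line z l * cexp_line w l)%C = cexp_line (z + w)%C l.
Proof.
  unfold cexp_line, Cmult; simpl. unfold Re, Im. rewrite !Rmult_plus_distr_r, exp_plus, cos_plus, sin_plus.
  f_equal; ring.
Qed.

Lemma Cmod_le_sum z : Cmod z <= Rabs (Re z) + Rabs (Im z).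
Proof.
  replace z with (RtoC (Re z) + (0, Im z))%C at 1.
  2:{ destruct z; unfold Cplus, RtoC; simpl. f_equal; ring. }
  eapply Rle_trans; [apply Cmod_triangle|]. rewrite Cmod_R. apply Rplus_le_compat_l.
  unfold Cmod; simpl. right. rewrite <- sqrt_Rsqr_abs. f_equal. unfold Rsqr; ring.
Qed.

Lemma cexp_line_taylor z : exists M, 0 <= M /\ forall l, 0 <= l <= 1 ->
  Cmod (cexp_line z l - 1 - z * l)%C <= M * l ^ 2.
Proof.
  set (x := Re z). set (y := Im z).
  set (M := exp (Rabs x) * (Rabs (x ^ 2 - y ^ 2) + Rabs (2 * x * y))).
  assert (He : forall s, 0 <= s <= 1 -> exp (x * s) <= exp (Rabs x)).
  { intros s Hs. destruct (Req_dec (x * s) (Rabs x)) as [E|E]; [rewrite E; lra|].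
    left. apply exp_increasing. pose proof (Rle_abs x). pose proof (Rabs_pos x). nra. }
  assert (Hb : forall s p q u v, 0 <= s <= 1 -> Rabs u <= 1 -> Rabs v <= 1 ->
      Rabs (exp (x * s) * (p * u + q * v)) <= exp (Rabs x) * (Rabs p + Rabs q)).
  { intros s p q u v Hs Hu Hv. rewrite Rabs_mult, (Rabs_pos_eq (exp _)) by (left; apply exp_pos).
    apply Rmult_le_compat; [left; apply exp_pos|apply Rabs_pos|apply He, Hs|].
    eapply Rle_trans; [apply Rabs_triang|]. rewrite !Rabs_mult.
    pose proof (Rabs_pos p). pose proof (Rabs_pos q). pose proof (Rabs_pos u). pose proof (Rabs_pos v).
    apply Rplus_le_compat; nra. }
  assert (Hc : forall t, Rabs (cos t) <= 1) by (intros t; apply Rabs_le, COS_bound).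
  assert (Hs : forall t, Rabs (sin t) <= 1) by (intros t; apply Rabs_le, SIN_bound).
  exists (M + M). split.
  { unfold M. pose proof (exp_pos (Rabs x)). pose proof (Rabs_pos (x ^ 2 - y ^ 2)).
    pose proof (Rabs_pos (2 * x * y)). nra. }
  intros l Hl. eapply Rle_trans; [apply Cmod_le_sum|]. rewrite Rmult_plus_distr_r.
  apply Rplus_le_compat.
  - pose proof (taylor2 (fun t => exp (x * t) * cos (y * t))
      (fun t => exp (x * t) * (x * cos (y * t) - y * sin (y * t)))
      (fun t => exp (x * t) * ((x ^ 2 - y ^ 2) * cos (y * t) + (2 * x * y) * (- sin (y * t)))) 1 M l) as H.
    match type of H with _ -> _ -> _ -> _ -> Rabs ?a <= _ =>
      replace (Re (cexp_line z l - 1 - z * l)%C) with a end.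
    + apply H; [| | |exact Hl].
      * intros s; auto_derive; [exact I|ring]. * intros s; auto_derive; [exact I|ring].
      * intros s Hs1. apply Hb; [exact Hs1|apply Hc|rewrite Rabs_Ropp; apply Hs].
    + cbv beta. rewrite !Rmult_0_r, exp_0, cos_0, sin_0. unfold x, y, cexp_line, Re, Im. simpl. ring.
  - pose proof (taylor2 (fun t => exp (x * t) * sin (y * t))
      (fun t => exp (x * t) * (x * sin (y * t) + y * cos (y * t)))
      (fun t => exp (x * t) * ((x ^ 2 - y ^ 2) * sin (y * t) + (2 * x * y) * cos (y * t))) 1 M l) as H.
    match type of H with _ -> _ -> _ -> _ -> Rabs ?a <= _ =>
      replace (Im (cexp_line z l - 1 - z * l)%C) with a end.
    + apply H; [| | |exact Hl].
      * intros s; auto_derive; [exact I|ring]. * intros s; auto_derive; [exact I|ring].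
      * intros s Hs1. apply Hb; [exact Hs1|apply Hs|apply Hc].
    + cbv beta. rewrite !Rmult_0_r, exp_0, cos_0, sin_0. unfold x, y, cexp_line, Re, Im. simpl. ring.
Qed.

Definition is_climseq (u : nat -> C) (l : C) : Prop :=
  is_lim_seq (fun n => Re (u n)) (Re l) /\ is_lim_seq (fun n => Im (u n)) (Im l).

(** A telescoping sequence of order 1/n^2, used to compare increments. *)
Definition gap (n : nat) : R := / (INR n + 1) - / (INR n + 2).

Lemma gap_pos n : 0 < gap n.
Proof.
  unfold gap. pose proof (pos_INR n).
  assert (/ (INR n + 2) < / (INR n + 1)); [|lra].
  apply Rinv_lt_contravar; [apply Rmult_lt_0_compat; lra|lra].
Qed.

Lemma gap_series : ex_series gap.
Proof.
  apply (series_nonneg_bounded gap 1).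
  - intros n; left; apply gap_pos.
  - intros n.
    assert (E : sum_f_R0 gap n = 1 - / (INR n + 2)).
    { induction n as [|n IH]; [unfold gap; simpl; field|].
      rewrite sumR_S, IH. unfold gap. rewrite S_INR. pose proof (pos_INR n). field. lra. }
    rewrite E. pose proof (pos_INR n). assert (0 < / (INR n + 2)) by (apply Rinv_0_lt_compat; lra). lra.
Qed.

Lemma real_seq_converges (u : nat -> R) K :
  (forall n, Rabs (u (S n) - u n) <= K * gap n) -> ex_finite_lim_seq u.
Proof.
  intros H.
  assert (Hs : ex_series (fun n => u (S n) - u n)).
  { apply ex_series_Rabs, (ex_series_dom _ (fun n => K * gap n) H).
    apply ex_series_scalR, gap_series. }
  destruct Hs as [l Hl]. exists (u O + l).
  apply is_lim_seq_incr_1.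
  apply is_lim_seq_ext with (fun n => u O + sum_n (fun n => u (S n) - u n) n).
  - intros n. rewrite sum_n_Reals.
    induction n as [|n IH]; [simpl; ring|]. rewrite sumR_S, <- Rplus_assoc, IH. ring.
  - apply is_lim_seq_plus'; [apply is_lim_seq_const|exact Hl].
Qed.

(** The product of the modulus with exp(c/(n + 1)) decreases, so the sequence is bounded and its increments are summable. *)
Lemma complex_seq_converges (v : nat -> C) c : 0 <= c ->
  (forall n, Cmod (v (S n) - v n)%C <= c * gap n * Cmod (v n)) ->
  exists l, is_climseq v l.
Proof.
  intros Hc H.
  assert (HB : forall n, Cmod (v n) * exp (c * / (INR n + 1)) <= Cmod (v O) * exp c).
  { induction n as [|n IH].
    - simpl. rewrite Rplus_0_l, Rinv_1, Rmult_1_r. lra.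
    - eapply Rle_trans; [|exact IH]. rewrite S_INR.
      replace (exp (c * / (INR n + 1))) with (exp (c * gap n) * exp (c * / (INR n + 1 + 1))).
      2:{ rewrite <- exp_plus. f_equal. unfold gap. replace (INR n + 1 + 1) with (INR n + 2) by ring. ring. }
      rewrite <- Rmult_assoc. apply Rmult_le_compat_r; [left; apply exp_pos|].
      assert (Cmod (v (S n)) <= Cmod (v n) + Cmod (v (S n) - v n)%C).
      { replace (v (S n)) with (v n + (v (S n) - v n))%C at 1 by ring. apply Cmod_triangle. }
      pose proof (H n). pose proof (exp_ineq1_le (c * gap n)). pose proof (Cmod_ge_0 (v n)). nra. }
  (* Each increment is at most K times a term of the telescoping series. *)
  set (K := c * (Cmod (v O) * exp c)).
  assert (HK : forall n, Cmod (v (S n) - v n)%C <= K * gap n).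
  { intros n. eapply Rle_trans; [apply H|]. unfold K. pose proof (gap_pos n).
    assert (Hv : Cmod (v n) <= Cmod (v O) * exp c).
    { eapply Rle_trans; [|apply (HB n)]. rewrite <- (Rmult_1_r (Cmod (v n))) at 1.
      apply Rmult_le_compat_l; [apply Cmod_ge_0|].
      pose proof (exp_ineq1_le (c * / (INR n + 1))). pose proof (pos_INR n).
      assert (0 < / (INR n + 1)) by (apply Rinv_0_lt_compat; lra). nra. }
    replace (c * (Cmod (v O) * exp c) * gap n) with (c * gap n * (Cmod (v O) * exp c)) by ring.
    apply Rmult_le_compat_l; [nra|exact Hv]. }
  destruct (real_seq_converges (fun n => Re (v n)) K) as [l1 H1].
  { intros n. eapply Rle_trans; [|apply HK]. apply (Re_le_Cmod (v (S n) - v n)%C). }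
  destruct (real_seq_converges (fun n => Im (v n)) K) as [l2 H2].
  { intros n. eapply Rle_trans; [|apply HK]. apply (Im_le_Cmod (v (S n) - v n)%C). }
  exists (l1, l2). split; assumption.
Qed.

Lemma poch_neq0 z n : 0 < Re z -> poch z n <> 0.
Proof.
  intros Hz; induction n as [|n IH]; [exact C1_nz|]. simpl. apply Cmult_neq_0; [exact IH|].
  intros E. apply (f_equal Re) in E. simpl in E. pose proof (pos_INR n). unfold Re in *. lra.
Qed.

Lemma ln_bounds n : / (INR n + 2) <= ln ((INR n + 2) / (INR n + 1)) <= / (INR n + 1).
Proof.
  pose proof (pos_INR n).
  assert (Hln : forall t, 0 < t -> ln t <= t - 1).
  { intros t Ht. pose proof (exp_ineq1_le (ln t)) as Hx. rewrite exp_ln in Hx by assumption. lra. }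
  split.
  - assert (E : ln ((INR n + 2) / (INR n + 1)) = - ln ((INR n + 1) / (INR n + 2))).
    { rewrite !ln_div by lra. ring. }
    rewrite E. specialize (Hln ((INR n + 1) / (INR n + 2))).
    assert (Hp : 0 < (INR n + 1) / (INR n + 2)) by (apply Rdiv_lt_0_compat; lra).
    specialize (Hln Hp).
    replace ((INR n + 1) / (INR n + 2) - 1) with (- / (INR n + 2)) in Hln by (field; lra). lra.
  - assert (Hp : 0 < (INR n + 2) / (INR n + 1)) by (apply Rdiv_lt_0_compat; lra).
    specialize (Hln _ Hp).
    replace ((INR n + 2) / (INR n + 1) - 1) with (/ (INR n + 1)) in Hln by (field; lra). lra.
Qed.

(** Consecutive terms have ratio (1 + 1/n)^z (n + 1)/(z + n + 1) = 1 + O(1/n^2). *)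
Lemma Gamma_seq_converges z : 0 < Re z -> is_climseq (Gamma_seq z) (CGamma z).
Proof.
  intros Hz.
  destruct (cexp_line_taylor z) as (M & HM & HT).
  assert (Hex : exists l, is_climseq (fun n => Gamma_seq z (S n)) l).
  { apply (complex_seq_converges _ (2 * M + Cmod z)).
    { pose proof (Cmod_ge_0 z); lra. }
    intros n. pose proof (pos_INR n) as Hn.
    (* The sequence is used from index 1 on, so that the step goes from n + 1 to n + 2. *)
    set (l := ln ((INR n + 2) / (INR n + 1))).
    set (N := INR n + 2).
    assert (HzN : (z + N)%C <> 0).
    { intros E. apply (f_equal Re) in E. simpl in E. unfold Re in *; unfold N in *; lra. }
    assert (Hr : Gamma_seq z (S (S n)) = (Gamma_seq z (S n) * (N * cexp_line z l / (z + N)))%C).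
    { unfold Gamma_seq.
      change (Rpowc (INR (S (S n))) z) with (cexp_line z (ln (INR (S (S n))))).
      change (Rpowc (INR (S n)) z) with (cexp_line z (ln (INR (S n)))).
      replace (ln (INR (S (S n)))) with (ln (INR (S n)) + l).
      2:{ unfold l. rewrite ln_div by lra. rewrite !S_INR. replace (INR n + 1 + 1) with (INR n + 2) by ring. ring. }
      rewrite cexp_line_plus, (fact_simpl (S n)), mult_INR, RtoC_mult.
      change (poch z (S (S (S n)))) with (poch z (S (S n)) * (z + INR (S (S n))))%C.
      replace (INR (S (S n))) with N by (rewrite !S_INR; unfold N; ring).
      pose proof (poch_neq0 z (S (S n)) Hz). field. split; assumption. }
    rewrite Hr.
    replace (Gamma_seq z (S n) * (N * cexp_line z l / (z + N)) - Gamma_seq z (S n))%C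
      with (Gamma_seq z (S n) * ((N * ((cexp_line z l - 1 - z * l) + z * (RtoC l - RtoC (/ N)))) / (z + N)))%C.
    2:{ rewrite RtoC_inv by (unfold N; lra). field. repeat split; try exact HzN.
        intros E; apply RtoC_inj in E; unfold N in E; lra. }
    rewrite Cmod_mult, Rmult_comm. apply Rmult_le_compat_r; [apply Cmod_ge_0|].
    unfold Cdiv. rewrite !Cmod_mult, Cmod_inv by exact HzN.
    assert (HN : 0 < N) by (unfold N; lra).
    assert (HmN : N <= Cmod (z + N)%C).
    { pose proof (re_le_Cmod (z + N)%C) as H1. pose proof (Rle_abs (Re (z + N)%C)).
      simpl in *. unfold Re in *. lra. }
    rewrite Cmod_R, (Rabs_pos_eq N) by lra.
    apply Rle_trans with (Cmod (cexp_line z l - 1 - z * l + z * (RtoC l - RtoC (/ N)))%C).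
    { rewrite Rmult_comm, <- Rmult_assoc.
      rewrite <- (Rmult_1_l (Cmod (cexp_line z l - 1 - z * l + z * (RtoC l - RtoC (/ N)))%C)) at 2.
      apply Rmult_le_compat_r; [apply Cmod_ge_0|].
      apply Rmult_le_reg_r with (Cmod (z + N)%C); [lra|].
      replace (/ Cmod (z + N) * N * Cmod (z + N)) with N by (field; lra). lra. }
    eapply Rle_trans; [apply Cmod_triangle|]. rewrite Cmod_mult, <- RtoC_minus, Cmod_R.
    destruct (ln_bounds n) as [L1 L2]. fold l in L1, L2. fold N in L1.
    assert (Hi1 : 0 < / N) by (apply Rinv_0_lt_compat; lra).
    assert (Hi2 : 0 < / (INR n + 1)) by (apply Rinv_0_lt_compat; lra).
    assert (Hi3 : / (INR n + 1) <= 1) by (rewrite <- Rinv_1; apply Rinv_le_contravar; lra).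
    rewrite (Rabs_pos_eq (l - / N)) by lra.
    assert (Hgap : gap n = / (INR n + 1) - / N) by reflexivity.
    assert (Hl2 : l ^ 2 <= 2 * gap n).
    { apply Rle_trans with ((/ (INR n + 1)) ^ 2); [apply pow_incr; lra|].
      rewrite Hgap. unfold N.
      apply Rmult_le_reg_r with ((INR n + 1) ^ 2 * (INR n + 2)).
      { apply Rmult_lt_0_compat; [apply pow_lt|]; lra. }
      replace ((/ (INR n + 1)) ^ 2 * ((INR n + 1) ^ 2 * (INR n + 2))) with (INR n + 2) by (field; lra).
      replace (2 * (/ (INR n + 1) - / (INR n + 2)) * ((INR n + 1) ^ 2 * (INR n + 2)))
        with (2 * (INR n + 1)) by (field; lra). lra. }
    pose proof (HT l ltac:(lra)) as HTl.
    assert (M * l ^ 2 <= M * (2 * gap n)) by (apply Rmult_le_compat_l; assumption).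
    assert (Cmod z * (l - / N) <= Cmod z * gap n) by (apply Rmult_le_compat_l; [apply Cmod_ge_0|lra]).
    lra. }
  destruct Hex as [l [H1 H2]].
  apply (is_lim_seq_incr_1 (fun n => Re (Gamma_seq z n))) in H1.
  apply (is_lim_seq_incr_1 (fun n => Im (Gamma_seq z n))) in H2.
  split.
  - change (Re (CGamma z)) with (real (Lim_seq (fun n => Re (Gamma_seq z n)))).
    rewrite (is_lim_seq_unique _ _ H1). exact H1.
  - change (Im (CGamma z)) with (real (Lim_seq (fun n => Im (Gamma_seq z n)))).
    rewrite (is_lim_seq_unique _ _ H2). exact H2.
Qed.

(** * The product formula for the cosine *)

Section Wallis.
Variables (c s : R -> R) (q : R).
Hypothesis Hc : forall t, is_derive c t (s t).
Hypothesis Hs : forall t, is_derive s t (- q * c t).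
Hypothesis c0 : c 0 = 1.
Hypothesis s0 : s 0 = 0.

(** The function c stands for cos(2 nu t), in the form c'' = - q c with q = 4 nu^2; the other case is a hyperbolic cosine, with q < 0. *)
Definition wallis_int (n : nat) : R := RInt (fun t => c t * cos t ^ n) 0 (PI / 2).

Lemma wallis_int_cont n t : continuous (fun t => c t * cos t ^ n) t.
Proof.
  apply (ex_derive_continuous (fun t => c t * cos t ^ n)). auto_derive. exists (s t); apply Hc.
Qed.

Lemma wallis_int_ex n : ex_RInt (fun t => c t * cos t ^ n) 0 (PI / 2).
Proof. apply (ex_RInt_continuous (V := R_CompleteNormedModule)). intros; apply wallis_int_cont. Qed.

Lemma wallis_int_ftc (F f : R -> R) : (forall t, is_derive F t (f t)) -> (forall t, continuous f t) ->
  is_RInt f 0 (PI / 2) (F (PI / 2) - F 0).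
Proof. intros H1 H2. apply (is_RInt_derive F f); intros; [apply H1|apply H2]. Qed.

(** The integrand of the difference is the derivative of n c(t) cos(t)^(n-1) sin(t) + c'(t) cos(t)^n, which vanishes at both ends. *)
Lemma wallis_int_rec n : (INR (S (S n)) ^ 2 - q) * wallis_int (S (S n)) = INR (S (S n)) * INR (S n) * wallis_int n.
Proof.
  set (N := INR (S (S n))).
  assert (HI : is_RInt (fun t => minus (scal (N ^ 2 - q) (c t * cos t ^ S (S n)))
                                       (scal (N * INR (S n)) (c t * cos t ^ n))) 0 (PI / 2)
      (minus (scal (N ^ 2 - q) (wallis_int (S (S n)))) (scal (N * INR (S n)) (wallis_int n)))).
  { apply (is_RInt_minus (V := R_NormedModule)); apply (is_RInt_scal (V := R_NormedModule));
    apply (RInt_correct (V := R_CompleteNormedModule)), wallis_int_ex. }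
  set (F := fun t => N * c t * cos t ^ S n * sin t + s t * cos t ^ S (S n)).
  assert (HD : forall t, is_derive F t ((N ^ 2 - q) * (c t * cos t ^ S (S n))
                                        - N * INR (S n) * (c t * cos t ^ n))).
  { intros t. unfold F. auto_derive.
    - repeat split; try (eexists; apply Hc); eexists; apply Hs.
    - rewrite (is_derive_unique (fun x : R => c x) t _ (Hc t)), (is_derive_unique (fun x : R => s x) t _ (Hs t)).
      change (Nat.pred (S n)) with n. change (Nat.pred (S (S n))) with (S n).
      assert (E : sin t ^ 2 = 1 - cos t ^ 2) by (pose proof (sin2_cos2 t) as E; unfold Rsqr in E; lra).
      change (match n with 0%nat => 1 | S _ => INR n + 1 end) with (INR (S n)).
      fold N. set (m := INR (S n)) in *. assert (EN : N = m + 1) by (unfold N; rewrite S_INR; reflexivity).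
      simpl pow.
      transitivity (c t * cos t ^ n * (N * cos t * cos t - N * m * (sin t ^ 2) - q * cos t * cos t)); [|rewrite E, EN; ring].
      rewrite EN. ring. }
  assert (HF : is_RInt (fun t => (N ^ 2 - q) * (c t * cos t ^ S (S n))
                                        - N * INR (S n) * (c t * cos t ^ n)) 0 (PI / 2) (F (PI / 2) - F 0)).
  { apply wallis_int_ftc; [exact HD|]. intros t.
    apply (continuous_minus (V := R_NormedModule)); apply (continuous_scal_r (V := R_NormedModule)), wallis_int_cont. }
  pose proof (is_RInt_unique (V := R_CompleteNormedModule) _ _ _ _ HI) as E1.
  pose proof (is_RInt_unique (V := R_CompleteNormedModule) _ _ _ _ HF) as E2.
  assert (E3 : (N ^ 2 - q) * wallis_int (S (S n)) - N * INR (S n) * wallis_int n = F (PI / 2) - F 0).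
  { rewrite <- E2. symmetry. exact E1. }
  unfold F in E3. rewrite cos_PI2, sin_0, s0 in E3. simpl in E3. simpl. lra.
Qed.

Lemma wallis_int_1 : (1 - q) * wallis_int 1 = c (PI / 2).
Proof.
  assert (HI : is_RInt (fun t => scal (1 - q) (c t * cos t ^ 1)) 0 (PI / 2) (scal (1 - q) (wallis_int 1))).
  { apply (is_RInt_scal (V := R_NormedModule)), (RInt_correct (V := R_CompleteNormedModule)), wallis_int_ex. }
  assert (HF : is_RInt (fun t => scal (1 - q) (c t * cos t ^ 1)) 0 (PI / 2)
     ((c (PI / 2) * sin (PI / 2) + s (PI / 2) * cos (PI / 2)) - (c 0 * sin 0 + s 0 * cos 0))).
  { apply (wallis_int_ftc (fun t => c t * sin t + s t * cos t)).
    - intros t. auto_derive.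
      + repeat split; try (eexists; apply Hc); eexists; apply Hs.
      + rewrite (is_derive_unique (fun x : R => c x) t _ (Hc t)), (is_derive_unique (fun x : R => s x) t _ (Hs t)).
        change scal with Rmult. simpl. ring.
    - intros t. apply (continuous_scal_r (V := R_NormedModule)), wallis_int_cont. }
  pose proof (is_RInt_unique (V := R_CompleteNormedModule) _ _ _ _ HI) as E1.
  pose proof (is_RInt_unique (V := R_CompleteNormedModule) _ _ _ _ HF) as E2.
  rewrite E1 in E2. change scal with Rmult in E2.
  rewrite E2, sin_PI2, cos_PI2, sin_0, s0. ring.
Qed.

(** Solving the recursion produces the partial products of cos(pi nu), in which the factors (2 k + 1)^2 - 4 nu^2 are 4 (k^2 + k + beta). *)
Lemma wallis_int_odd beta m : q = 1 - 4 * beta ->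
  quad_poch beta (S m) * 4 ^ S m * wallis_int (2 * m + 1) = c (PI / 2) * INR (fact (2 * m + 1)).
Proof.
  intros Hq. induction m as [|m IH].
  - simpl. pose proof wallis_int_1 as E. rewrite Hq in E. lra.
  - replace (2 * S m + 1)%nat with (S (S (2 * m + 1))) by lia.
    pose proof (wallis_int_rec (2 * m + 1)) as E.
    rewrite !fact_simpl, !mult_INR.
    transitivity (INR (S (S (2 * m + 1))) * INR (S (2 * m + 1)) * (c (PI / 2) * INR (fact (2 * m + 1)))); [|ring].
    rewrite <- IH.
    transitivity (quad_poch beta (S m) * 4 ^ S m * (INR (S (S (2 * m + 1))) * INR (S (2 * m + 1)) * wallis_int (2 * m + 1))); [|ring].
    rewrite <- E. change (quad_poch beta (S (S m))) with (quad_poch beta (S m) * (INR (S m) * INR (S m) + INR (S m) + beta)).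
    change (4 ^ S (S m)) with (4 * 4 ^ S m).
    rewrite Hq, !S_INR, plus_INR, mult_INR. simpl (INR 1). simpl (INR 2). ring.
Qed.

End Wallis.

(** The case nu = 0. *)
Definition wallis (n : nat) : R := wallis_int (fun _ => 1) n.

Lemma d_one t : is_derive (fun _ : R => 1) t ((fun _ => 0) t).
Proof. auto_derive; [exact I|ring]. Qed.
Lemma d_zero t : is_derive (fun _ : R => 0) t (- 0 * (fun _ : R => 1) t).
Proof. auto_derive; [exact I|ring]. Qed.

Lemma wallis_rec n : INR (S (S n)) * wallis (S (S n)) = INR (S n) * wallis n.
Proof.
  pose proof (wallis_int_rec (fun _ => 1) (fun _ => 0) 0 d_one d_zero eq_refl n) as E.
  fold (wallis (S (S n))) (wallis n) in E.
  apply Rmult_eq_reg_l with (INR (S (S n))); [|apply not_0_INR; lia]. lra.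
Qed.

Lemma wallis_even m : wallis (2 * m) * 4 ^ m * INR (fact m) ^ 2 = PI / 2 * INR (fact (2 * m)).
Proof.
  induction m as [|m IH].
  - simpl. unfold wallis, wallis_int. simpl.
    rewrite (RInt_ext _ (fun _ => 1)) by (intros; as_R; ring).
    rewrite RInt_const. change scal with Rmult. simpl. ring.
  - replace (2 * S m)%nat with (S (S (2 * m))) by lia.
    pose proof (wallis_rec (2 * m)) as E. rewrite !fact_simpl, !mult_INR.
    transitivity (INR (S (S (2 * m))) * INR (S (2 * m)) * (PI / 2 * INR (fact (2 * m)))); [|ring].
    rewrite <- IH.
    transitivity (INR (S (S (2 * m))) * (INR (S (2 * m)) * wallis (2 * m)) * 4 ^ m * INR (fact m) ^ 2); [|ring].
    rewrite <- E. rewrite !S_INR, mult_INR. simpl (INR 2). simpl pow. ring.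
Qed.

Lemma wallis_pos_dec n : 0 < wallis n /\ wallis (S n) <= wallis n.
Proof.
  assert (HPI := PI_RGT_0).
  assert (Hcos : forall t, 0 < t < PI / 2 -> 0 < cos t <= 1).
  { intros t Ht. split; [apply cos_gt_0; lra|apply COS_bound]. }
  split.
  - unfold wallis, wallis_int. apply RInt_gt_0; [lra| |].
    + intros t Ht. destruct (Hcos t Ht). rewrite Rmult_1_l. apply pow_lt; lra.
    + intros t Ht. apply (wallis_int_cont _ _ d_one).
  - unfold wallis, wallis_int. apply RInt_le; [lra|apply (wallis_int_ex _ _ d_one)|apply (wallis_int_ex _ _ d_one)|].
    intros t Ht. destruct (Hcos t Ht). simpl. assert (0 < cos t ^ n) by (apply pow_lt; lra). nra.
Qed.

Lemma sin_lower t : 0 <= t <= 2 -> t / 3 <= sin t.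
Proof.
  intros Ht. assert (t <= PI) by (pose proof PI2_3_2; lra).
  destruct (SIN t) as [H1 _]; [lra|assumption|].
  eapply Rle_trans; [|exact H1]. unfold sin_lb, sin_approx, sin_term. simpl.
  set (u := t * t).
  assert (Hu : 0 <= u <= 4) by (unfold u; nra).
  match goal with |- _ <= ?r => replace r with (t * (1 - u / 6 + u ^ 2 / 120 - u ^ 3 / 5040)) by (unfold u; field) end.
  assert (1 / 3 <= 1 - u / 6 + u ^ 2 / 120 - u ^ 3 / 5040) by nra. nra.
Qed.

(** Since |c(t) - 1| is at most a constant times sin(t)^2, the difference with the case nu = 0 is bounded by a multiple of
    the drop from one integral to the next but one. *)
Lemma wallis_int_asymptotic (c s : R -> R) q M :
  (forall t, is_derive c t (s t)) -> (forall t, is_derive s t (- q * c t)) ->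
  c 0 = 1 -> s 0 = 0 -> (forall t, 0 <= t <= PI / 2 -> Rabs (- q * c t) <= M) ->
  exists K, forall m, Rabs (wallis_int c (2 * m + 1) - wallis (2 * m)) <= K / INR (2 * m + 2) * wallis (2 * m).
Proof.
  intros Hc Hs c0 s0 HM.
  assert (HPI := PI_RGT_0). assert (HPI4 := PI_4).
  assert (HM0 : 0 <= M) by (eapply Rle_trans; [apply Rabs_pos|apply (HM 0); lra]).
  assert (Hcb : forall t, 0 <= t <= PI / 2 -> Rabs (c t - 1) <= 9 * M * sin t ^ 2).
  { intros t Ht. pose proof (taylor2 c s (fun t => - q * c t) (PI / 2) M t Hc Hs HM Ht) as H.
    rewrite c0, s0 in H. replace (c t - 1 - 0 * t) with (c t - 1) in H by ring.
    eapply Rle_trans; [exact H|].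
    pose proof (sin_lower t ltac:(lra)). simpl.
    assert (t * t <= 9 * (sin t * sin t)) by nra. nra. }
  (* 9 M bounds |c - 1| by sin^2, since t <= 3 sin t on the interval; the summand 1 accounts for passing from the odd to the even integral. *)
  exists (9 * M + 1). intros m.
  set (n := (2 * m + 1)%nat).
  assert (H1 : Rabs (wallis_int c n - wallis n) <= 9 * M * (wallis n - wallis (S (S n)))).
  { unfold wallis. unfold wallis_int.
    assert (Hd : is_RInt (fun t => minus (c t * cos t ^ n) (1 * cos t ^ n)) 0 (PI / 2)
               (minus (wallis_int c n) (wallis n))).
    { apply (is_RInt_minus (V := R_NormedModule)); apply (RInt_correct (V := R_CompleteNormedModule));
      [apply (wallis_int_ex _ _ Hc)|apply (wallis_int_ex _ _ d_one)]. }
    assert (Hd2 : is_RInt (fun t => scal (9 * M) (minus (1 * cos t ^ n) (1 * cos t ^ S (S n)))) 0 (PI / 2)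
               (scal (9 * M) (minus (wallis n) (wallis (S (S n)))))).
    { apply (is_RInt_scal (V := R_NormedModule)), (is_RInt_minus (V := R_NormedModule));
      apply (RInt_correct (V := R_CompleteNormedModule)); apply (wallis_int_ex _ _ d_one). }
    assert (Hpt : forall t, 0 <= t <= PI / 2 ->
       Rabs (c t * cos t ^ n - 1 * cos t ^ n) <= 9 * M * (1 * cos t ^ n - 1 * cos t ^ S (S n))).
    { intros t Ht. assert (0 <= cos t) by (apply cos_ge_0; lra).
      assert (0 <= cos t ^ n) by (apply pow_le; assumption).
      replace (c t * cos t ^ n - 1 * cos t ^ n) with ((c t - 1) * cos t ^ n) by ring.
      rewrite Rabs_mult, (Rabs_pos_eq (cos t ^ n)) by assumption.
      pose proof (sin2_cos2 t) as E. unfold Rsqr in E.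
      replace (9 * M * (1 * cos t ^ n - 1 * cos t ^ S (S n)))
        with (9 * M * sin t ^ 2 * cos t ^ n) by (simpl; replace (sin t * (sin t * 1)) with (1 - cos t * cos t) by lra; ring).
      apply Rmult_le_compat_r; [assumption|apply Hcb, Ht]. }
    apply Rabs_le. split.
    - pose proof (is_RInt_opp (V := R_NormedModule) _ _ _ _ Hd2) as Hd3.
      pose proof (is_RInt_le _ _ 0 (PI / 2) _ _ ltac:(lra) Hd3 Hd) as HL.
      apply HL. intros t Ht. specialize (Hpt t ltac:(lra)). apply Rabs_le_between in Hpt. apply Hpt.
    - pose proof (is_RInt_le _ _ 0 (PI / 2) _ _ ltac:(lra) Hd Hd2) as HL.
      apply HL. intros t Ht. specialize (Hpt t ltac:(lra)). apply Rabs_le_between in Hpt. apply Hpt. }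
  destruct (wallis_pos_dec (2 * m)) as [P0 D0]. destruct (wallis_pos_dec n) as [P1 D1].
  pose proof (wallis_rec (2 * m)) as R0. pose proof (wallis_rec n) as R1.
  replace (S (2 * m)) with n in D0 by (unfold n; lia).
  replace (S n) with (S (S (2 * m))) in D1 by (unfold n; lia).
  set (N := INR (2 * m + 2)).
  replace (INR (S (S (2 * m)))) with N in R0 by (unfold N; f_equal; lia).
  replace (INR (S (2 * m))) with (N - 1) in R0 by (unfold N; rewrite plus_INR, (S_INR (2 * m)); change (INR 2) with 2; ring).
  replace (INR (S (S n))) with (N + 1) in R1 by (unfold N, n; rewrite (S_INR (S _)), (S_INR (2 * m + 1)), !plus_INR; change (INR 2) with 2; change (INR 1) with 1; ring).
  replace (INR (S n)) with N in R1 by (unfold N, n; f_equal; lia).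
  assert (HN : 2 <= N) by (unfold N; rewrite plus_INR; pose proof (pos_INR (2 * m)); change (INR 2) with 2; lra).
  apply Rmult_le_reg_l with N; [lra|].
  replace (N * ((9 * M + 1) / N * wallis (2 * m))) with ((9 * M + 1) * wallis (2 * m)) by (field; lra).
  assert (HA : N * (wallis n - wallis (S (S n))) <= wallis (2 * m)).
  { apply Rle_trans with (wallis n); [|exact D0].
    apply Rmult_le_reg_l with (N + 1); [lra|].
    replace ((N + 1) * (N * (wallis n - wallis (S (S n)))))
      with (N * ((N + 1) * wallis n - (N + 1) * wallis (S (S n)))) by ring.
    rewrite R1. nra. }
  assert (HB : N * (wallis (2 * m) - wallis n) <= wallis (2 * m)).
  { assert (N * wallis (S (S (2 * m))) <= N * wallis n) by (apply Rmult_le_compat_l; lra). lra. }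
  replace (wallis_int c n - wallis (2 * m)) with ((wallis_int c n - wallis n) + (wallis n - wallis (2 * m))) by ring.
  pose proof (Rabs_triang (wallis_int c n - wallis n) (wallis n - wallis (2 * m))) as HTr.
  rewrite (Rabs_left1 (wallis n - wallis (2 * m))) in HTr by lra.
  assert (N * Rabs (wallis_int c n - wallis n) <= 9 * M * wallis (2 * m)).
  { apply Rle_trans with (9 * M * (N * (wallis n - wallis (S (S n))))); nra. }
  nra.
Qed.

(** The quotient of the two integrals tends to 1, and both have closed forms; this contains the product formula for the cosine
    and the formula of Wallis. *)
Lemma factorial_quad_poch_limit (c s : R -> R) beta M : 0 < beta ->
  (forall t, is_derive c t (s t)) -> (forall t, is_derive s t (- (1 - 4 * beta) * c t)) ->
  c 0 = 1 -> s 0 = 0 -> (forall t, 0 <= t <= PI / 2 -> Rabs (- (1 - 4 * beta) * c t) <= M) ->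
  0 < c (PI / 2) ->
  is_lim_seq (fun n => INR (fact n) ^ 2 * INR n / quad_poch beta (S n)) (PI / c (PI / 2)).
Proof.
  intros Hb Hc Hs c0 s0 HM Hpos.
  destruct (wallis_int_asymptotic c s _ M Hc Hs c0 s0 HM) as [K HK].
  assert (Hrat : is_lim_seq (fun m => wallis_int c (2 * m + 1) / wallis (2 * m)) 1).
  { assert (H0 : is_lim_seq (fun m => K * / INR (2 * m + 2)) 0).
    { replace (Finite 0) with (Rbar_mult K 0) by (simpl; f_equal; ring).
      apply is_lim_seq_scal_l.
      replace (Finite 0) with (Rbar_inv p_infty) by reflexivity.
      apply is_lim_seq_inv; [|discriminate].
      apply is_lim_seq_le_p_loc with INR; [|apply is_lim_seq_INR].
      exists O. intros n _. apply le_INR. lia. }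
    apply is_lim_seq_le_le with (fun m => 1 + - (K * / INR (2 * m + 2))) (fun m => 1 + K * / INR (2 * m + 2)).
    - intros m. specialize (HK m). destruct (wallis_pos_dec (2 * m)) as [P0 _].
      apply Rabs_le_between in HK.
      assert (E : wallis_int c (2 * m + 1) / wallis (2 * m) * wallis (2 * m) = wallis_int c (2 * m + 1)) by (field; lra).
      unfold Rdiv in HK at 1 2.
      split; apply Rmult_le_reg_r with (wallis (2 * m)); try assumption; lra.
    - replace (Finite 1) with (Finite (1 + - 0)) by (f_equal; ring).
      apply is_lim_seq_plus'; [apply is_lim_seq_const|].
      apply (is_lim_seq_opp _ 0), H0.
    - replace (Finite 1) with (Finite (1 + 0)) by (f_equal; ring).
      apply is_lim_seq_plus'; [apply is_lim_seq_const|exact H0]. }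
  assert (Hhalf : is_lim_seq (fun m => INR m * / (2 * INR m + 1)) (/ 2)).
  { apply is_lim_seq_ext with (fun m => / 2 * (1 + - / (2 * INR m + 1))).
    - intros m. pose proof (pos_INR m). field. lra.
    - replace (Finite (/ 2)) with (Finite (/ 2 * (1 + - 0))) by (f_equal; ring).
      apply is_lim_seq_mult'; [apply is_lim_seq_const|].
      apply is_lim_seq_plus'; [apply is_lim_seq_const|].
      apply (is_lim_seq_opp _ 0).
      replace (Finite 0) with (Rbar_inv p_infty) by reflexivity.
      apply is_lim_seq_inv; [|discriminate].
      apply is_lim_seq_le_p_loc with INR; [|apply is_lim_seq_INR].
      exists O. intros n _. pose proof (pos_INR n). lra. }
  pose proof (is_lim_seq_mult' _ _ _ _ (is_lim_seq_const (2 * PI / c (PI / 2))) (is_lim_seq_mult' _ _ _ _ Hrat Hhalf)) as HL.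
  replace (Finite (PI / c (PI / 2))) with (Finite (2 * PI / c (PI / 2) * (1 * / 2))) by (f_equal; field; lra).
  eapply is_lim_seq_ext; [|exact HL]. intros m. cbv beta.
  pose proof (wallis_int_odd c s (1 - 4 * beta) Hc Hs s0 beta m eq_refl) as E1.
  pose proof (wallis_even m) as E2.
  destruct (wallis_pos_dec (2 * m)) as [P0 _].
  assert (HP : 0 < quad_poch beta (S m)) by (apply quad_poch_pos; assumption).
  assert (H4 : 0 < 4 ^ m) by (apply pow_lt; lra).
  assert (Hf : 0 < INR (fact m)) by apply INR_fact_lt_0.
  assert (Hf2 : 0 < INR (fact (2 * m))) by apply INR_fact_lt_0.
  pose proof (pos_INR m). pose proof PI_RGT_0.
  assert (E3 : wallis_int c (2 * m + 1) = c (PI / 2) * ((2 * INR m + 1) * INR (fact (2 * m))) / (quad_poch beta (S m) * 4 ^ S m)).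
  { replace (2 * m + 1)%nat with (S (2 * m)) in * by lia. rewrite fact_simpl, mult_INR, S_INR, mult_INR in E1.
    change (INR 2) with 2 in E1. rewrite <- E1. simpl pow. field. split; lra. }
  assert (E4 : wallis (2 * m) = PI / 2 * INR (fact (2 * m)) / (4 ^ m * INR (fact m) ^ 2)).
  { rewrite <- E2. field. split; lra. }
  rewrite E3, E4. simpl pow. field. repeat split; lra.
Qed.

(** * The weight psi in closed form *)

Definition nu_beta (nu : C) : R := 1 / 4 - (Re nu ^ 2 - Im nu ^ 2).

Definition admissible (nu : C) : Prop := (Im nu = 0 /\ 0 <= Re nu < 1/2) \/ Re nu = 0.

Lemma admissible_sq nu : admissible nu -> (nu * nu)%C = RtoC (1 / 4 - nu_beta nu).
Proof.
  intros H. unfold nu_beta. destruct nu as [a b]. unfold admissible, Re, Im in *. simpl in *.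
  unfold Cmult, RtoC; simpl. destruct H as [[-> _]| ->]; f_equal; ring.
Qed.

Lemma admissible_beta nu : admissible nu -> 0 < nu_beta nu.
Proof.
  unfold admissible, nu_beta. intros [[-> H]| ->]; nra.
Qed.

Lemma admissible_re nu : admissible nu -> - (1 / 2) < Re nu < 1 / 2.
Proof. intros [[_ H]| ->]; lra. Qed.

(** The two kinds of admissible nu differ only in the choice of c: a cosine or a hyperbolic cosine. *)
Lemma cos_pi_interp nu : admissible nu -> exists (c s : R -> R) (M : R),
  (forall t, is_derive c t (s t)) /\
  (forall t, is_derive s t (- (1 - 4 * nu_beta nu) * c t)) /\
  c 0 = 1 /\ s 0 = 0 /\
  (forall t, 0 <= t <= PI / 2 -> Rabs (- (1 - 4 * nu_beta nu) * c t) <= M) /\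
  c (PI / 2) = cos_pi nu /\ 0 < cos_pi nu.
Proof.
  assert (HPI := PI_RGT_0). assert (HPI4 := PI_4).
  unfold admissible, nu_beta, cos_pi. destruct nu as [a b]. change (Re (a, b)) with a. change (Im (a, b)) with b.
  intros [[-> H]| ->].
  - exists (fun t => cos (2 * a * t)), (fun t => - (2 * a) * sin (2 * a * t)), (Rabs (- (1 - 4 * (1 / 4 - (a ^ 2 - 0 ^ 2))))).
    assert (E : Re (Ccos (PI * (a, 0))%C) = cos (PI * a)).
    { unfold Ccos, Re, Im; simpl. replace (PI * 0 + 0 * a) with 0 by ring.
      replace (PI * a - 0 * 0) with (PI * a) by ring. rewrite cosh_0. ring. }
    rewrite E. refine (conj _ (conj _ (conj _ (conj _ (conj _ (conj _ _)))))).
    + intros t. auto_derive; [exact I|ring].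
    + intros t. auto_derive; [exact I|field].
    + rewrite Rmult_0_r; apply cos_0.
    + rewrite Rmult_0_r, sin_0; ring.
    + intros t Ht. rewrite Rabs_mult. rewrite <- Rmult_1_r. apply Rmult_le_compat_l; [apply Rabs_pos|].
      apply Rabs_le, COS_bound.
    + f_equal. field.
    + apply cos_gt_0; nra.
  - exists (fun t => cosh (2 * b * t)), (fun t => (2 * b) * sinh (2 * b * t)),
      (Rabs (- (1 - 4 * (1 / 4 - (0 ^ 2 - b ^ 2)))) * exp (Rabs (2 * b) * 2)).
    assert (E : Re (Ccos (PI * (0, b))%C) = cosh (PI * b)).
    { unfold Ccos, Re, Im; simpl. replace (PI * 0 - 0 * b) with 0 by ring.
      replace (PI * b + 0 * 0) with (PI * b) by ring. rewrite cos_0. ring. }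
    rewrite E. unfold cosh, sinh. refine (conj _ (conj _ (conj _ (conj _ (conj _ (conj _ _)))))).
    + intros t. auto_derive; [exact I|field].
    + intros t. auto_derive; [exact I|field].
    + rewrite Rmult_0_r, Ropp_0, exp_0. field.
    + rewrite Rmult_0_r, Ropp_0, exp_0. field.
    + intros t Ht. rewrite Rabs_mult. apply Rmult_le_compat_l; [apply Rabs_pos|].
      assert (Hexp : forall u, Rabs u <= Rabs (2 * b) * 2 -> exp u <= exp (Rabs (2 * b) * 2)).
      { intros u Hu. destruct (Req_dec u (Rabs (2 * b) * 2)) as [<-|]; [lra|].
        left; apply exp_increasing. pose proof (Rle_abs u). lra. }
      assert (Hab : Rabs (2 * b * t) <= Rabs (2 * b) * 2).
      { rewrite Rabs_mult, (Rabs_pos_eq t) by lra. apply Rmult_le_compat_l; [apply Rabs_pos|lra]. }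
      pose proof (Hexp _ Hab). pose proof (Hexp (- (2 * b * t)) ltac:(rewrite Rabs_Ropp; exact Hab)).
      pose proof (exp_pos (2 * b * t)). pose proof (exp_pos (- (2 * b * t))).
      rewrite Rabs_pos_eq by lra. lra.
    + replace (2 * b * (PI / 2)) with (PI * b) by field. reflexivity.
    + pose proof (exp_pos (PI * b)). pose proof (exp_pos (- (PI * b))). lra.
Qed.

(** The product of the Euler sequences at 1/2 - nu + x and 1/2 + nu + x, which is real. *)
Definition gamma_product (nu : C) (x n : nat) : R :=
  INR (fact n) ^ 2 * exp ((1 + 2 * INR x) * ln (INR n)) * quad_poch (nu_beta nu) x / quad_poch (nu_beta nu) (x + S n).

Lemma poch_prod nu x k : admissible nu ->
  (poch ((1/2)%R - nu + INR x) k * poch ((1/2)%R + nu + INR x) k * quad_poch (nu_beta nu) x)%C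
  = RtoC (quad_poch (nu_beta nu) (x + k)).
Proof.
  intros Hnu. pose proof (admissible_sq nu Hnu) as Hsq.
  induction k as [|k IH].
  - rewrite Nat.add_0_r. simpl. ring.
  - replace (x + S k)%nat with (S (x + k)) by lia.
    change (quad_poch (nu_beta nu) (S (x + k))) with
      (quad_poch (nu_beta nu) (x + k) * (INR (x + k) * INR (x + k) + INR (x + k) + nu_beta nu)).
    rewrite RtoC_mult, <- IH. cbn [poch].
    replace (INR (x + k) * INR (x + k) + INR (x + k) + nu_beta nu)
      with ((1 / 2 + INR x + INR k) ^ 2 - (1 / 4 - nu_beta nu)) by (rewrite plus_INR; field).
    rewrite RtoC_minus, <- Hsq, RtoC_pow, !RtoC_plus. ring.
Qed.

Lemma Gamma_seq_prod nu x n : admissible nu ->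
  (Gamma_seq ((1/2)%R - nu + INR x) n * Gamma_seq ((1/2)%R + nu + INR x) n)%C = RtoC (gamma_product nu x n).
Proof.
  intros Hnu. unfold Gamma_seq, gamma_product.
  change (Rpowc (INR n) ((1/2)%R - nu + INR x)%C) with (cexp_line ((1/2)%R - nu + INR x)%C (ln (INR n))).
  change (Rpowc (INR n) ((1/2)%R + nu + INR x)%C) with (cexp_line ((1/2)%R + nu + INR x)%C (ln (INR n))).
  pose proof (admissible_re nu Hnu) as Hre. pose proof (pos_INR x).
  assert (H1 : poch ((1/2)%R - nu + INR x)%C (S n) <> 0).
  { apply poch_neq0. unfold Re in *; simpl. lra. }
  assert (H2 : poch ((1/2)%R + nu + INR x)%C (S n) <> 0).
  { apply poch_neq0. unfold Re in *; simpl. lra. }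
  assert (HPx : 0 < quad_poch (nu_beta nu) x) by (apply quad_poch_pos, admissible_beta, Hnu).
  assert (HPn : 0 < quad_poch (nu_beta nu) (x + S n)) by (apply quad_poch_pos, admissible_beta, Hnu).
  assert (HPxC : RtoC (quad_poch (nu_beta nu) x) <> 0) by (intros E; apply RtoC_inj in E; lra).
  rewrite (RtoC_div _ (quad_poch (nu_beta nu) (x + S n))), <- (poch_prod nu x (S n) Hnu) by lra.
  rewrite !RtoC_mult, RtoC_pow.
  assert (E : RtoC (exp ((1 + 2 * INR x) * ln (INR n)))
     = (cexp_line ((1/2)%R - nu + INR x)%C (ln (INR n)) * cexp_line ((1/2)%R + nu + INR x)%C (ln (INR n)))%C).
  { rewrite cexp_line_mult.
    replace ((1 / 2)%R - nu + INR x + ((1 / 2)%R + nu + INR x))%C with (RtoC (1 + 2 * INR x)).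
    - unfold cexp_line. simpl. rewrite Rmult_0_l, cos_0, sin_0. unfold RtoC. f_equal; ring.
    - replace (1 + 2 * INR x) with (1 / 2 + INR x + (1 / 2 + INR x)) by field.
      rewrite !RtoC_plus. ring. }
  rewrite E. field. repeat split; assumption.
Qed.

(** Induction on x, by the functional equation of Gamma at the level of the sequences. *)
Lemma gamma_product_lim nu : admissible nu -> forall x,
  is_lim_seq (gamma_product nu x) (PI / cos_pi nu * quad_poch (nu_beta nu) x).
Proof.
  intros Hnu. pose proof (admissible_beta nu Hnu) as Hb.
  destruct (cos_pi_interp nu Hnu) as (c & s & M & Hc & Hs & c0 & s0 & HM & Ec & Hpos).
  induction x as [|x IH].
  - simpl quad_poch. rewrite Rmult_1_r, <- Ec.
    apply is_lim_seq_ext_loc with (fun n => INR (fact n) ^ 2 * INR n / quad_poch (nu_beta nu) (S n)).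
    + exists 1%nat. intros n Hn. unfold gamma_product. change (0 + S n)%nat with (S n).
      change (quad_poch (nu_beta nu) 0) with 1. change (INR 0) with 0.
      replace ((1 + 2 * 0) * ln (INR n)) with (ln (INR n)) by ring.
      rewrite exp_ln by (apply lt_0_INR; lia). rewrite Rmult_1_r. reflexivity.
    + apply (factorial_quad_poch_limit c s (nu_beta nu) M); auto. rewrite Ec; exact Hpos.
  - set (b := nu_beta nu) in *.
    set (r := fun n => INR n * INR n / ((INR n + INR x + 1) * (INR n + INR x + 1) + (INR n + INR x + 1) + b)).
    assert (Hinv : is_lim_seq (fun n => / INR n) 0).
    { replace (Finite 0) with (Rbar_inv p_infty) by reflexivity.
      apply is_lim_seq_inv; [apply is_lim_seq_INR|discriminate]. }
    assert (Hr : is_lim_seq r 1).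
    { set (y := INR x + 1).
      apply is_lim_seq_ext_loc with (fun n => / ((1 + y * / INR n) * (1 + y * / INR n) + (/ INR n * (1 + y * / INR n) + b * (/ INR n * / INR n)))).
      - exists 1%nat. intros n Hn. unfold r.
        assert (0 < INR n) by (apply lt_0_INR; lia). pose proof (pos_INR x).
        assert (0 < (INR n + INR x + 1) * (INR n + INR x + 1)) by (apply Rmult_lt_0_compat; lra).
        unfold y. field. split; lra.
      - replace (Finite 1) with (Rbar_inv (Finite ((1 + y * 0) * (1 + y * 0) + (0 * (1 + y * 0) + b * (0 * 0)))))
          by (cbn [Rbar_inv]; f_equal; field).
        assert (H1 : is_lim_seq (fun n => 1 + y * / INR n) (1 + y * 0)).
        { apply is_lim_seq_plus'; [apply is_lim_seq_const|].
          apply is_lim_seq_mult'; [apply is_lim_seq_const|exact Hinv]. }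
        apply is_lim_seq_inv.
        + apply is_lim_seq_plus'; [apply is_lim_seq_mult'; assumption|].
          apply is_lim_seq_plus'; [apply is_lim_seq_mult'; assumption|].
          apply is_lim_seq_mult'; [apply is_lim_seq_const|apply is_lim_seq_mult'; assumption].
        + intros E. inversion E. lra. }
    pose proof (is_lim_seq_mult' _ _ _ _ (is_lim_seq_const (INR x * INR x + INR x + b)) (is_lim_seq_mult' _ _ _ _ IH Hr)) as HL.
    replace (PI / cos_pi nu * quad_poch b (S x)) with ((INR x * INR x + INR x + b) * (PI / cos_pi nu * quad_poch b x * 1))
      by (simpl; field; lra).
    eapply is_lim_seq_ext_loc; [|exact HL].
    exists 1%nat. intros n Hn. unfold gamma_product, r.
    assert (H0 : 0 < INR n) by (apply lt_0_INR; lia). pose proof (pos_INR x).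
    replace (S x + S n)%nat with (S (x + S n)) by lia.
    fold b. change (quad_poch b (S (x + S n))) with (quad_poch b (x + S n) * (INR (x + S n) * INR (x + S n) + INR (x + S n) + b)).
    replace (INR (x + S n)) with (INR n + INR x + 1) by (rewrite plus_INR, S_INR; ring).
    replace ((1 + 2 * INR (S x)) * ln (INR n)) with ((1 + 2 * INR x) * ln (INR n) + (ln (INR n) + ln (INR n)))
      by (rewrite S_INR; ring).
    rewrite !exp_plus, exp_ln by assumption.
    change (quad_poch b (S x)) with (quad_poch b x * (INR x * INR x + INR x + b)).
    assert (0 < quad_poch b (x + S n)) by (apply quad_poch_pos; assumption).
    assert (0 < (INR n + INR x + 1) * (INR n + INR x + 1)) by (apply Rmult_lt_0_compat; lra).
    field. split; lra.
Qed.

Lemma Gamma_prod_eval nu x : admissible nu ->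
  Gamma_prod nu x = PI / cos_pi nu * quad_poch (nu_beta nu) x.
Proof.
  intros Hnu. pose proof (admissible_re nu Hnu) as Hre. pose proof (pos_INR x).
  set (z := ((1/2)%R - nu + INR x)%C). set (w := ((1/2)%R + nu + INR x)%C).
  assert (Hz : 0 < Re z) by (unfold z, Re in *; simpl; lra).
  assert (Hw : 0 < Re w) by (unfold w, Re in *; simpl; lra).
  destruct (Gamma_seq_converges z Hz) as [Hz1 Hz2].
  destruct (Gamma_seq_converges w Hw) as [Hw1 Hw2].
  pose proof (is_lim_seq_minus' _ _ _ _ (is_lim_seq_mult' _ _ _ _ Hz1 Hw1) (is_lim_seq_mult' _ _ _ _ Hz2 Hw2)) as HL.
  assert (HL' : is_lim_seq (gamma_product nu x) (Gamma_prod nu x)).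
  { eapply is_lim_seq_ext; [|exact HL]. intros n. cbv beta.
    pose proof (f_equal Re (Gamma_seq_prod nu x n Hnu)) as E. fold z w in E.
    exact E. }
  pose proof (is_lim_seq_unique _ _ HL') as E1. pose proof (is_lim_seq_unique _ _ (gamma_product_lim nu Hnu x)) as E2.
  rewrite E1 in E2. injection E2; auto.
Qed.

Lemma cos_pi_pos nu : admissible nu -> 0 < cos_pi nu.
Proof. intros H. destruct (cos_pi_interp nu H) as (c & s & M & _ & _ & _ & _ & _ & _ & Hp). exact Hp. Qed.

Lemma psi_eval nu xi x : admissible nu ->
  psi nu xi x = xi ^ x / 2 * (quad_poch (nu_beta nu) x / INR (fact x) ^ 2).
Proof.
  intros H. unfold psi. rewrite Gamma_prod_eval by assumption.
  pose proof (cos_pi_pos nu H). pose proof PI_RGT_0. pose proof (INR_fact_neq_0 x).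
  field. repeat split; lra.
Qed.

(** * The discrete equations satisfied by A and B *)

Lemma weight_coef_pos beta i : 0 < beta -> 0 < weight_coef beta i.
Proof.
  intros Hb. apply Rdiv_lt_0_compat; [apply quad_poch_pos, Hb|].
  apply Rmult_lt_0_compat; apply INR_fact_lt_0.
Qed.

Lemma weight_coef_S beta i : 
  weight_coef beta (S (S i)) = weight_coef beta (S i) * (1 + beta * (/ INR (S i) - / INR (S (S i)))).
Proof.
  unfold weight_coef. replace (S (S i) - 1)%nat with (S i) by lia. replace (S i - 1)%nat with i by lia.
  change (quad_poch beta (S (S i))) with (quad_poch beta (S i) * (INR (S i) * INR (S i) + INR (S i) + beta)).
  rewrite (fact_simpl (S i)), (fact_simpl i), !mult_INR.
  pose proof (INR_fact_neq_0 i). pose proof (pos_INR i).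
  rewrite (S_INR (S i)), (S_INR i). field. repeat split; lra.
Qed.

(** The ratio of consecutive terms is 1 + beta/(y (y + 1)), and the product of these factors converges. *)
Lemma weight_coef_bound beta i : 0 < beta -> weight_coef beta (S i) <= beta * exp beta.
Proof.
  intros Hb.
  assert (H : weight_coef beta (S i) <= beta * exp (beta * (1 - / INR (S i)))).
  { induction i as [|i IH].
    - replace (beta * (1 - / INR 1)) with 0 by (simpl; field). rewrite exp_0.
      unfold weight_coef; simpl. right. field.
    - rewrite weight_coef_S.
      set (g := / INR (S i) - / INR (S (S i))).
      replace (beta * (1 - / INR (S (S i)))) with (beta * (1 - / INR (S i)) + beta * g) by (unfold g; ring).
      rewrite exp_plus, <- Rmult_assoc.
      assert (Hg : 0 <= g).
      { unfold g. assert (/ INR (S (S i)) <= / INR (S i)); [|lra].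
        apply Rinv_le_contravar; [apply lt_0_INR; lia|apply le_INR; lia]. }
      apply Rmult_le_compat; [left; apply weight_coef_pos, Hb|nra|exact IH|apply exp_ineq1_le]. }
  eapply Rle_trans; [exact H|]. apply Rmult_le_compat_l; [lra|].
  assert (0 < / INR (S i)) by (apply Rinv_0_lt_compat, lt_0_INR; lia).
  left. apply exp_increasing. nra.
Qed.

(** The points of the process, indexed from 0. *)
Definition pt (i : nat) : R := INR (S i).
(** The number 2 y psi(y) at the point y of index i; see [two_z_psi]. *)
Definition weight (beta xi : R) (i : nat) : R := weight_coef beta (S i) * xi ^ S i.

Lemma pt_ge1 i : 1 <= pt i.
Proof. unfold pt; rewrite S_INR; pose proof (pos_INR i); lra. Qed.

Lemma weight_pos beta xi i : 0 < beta -> 0 < xi < 1 -> 0 < weight beta xi i.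
Proof. intros; apply Rmult_lt_0_compat; [apply weight_coef_pos; assumption|apply pow_lt; lra]. Qed.

Lemma weight_summable beta xi : 0 < beta -> 0 < xi < 1 ->
  ex_series (fun i => weight beta xi i * (1 + pt i) ^ 2).
Proof.
  intros Hb Hxi. destruct (poly_geom xi Hxi) as (K & th & HK & Hth & H).
  apply (ex_series_leR _ (fun i => (beta * exp beta * K * th) * th ^ i)).
  2:{ apply ex_series_scalR, ex_series_geom. rewrite Rabs_pos_eq; lra. }
  intros i. cbv beta.
  pose proof (weight_pos beta xi i Hb Hxi) as HW. pose proof (pt_ge1 i) as Hz.
  rewrite Rabs_pos_eq by (apply Rmult_le_pos; [lra|apply pow_le; lra]).
  unfold weight. specialize (H (S i)). fold (pt i) in H.
  replace (weight_coef beta (S i) * xi ^ S i * (1 + pt i) ^ 2) with (weight_coef beta (S i) * ((1 + pt i) ^ 2 * xi ^ S i)) by ring.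
  replace (beta * exp beta * K * th * th ^ i) with (beta * exp beta * (K * th ^ S i)) by (simpl; ring).
  apply Rmult_le_compat.
  - left; apply weight_coef_pos, Hb. - apply Rmult_le_pos; apply pow_le; lra.
  - apply weight_coef_bound, Hb. - exact H.
Qed.

(** Multiplication of a power series by the (i + 1)-st power of its variable. *)
Definition delay (u : nat -> R) (i n : nat) : R := if Nat.ltb i n then u (n - S i)%nat else 0.

Lemma is_series_delay (u : nat -> R) (l : R) i : is_series u l -> is_series (delay u i) l.
Proof.
  intros Hu.
  assert (H : forall v : nat -> R, v O = 0 -> is_series (fun n => v (S n)) l -> is_series v l).
  { intros v Hv H. apply is_series_decr_1.
    match goal with |- is_series _ ?t => replace t with l; [exact H|] end.
    rewrite Hv. change (@eq R l (l + - 0)). ring. }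
  induction i as [|i IH]; apply H; try reflexivity.
  - eapply is_series_ext; [|exact Hu]. intros n. unfold delay. simpl. f_equal. lia.
  - eapply is_series_ext; [|exact IH]. intros n. unfold delay.
    change (S i <? S n)%nat with (i <? n)%nat. change (S n - S (S i))%nat with (n - S i)%nat. reflexivity.
Qed.

Lemma delay_abs u i n : Rabs (delay u i n) = delay (fun k => Rabs (u k)) i n.
Proof. unfold delay. destruct (i <? n)%nat; [reflexivity|apply Rabs_R0]. Qed.

(** The degree n part of the sum over y of W_y g(y)/(x + y), when W_y and g(y) are expanded in powers of xi. *)
Definition gcol (beta xi x : R) (g : R -> nat -> R) (n : nat) : R :=
  match n with
  | O => 0
  | S N => sum_f_R0 (fun i => weight_coef beta (S i) / (x + pt i) * g (pt i) (N - i)%nat) N * xi ^ S N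
  end.

(** Summation of the graded identities: the double series over y and the degree converges absolutely. *)
Lemma convolution_series beta xi x (g : R -> nat -> R) M :
  0 < beta -> 0 < xi < 1 -> 0 <= x -> 0 <= M ->
  (forall i, ex_series (fun n => Rabs (g (pt i) n * xi ^ n)) /\
             Series (fun n => Rabs (g (pt i) n * xi ^ n)) <= M * (1 + pt i)) ->
  is_series (gcol beta xi x g)
    (Series (fun i => weight beta xi i / (x + pt i) * Series (fun n => g (pt i) n * xi ^ n))).
Proof.
  intros Hb Hxi Hx HM Hg.
  set (u := fun i n => g (pt i) n * xi ^ n) in *.
  set (a := fun i n => weight beta xi i / (x + pt i) * delay (u i) i n).
  assert (HW : forall i, 0 < weight beta xi i / (x + pt i)).
  { intros i. apply Rdiv_lt_0_compat; [apply weight_pos; assumption|]. pose proof (pt_ge1 i). lra. }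
  assert (Hrow : forall i, is_series (fun n => Rabs (a i n))
                   (weight beta xi i / (x + pt i) * Series (fun n => Rabs (u i n)))).
  { intros i. eapply is_series_ext.
    2:{ apply is_series_scalR, (is_series_delay (fun n => Rabs (u i n)) _ i), Series_correct, (Hg i). }
    intros n. unfold a. rewrite Rabs_mult, delay_abs, (Rabs_pos_eq (_ / _)) by (left; apply HW). reflexivity. }
  assert (Ha : abs_summable2 a).
  { split; [intros i; eexists; apply Hrow|].
    eapply ex_series_ext; [intros i; symmetry; apply is_series_unique, Hrow|].
    apply (ex_series_leR _ (fun i => M * (weight beta xi i * (1 + pt i) ^ 2))).
    2:{ apply ex_series_scalR, weight_summable; assumption. }
    intros i. destruct (Hg i) as [H1 H2].
    assert (H0 : 0 <= Series (fun n => Rabs (u i n))).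
    { eapply Rle_trans; [apply (Rabs_pos (u i O))|].
      apply (term_le_series (fun n => Rabs (u i n)) O); [intros; apply Rabs_pos|exact H1]. }
    cbv beta.
    rewrite Rabs_pos_eq by (apply Rmult_le_pos; [left; apply HW|exact H0]).
    pose proof (weight_pos beta xi i Hb Hxi) as HWi. pose proof (pt_ge1 i).
    assert (Hle : weight beta xi i / (x + pt i) <= weight beta xi i).
    { unfold Rdiv. rewrite <- (Rmult_1_r (weight beta xi i)) at 2. apply Rmult_le_compat_l; [lra|].
      rewrite <- Rinv_1. apply Rinv_le_contravar; lra. }
    apply Rle_trans with (weight beta xi i * (M * (1 + pt i))).
    - apply Rmult_le_compat; [left; apply HW|exact H0|exact Hle|exact H2].
    - replace (M * (weight beta xi i * (1 + pt i) ^ 2)) with (weight beta xi i * (M * (1 + pt i)) * (1 + pt i)) by ring.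
      rewrite <- (Rmult_1_r (weight beta xi i * (M * (1 + pt i)))) at 1.
      apply Rmult_le_compat_l; [|lra]. apply Rmult_le_pos; [lra|]. apply Rmult_le_pos; lra. }
  pose proof (fubini a Ha) as HF.
  replace (Series (fun i => weight beta xi i / (x + pt i) * Series (fun n => g (pt i) n * xi ^ n)))
    with (Series (fun i => Series (a i))).
  - eapply is_series_ext; [|exact HF]. intros [|N].
    + unfold gcol, a, delay. simpl. apply is_series_unique.
      apply (is_series_ext (fun _ => 0)); [intros; as_R; ring|exact is_series_0].
    + apply is_series_unique. cbn [gcol].
      rewrite (Rmult_comm (sum_f_R0 _ _)), <- sumR_scal.
      rewrite (sumR_ext_loc _ (fun i => a i (S N))).
      * apply is_series_finite. intros i Hi. unfold a, delay.
        destruct (Nat.ltb_spec i (S N)); [lia|ring].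
      * intros i Hi. unfold a, delay, u. destruct (Nat.ltb_spec i (S N)); [|lia].
        replace (S N - S i)%nat with (N - i)%nat by lia.
        unfold weight. replace (S N) with (S i + (N - i))%nat at 1 by lia. rewrite pow_add.
        pose proof (pt_ge1 i). field. lra.
  - apply Series_ext. intros i. unfold a. rewrite Series_scal_l. f_equal.
    apply is_series_unique, is_series_delay, Series_correct, ex_series_Rabs, (Hg i).
Qed.

Lemma series_geom_le (u : nat -> R) K th : 0 < th < 1 ->
  (forall n, Rabs (u n) <= K * th ^ n) ->
  ex_series (fun n => Rabs (u n)) /\ Series (fun n => Rabs (u n)) <= K / (1 - th).
Proof.
  intros Hth H. split; [apply (ex_series_geom_bound u K th Hth H)|].
  assert (HG : is_series (fun n => K * th ^ n) (K * / (1 - th))).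
  { apply is_series_scalR, is_series_geom. rewrite Rabs_pos_eq; lra. }
  unfold Rdiv. rewrite <- (is_series_unique _ _ HG).
  apply Series_le; [|eexists; exact HG]. intros n; split; [apply Rabs_pos|apply H].
Qed.

Definition Acoef (beta x : R) (n : nat) : R := (x + 2 * INR n) * phi_coef beta x n.

Lemma AB_bounds beta xi : 0 < beta -> 0 < xi < 1 ->
  exists M, 0 <= M /\ forall x, 0 <= x ->
    (ex_series (fun n => Rabs (phi_coef beta x n * xi ^ n)) /\
     Series (fun n => Rabs (phi_coef beta x n * xi ^ n)) <= M) /\
    (ex_series (fun n => Rabs (Acoef beta x n * xi ^ n)) /\
     Series (fun n => Rabs (Acoef beta x n * xi ^ n)) <= M * (1 + x)).
Proof.
  intros Hb Hxi. destruct (phi_coef_geom beta xi Hb Hxi) as (K & th & HK & Hth & H).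
  assert (Hth1 : 0 < / (1 - th)) by (apply Rinv_0_lt_compat; lra).
  exists (2 * K / (1 - th)). split; [apply Rmult_le_pos; lra|].
  intros x Hx. split.
  - destruct (series_geom_le (fun n => phi_coef beta x n * xi ^ n) K th Hth) as [H1 H2].
    + intros n. eapply Rle_trans; [|apply (H x n Hx)].
      assert (0 <= xi ^ n) by (apply pow_le; lra).
      rewrite Rabs_mult, (Rabs_pos_eq (_ ^ _)) by assumption.
      apply Rmult_le_compat_r; [assumption|]. pose proof (pos_INR n). pose proof (Rabs_pos (phi_coef beta x n)). nra.
    + split; [exact H1|]. eapply Rle_trans; [exact H2|].
      unfold Rdiv. apply Rmult_le_compat_r; lra.
  - destruct (series_geom_le (fun n => Acoef beta x n * xi ^ n) (2 * K * (1 + x)) th Hth) as [H1 H2].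
    + intros n. specialize (H x n Hx).
      assert (0 <= xi ^ n) by (apply pow_le; lra). pose proof (pos_INR n).
      unfold Acoef.
      rewrite !Rabs_mult, (Rabs_pos_eq (_ ^ _)), (Rabs_pos_eq (x + _)) by lra.
      apply Rle_trans with ((2 * (1 + x)) * ((1 + INR n) * Rabs (phi_coef beta x n) * xi ^ n)).
      * replace (2 * (1 + x) * ((1 + INR n) * Rabs (phi_coef beta x n) * xi ^ n))
          with (2 * (1 + x) * (1 + INR n) * (Rabs (phi_coef beta x n) * xi ^ n)) by ring.
        rewrite Rmult_assoc. apply Rmult_le_compat_r; [|nra].
        apply Rmult_le_pos; [apply Rabs_pos|assumption].
      * replace (2 * K * (1 + x) * th ^ n) with (2 * (1 + x) * (K * th ^ n)) by ring.
        apply Rmult_le_compat_l; lra.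
    + split; [exact H1|]. eapply Rle_trans; [exact H2|]. right. field. lra.
Qed.

Lemma Aser_series beta xi x : 0 < beta -> 0 < xi < 1 -> 0 <= x ->
  is_series (fun n => Acoef beta x n * xi ^ n) (Aser beta xi x).
Proof.
  intros Hb Hxi Hx. unfold Aser.
  pose proof (is_series_plus _ _ _ _
    (is_series_scalR x _ _ (Series_correct _ (ex_series_Rabs _ (Bser_abs beta xi x Hb Hxi Hx))))
    (is_series_scalR 2 _ _ (Series_correct _ (ex_series_Rabs _ (Dser_abs beta xi x Hb Hxi Hx))))) as H.
  eapply is_series_ext; [|exact H]. intros n.
  change (x * (phi_coef beta x n * xi ^ n) + 2 * (INR n * phi_coef beta x n * xi ^ n) = Acoef beta x n * xi ^ n).
  unfold Acoef; ring.
Qed.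

Lemma is_series_delta (v : R) : is_series (fun n => match n with O => v | S _ => 0 end) v.
Proof.
  pose proof (is_series_finite (fun n => match n with O => v | S _ => 0 end) 0) as H.
  apply H. intros [|n] Hn; [lia|reflexivity].
Qed.

Lemma B_equation beta xi x : 0 < beta -> 0 < xi < 1 -> 0 <= x ->
  Bser beta xi x + Series (fun i => weight beta xi i / (x + pt i) * Bser beta xi (pt i)) = 1.
Proof.
  intros Hb Hxi Hx. destruct (AB_bounds beta xi Hb Hxi) as (M & HM & HAB).
  assert (Hc := convolution_series beta xi x (phi_coef beta) M Hb Hxi Hx HM).
  assert (Hd : is_series (gcol beta xi x (phi_coef beta))
     (Series (fun i => weight beta xi i / (x + pt i) * Bser beta xi (pt i)))).
  { apply Hc. intros i. pose proof (pt_ge1 i).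
    destruct (HAB (pt i) ltac:(lra)) as [[H1 H2] _]. split; [exact H1|]. nra. }
  pose proof (is_series_plus _ _ _ _ (Series_correct _ (ex_series_Rabs _ (Bser_abs beta xi x Hb Hxi Hx))) Hd) as H.
  pose proof (is_series_unique _ _ H) as E1.
  pose proof (is_series_unique _ _ (is_series_delta 1)) as E2.
  change plus with Rplus in E1. fold (Bser beta xi x) in E1. rewrite <- E1, <- E2.
  apply Series_ext. intros [|N].
  - simpl. rewrite phi_coef_0. ring.
  - cbn [gcol]. pose proof (phi_coef_convolution beta x N Hb Hx) as E. unfold pt.
    rewrite <- Rmult_plus_distr_r, E. ring.
Qed.

(** The constant is the sum over y of W_y B(y). *)
Lemma A_equation beta xi : 0 < beta -> 0 < xi < 1 -> exists c, forall x, 0 <= x ->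
  Aser beta xi x + Series (fun i => weight beta xi i / (x + pt i) * Aser beta xi (pt i)) = x - c.
Proof.
  intros Hb Hxi. destruct (AB_bounds beta xi Hb Hxi) as (M & HM & HAB).
  set (Q := fun N => sum_f_R0 (fun i => weight_coef beta (S i) * phi_coef beta (INR (S i)) (N - i)) N).
  exists (Series (fun N => Q N * xi ^ S N)). intros x Hx.
  assert (Hc := convolution_series beta xi x (Acoef beta) M Hb Hxi Hx HM).
  assert (Hd : is_series (gcol beta xi x (Acoef beta))
     (Series (fun i => weight beta xi i / (x + pt i) * Aser beta xi (pt i)))).
  { rewrite (Series_ext (fun i => weight beta xi i / (x + pt i) * Aser beta xi (pt i))
      (fun i => weight beta xi i / (x + pt i) * Series (fun n => Acoef beta (pt i) n * xi ^ n))).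
    - apply Hc. intros i. pose proof (pt_ge1 i). apply (HAB (pt i) ltac:(lra)).
    - intros i. f_equal. symmetry. apply is_series_unique, Aser_series; try assumption. pose proof (pt_ge1 i); lra. }
  pose proof (is_series_plus _ _ _ _ (Aser_series beta xi x Hb Hxi Hx) Hd) as H.
  change plus with Rplus in H.
  set (L := Aser beta xi x + _) in *.
  assert (H' : is_series (fun n => match n with O => x | S N => - (Q N * xi ^ S N) end) L).
  { eapply is_series_ext; [|exact H]. intros [|N].
    - simpl. unfold Acoef. rewrite phi_coef_0. simpl. ring.
    - cbn [gcol]. pose proof (Acoef_convolution beta x N Hb Hx) as E. unfold Acoef, pt.
      rewrite <- Rmult_plus_distr_r, E. unfold Q. as_R. ring. }
  assert (H2 : is_series (fun N => - (Q N * xi ^ S N)) (L - x)).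
  { apply (is_series_incr_1 (fun n => match n with O => x | S N => - (Q N * xi ^ S N) end)).
    match goal with |- is_series _ ?t => replace t with L; [exact H'|] end.
    change (@eq R L ((L - x) + x)). ring. }
  rewrite (Series_ext (fun N => Q N * xi ^ S N) (fun N => - (- (Q N * xi ^ S N)))) by (intros; ring).
  rewrite Series_opp, (is_series_unique _ _ H2). ring.
Qed.

Lemma pser_unique rho xi u v v' : pser rho xi u v -> pser rho xi u v' -> v = v'.
Proof. intros [_ H1] [_ H2]; exact (is_cseries_unique _ _ _ H1 H2). Qed.

Lemma B_lower beta xi x : 0 < beta -> 0 < xi < 1 -> 0 <= x ->
  (x + 1) * Bser beta xi x = (x + 1) * Bser beta xi (x + 1) + (1 - xi) * Dser beta xi (x + 1).
Proof.
  intros Hb Hxi Hx. set (rho := (1 + xi) / 2).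
  assert (Hr : 0 < xi < rho /\ rho < 1) by (unfold rho; lra). destruct Hr as [Hr1 Hr2].
  apply RtoC_inj.
  pose proof (pser_scal rho xi (x + 1)%R _ _ (pser_h beta rho xi x Hb Hr1 Hr2 Hx)) as H1.
  pose proof (pser_h beta rho xi (x + 1) Hb Hr1 Hr2 ltac:(lra)) as H2.
  pose proof (pser_nh beta rho xi (x + 1) Hb Hr1 Hr2 ltac:(lra)) as H3.
  assert (Hr0 : 0 < rho) by lra.
  pose proof (pser_plus _ _ _ _ _ _ Hr0 (pser_scal _ _ (x + 1)%R _ _ H2)
     (pser_plus _ _ _ _ _ _ Hr0 H3 (pser_scal _ _ (-(1))%C _ _ (pser_clag _ _ _ _ H3)))) as H4.
  assert (H5 : pser rho xi (fun n => (x + 1)%R * RtoC (phi_coef beta x n))%C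
     ((x + 1)%R * Bser beta xi (x + 1) + (Dser beta xi (x + 1) + - (1) * (xi * Dser beta xi (x + 1))))%C).
  { eapply pser_ext; [|exact H4]. intros [|n]; cbv beta; cbn [clag].
    - rewrite !phi_coef_0. simpl (INR 0). rewrite Rmult_0_l. ring.
    - rewrite <- !RtoC_mult, <- RtoC_opp, <- !RtoC_mult, <- !RtoC_plus. f_equal.
      rewrite (phi_coef_lower beta x n Hx). ring. }
  rewrite RtoC_mult, (pser_unique _ _ _ _ _ H1 H5).
  rewrite (RtoC_plus ((x + 1) * _)), !RtoC_mult, RtoC_minus. ring.
Qed.

Lemma D_lower beta xi x : 0 < beta -> 0 < xi < 1 -> 0 <= x ->
  (x + 1) * Dser beta xi x = x * xi * Dser beta xi (x + 1) - beta * (xi / (1 - xi)) * Bser beta xi (x + 1).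
Proof.
  intros Hb Hxi Hx. set (rho := (1 + xi) / 2).
  assert (Hr : 0 < xi < rho /\ rho < 1) by (unfold rho; lra). destruct Hr as [Hr1 Hr2].
  apply RtoC_inj.
  pose proof (pser_scal rho xi (x + 1)%R _ _ (pser_nh beta rho xi x Hb Hr1 Hr2 Hx)) as H1.
  pose proof (pser_h beta rho xi (x + 1) Hb Hr1 Hr2 ltac:(lra)) as H2.
  pose proof (pser_nh beta rho xi (x + 1) Hb Hr1 Hr2 ltac:(lra)) as H3.
  assert (Hr0 : 0 < rho) by lra.
  pose proof (pser_plus _ _ _ _ _ _ Hr0 (pser_scal _ _ x _ _ (pser_clag _ _ _ _ H3))
     (pser_scal _ _ (- beta)%R _ _ (pser_lagsum _ _ _ _ Hr1 Hr2 H2))) as H4.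
  assert (H5 : pser rho xi (fun n => (x + 1)%R * RtoC (INR n * phi_coef beta x n))%C
     (x * (xi * Dser beta xi (x + 1)) + (- beta)%R * (xi / (1 - xi) * Bser beta xi (x + 1)))%C).
  { eapply pser_ext; [|exact H4]. intros [|n]; cbv beta; cbn [clag lagsum].
    - simpl (INR 0). rewrite Rmult_0_l. ring.
    - rewrite <- !RtoC_mult, <- !RtoC_plus. f_equal.
      rewrite <- (Rmult_assoc (x + 1)), (phi_coef_lower_deriv beta x n Hx). ring. }
  rewrite RtoC_mult, (pser_unique _ _ _ _ _ H1 H5).
  rewrite (RtoC_minus (x * _ * _)), !RtoC_mult, RtoC_div, RtoC_minus, RtoC_opp by lra. ring.
Qed.

(** The contiguity relations are a linear map between the values of B and xi dB/dxi at y and at y + 1, with determinant proportional to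
    y^2 + y + beta, so a common zero would spread to all points; this contradicts the equation for B. *)
Lemma AB_not_both_zero beta xi j : 0 < beta -> 0 < xi < 1 ->
  ~ (Aser beta xi (pt j) = 0 /\ Bser beta xi (pt j) = 0).
Proof.
  intros Hb Hxi [HA HB].
  set (good := fun i => Bser beta xi (pt i) = 0 /\ Dser beta xi (pt i) = 0).
  assert (Hj : good j) by (split; [exact HB|unfold Aser in HA; rewrite HB in HA; lra]).
  assert (Hz : forall i, pt (S i) = pt i + 1) by (intros i; unfold pt; rewrite S_INR; reflexivity).
  assert (Hdown : forall i, good (S i) -> good i).
  { intros i [H1 H2]. rewrite Hz in H1, H2. pose proof (pt_ge1 i).
    pose proof (B_lower beta xi (pt i) Hb Hxi ltac:(lra)) as E1.
    pose proof (D_lower beta xi (pt i) Hb Hxi ltac:(lra)) as E2.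
    rewrite H1, H2 in E1, E2. split; apply Rmult_eq_reg_l with (pt i + 1); lra. }
  assert (Hup : forall i, good i -> good (S i)).
  { intros i [H1 H2]. unfold good. rewrite Hz. pose proof (pt_ge1 i).
    pose proof (B_lower beta xi (pt i) Hb Hxi ltac:(lra)) as E1.
    pose proof (D_lower beta xi (pt i) Hb Hxi ltac:(lra)) as E2.
    rewrite H1 in E1. rewrite H2 in E2.
    set (b := Bser beta xi (pt i + 1)) in *. set (d := Dser beta xi (pt i + 1)) in *.
    set (z := pt i) in *.
    assert (E3 : (z * (z + 1) + beta) * b = 0).
    { assert (E4 : z * (1 - xi) * d - beta * b = 0).
      { apply Rmult_eq_reg_l with (xi / (1 - xi)).
        - rewrite Rmult_0_r. transitivity (z * xi * d - beta * (xi / (1 - xi)) * b); [field; lra|lra].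
        - apply Rgt_not_eq, Rdiv_lt_0_compat; lra. }
      assert (E5 : (1 - xi) * d = - (z + 1) * b) by lra.
      transitivity (- (z * ((1 - xi) * d) - beta * b)); [rewrite E5; ring|].
      transitivity (- (z * (1 - xi) * d - beta * b)); [ring|]. rewrite E4; ring. }
    assert (Hb0 : b = 0).
    { apply Rmult_eq_reg_l with (z * (z + 1) + beta); [lra|]. nra. }
    split; [exact Hb0|]. rewrite Hb0 in E1. apply Rmult_eq_reg_l with (1 - xi); lra. }
  assert (H0 : good O) by (clear HA HB; induction j; auto).
  assert (Hall : forall i, good i) by (induction i; auto).
  pose proof (B_equation beta xi (pt 0) Hb Hxi ltac:(pose proof (pt_ge1 0); lra)) as E.
  rewrite (proj1 (Hall O)) in E.
  rewrite (Series_ext _ (fun i => 0 * 0)) in E.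
  - rewrite Series_scal_l in E. lra.
  - intros i. rewrite (proj1 (Hall i)). ring.
Qed.

(** * From two discrete equations to the resolvent *)

Definition delta (j i : nat) : R := if Nat.eq_dec i j then 1 else 0.

Lemma is_series_delta_at j (f : nat -> R) : is_series (fun i => f i * delta j i) (f j).
Proof.
  assert (H0 : forall m, (m < j)%nat -> sum_f_R0 (fun i => f i * delta j i) m = 0).
  { intros m Hm. rewrite (sumR_ext_loc _ (fun _ => 0 * 0)).
    - rewrite sumR_scal; ring.
    - intros i Hi. unfold delta. destruct (Nat.eq_dec i j); [lia|ring]. }
  assert (Hj : f j * delta j j = f j) by (unfold delta; destruct (Nat.eq_dec j j); [ring|contradiction]).
  assert (E : sum_f_R0 (fun i => f i * delta j i) j = f j).
  { destruct j as [|m]; [exact Hj|]. rewrite sumR_S, H0, Hj by lia. ring. }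
  assert (H : is_series (fun i => f i * delta j i) (sum_f_R0 (fun i => f i * delta j i) j)).
  { apply is_series_finite. intros n Hn. unfold delta. destruct (Nat.eq_dec n j); [lia|ring]. }
  rewrite E in H. exact H.
Qed.

Section Resolvent.
Variables (W : nat -> R) (A B : R -> R) (c K : R).
Hypothesis HW : forall i, 0 < W i.
Hypothesis HWs : ex_series (fun i => W i * (1 + pt i) ^ 2).
Hypothesis HK : 0 <= K.
Hypothesis HBb : forall i, Rabs (B (pt i)) <= K * (1 + pt i).
Hypothesis HAb : forall i, Rabs (A (pt i)) <= K * (1 + pt i).
Hypothesis EB : forall x, 0 <= x -> B x + Series (fun i => W i / (x + pt i) * B (pt i)) = 1.
Hypothesis EA : forall x, 0 <= x -> A x + Series (fun i => W i / (x + pt i) * A (pt i)) = x - c.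
Hypothesis HAB : forall i, ~ (A (pt i) = 0 /\ B (pt i) = 0).

Lemma dom_ex (f : nat -> R) C : (forall i, Rabs (f i) <= C * (W i * (1 + pt i) ^ 2)) ->
  ex_series (fun i => Rabs (f i)).
Proof. intros H. apply (ex_series_dom f _ H). apply ex_series_scalR, HWs. Qed.

(** All vectors in this part grow at most linearly, against weights that decay geometrically. *)
Definition lin_bounded (u : nat -> R) (C : R) : Prop := forall i, Rabs (u i) <= C * (1 + pt i).

Lemma ex_W1 u C : lin_bounded u C -> ex_series (fun i => Rabs (W i * u i)).
Proof.
  intros Hu. apply (dom_ex _ C). intros i. rewrite Rabs_mult, (Rabs_pos_eq (W i)) by (left; apply HW).
  pose proof (HW i). pose proof (pt_ge1 i). specialize (Hu i). pose proof (Rabs_pos (u i)).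
  replace (C * (W i * (1 + pt i) ^ 2)) with (W i * (C * (1 + pt i) * (1 + pt i))) by ring.
  apply Rmult_le_compat_l; [lra|]. apply Rle_trans with (C * (1 + pt i)); [exact Hu|].
  rewrite <- (Rmult_1_r (C * (1 + pt i))) at 1. apply Rmult_le_compat_l; lra.
Qed.

Lemma ex_Wz u C : lin_bounded u C -> ex_series (fun i => Rabs (W i * (pt i * u i))).
Proof.
  intros Hu. apply (dom_ex _ C). intros i. pose proof (HW i). pose proof (pt_ge1 i). specialize (Hu i).
  rewrite !Rabs_mult, (Rabs_pos_eq (W i)), (Rabs_pos_eq (pt i)) by lra. pose proof (Rabs_pos (u i)).
  replace (C * (W i * (1 + pt i) ^ 2)) with (W i * ((1 + pt i) * (C * (1 + pt i)))) by ring.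
  apply Rmult_le_compat_l; [lra|]. apply Rmult_le_compat; lra.
Qed.

Lemma ex_Wuv u v C D : lin_bounded u C -> lin_bounded v D -> ex_series (fun i => Rabs (W i * u i * v i)).
Proof.
  intros Hu Hv. apply (dom_ex _ (C * D)). intros i. pose proof (HW i). pose proof (pt_ge1 i).
  specialize (Hu i). specialize (Hv i).
  rewrite !Rabs_mult, (Rabs_pos_eq (W i)) by lra. pose proof (Rabs_pos (u i)). pose proof (Rabs_pos (v i)).
  replace (C * D * (W i * (1 + pt i) ^ 2)) with (W i * ((C * (1 + pt i)) * (D * (1 + pt i)))) by ring.
  rewrite Rmult_assoc. apply Rmult_le_compat_l; [lra|]. apply Rmult_le_compat; lra.
Qed.

Lemma inv_le1 x i : 0 <= x -> 0 < / (x + pt i) <= 1.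
Proof.
  intros Hx. pose proof (pt_ge1 i). split; [apply Rinv_0_lt_compat; lra|].
  rewrite <- Rinv_1. apply Rinv_le_contravar; lra.
Qed.

Lemma ex_Wdiv x u C : 0 <= x -> lin_bounded u C -> ex_series (fun i => Rabs (W i / (x + pt i) * u i)).
Proof.
  intros Hx Hu. apply (ex_series_dom _ (fun i => Rabs (W i * u i))); [|apply (ex_W1 u C Hu)].
  intros i. destruct (inv_le1 x i Hx) as [H1 H2]. pose proof (HW i).
  unfold Rdiv. rewrite !Rabs_mult, (Rabs_pos_eq (/ _)) by lra.
  rewrite (Rabs_pos_eq (W i)) by lra. pose proof (Rabs_pos (u i)).
  rewrite Rmult_assoc. apply Rmult_le_compat_l; [lra|]. nra.
Qed.

(** Symmetry of the operator with kernel W/(x + y). *)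
Lemma pairing u v C D : 0 <= C -> 0 <= D -> lin_bounded u C -> lin_bounded v D ->
  Series (fun i => W i * u i * Series (fun l => W l / (pt i + pt l) * v l))
  = Series (fun l => W l * v l * Series (fun i => W i / (pt l + pt i) * u i)).
Proof.
  intros HC HD Hu Hv.
  set (a := fun i l => W i * u i * (W l / (pt i + pt l) * v l)).
  assert (Hz : forall i, 0 <= pt i) by (intros i; pose proof (pt_ge1 i); lra).
  assert (Hrow : forall i, is_series (fun l => Rabs (a i l))
     (Rabs (W i * u i) * Series (fun l => Rabs (W l / (pt i + pt l) * v l)))).
  { intros i. eapply is_series_ext; [intros l; symmetry; apply Rabs_mult|].
    apply is_series_scalR, Series_correct, (ex_Wdiv _ v D); auto. }
  assert (Ha : abs_summable2 a).
  { split; [intros i; eexists; apply Hrow|].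
    eapply ex_series_ext; [intros i; symmetry; apply is_series_unique, Hrow|].
    set (T0 := Series (fun l => Rabs (W l * v l))).
    apply (ex_series_leR _ (fun i => T0 * Rabs (W i * u i))).
    2:{ apply ex_series_scalR, (ex_W1 u C Hu). }
    intros i. cbv beta.
    assert (H0 : 0 <= Series (fun l => Rabs (W l / (pt i + pt l) * v l)) <= T0).
    { split.
      - eapply Rle_trans; [apply (Rabs_pos (W O / (pt i + pt O) * v O))|].
        apply (term_le_series (fun l => Rabs (W l / (pt i + pt l) * v l)) O); [intros; apply Rabs_pos|].
        apply (ex_Wdiv _ v D); auto.
      - apply Series_le; [|apply (ex_W1 v D Hv)]. intros l. split; [apply Rabs_pos|].
        destruct (inv_le1 (pt i) l (Hz i)) as [H1 H2]. pose proof (HW l).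
        unfold Rdiv. rewrite !Rabs_mult, (Rabs_pos_eq (/ _)), (Rabs_pos_eq (W l)) by lra.
        pose proof (Rabs_pos (v l)). rewrite Rmult_assoc. apply Rmult_le_compat_l; [lra|]. nra. }
    pose proof (Rabs_pos (W i * u i)).
    rewrite Rabs_pos_eq by (apply Rmult_le_pos; lra). rewrite Rmult_comm. apply Rmult_le_compat_r; lra. }
  pose proof (is_series_unique _ _ (fubini a Ha)) as E.
  transitivity (Series (fun i => Series (a i))).
  { apply Series_ext. intros i. symmetry. apply Series_scal_l. }
  rewrite <- E. apply Series_ext. intros l.
  rewrite <- Series_scal_l. apply Series_ext. intros i. unfold a. rewrite (Rplus_comm (pt l)).
  pose proof (pt_ge1 l). pose proof (pt_ge1 i). field. lra.
Qed.

Variable j : nat.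
Let y := pt j.
Definition numer (t : R) : R := A t * B y - B t * A y.

(** The candidate column of the resolvent, with the diagonal entry removed. *)
Definition res_off (i : nat) : R := if Nat.eq_dec i j then 0 else numer (pt i) / (pt i ^ 2 - y ^ 2).
(** The diagonal entry, chosen so that the resolvent equation holds off the diagonal; see [off_diagonal]. *)
Definition res_diag : R := (1 - B y - Series (fun i => W i * res_off i)) / W j.
Definition res_col (i : nat) : R := if Nat.eq_dec i j then res_diag else numer (pt i) / (pt i ^ 2 - y ^ 2).
Lemma pt_gap i : i <> j -> 1 <= Rabs (pt i ^ 2 - y ^ 2).
Proof.
  intros Hij. unfold y.
  replace (pt i ^ 2 - pt j ^ 2) with ((pt i - pt j) * (pt i + pt j)) by ring.
  pose proof (pt_ge1 i) as H1. pose proof (pt_ge1 j) as H2.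
  rewrite Rabs_mult, (Rabs_pos_eq (pt i + pt j)) by lra.
  assert (H : 1 <= Rabs (pt i - pt j)).
  { unfold pt in *. destruct (Nat.lt_total i j) as [H|[H|H]]; [|contradiction|].
    - assert (INR (S i) + 1 <= INR (S j)) by (rewrite <- S_INR; apply le_INR; lia).
      rewrite Rabs_left; lra.
    - assert (INR (S j) + 1 <= INR (S i)) by (rewrite <- S_INR; apply le_INR; lia).
      rewrite Rabs_pos_eq; lra. }
  nra.
Qed.

Lemma numer_y : numer y = 0.
Proof. unfold numer; ring. Qed.

Lemma numer_bound : lin_bounded (fun i => numer (pt i)) (K * (Rabs (A y) + Rabs (B y))).
Proof.
  intros i. unfold numer, Rminus. eapply Rle_trans; [apply Rabs_triang|].
  rewrite Rabs_Ropp, !Rabs_mult. pose proof (HAb i). pose proof (HBb i).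
  pose proof (Rabs_pos (A y)). pose proof (Rabs_pos (B y)). nra.
Qed.

Lemma C0_pos : 0 <= K * (Rabs (A y) + Rabs (B y)).
Proof. pose proof (Rabs_pos (A y)). pose proof (Rabs_pos (B y)). apply Rmult_le_pos; lra. Qed.

Lemma res_off_bound : lin_bounded res_off (K * (Rabs (A y) + Rabs (B y))).
Proof.
  intros i. unfold res_off. pose proof (pt_ge1 i) as Hz. pose proof C0_pos as HC.
  destruct (Nat.eq_dec i j) as [E|E].
  - rewrite Rabs_R0. apply Rmult_le_pos; lra.
  - pose proof (pt_gap i E) as Hg. pose proof (numer_bound i) as HN. cbv beta in HN.
    unfold Rdiv. rewrite Rabs_mult, Rabs_inv.
    assert (/ Rabs (pt i ^ 2 - y ^ 2) <= 1) by (rewrite <- Rinv_1; apply Rinv_le_contravar; lra).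
    assert (0 < / Rabs (pt i ^ 2 - y ^ 2)) by (apply Rinv_0_lt_compat; lra).
    pose proof (Rabs_pos (numer (pt i))). nra.
Qed.

Lemma res_off_mul i : numer (pt i) = res_off i * (pt i ^ 2 - y ^ 2).
Proof.
  unfold res_off. destruct (Nat.eq_dec i j) as [->|E].
  - change (pt j) with y. rewrite numer_y. ring.
  - pose proof (pt_gap i E) as Hg. field. intros E'. rewrite E', Rabs_R0 in Hg. lra.
Qed.

Lemma res_col_split i : res_col i = res_off i + res_diag * delta j i.
Proof. unfold res_col, res_off, delta. destruct (Nat.eq_dec i j); ring. Qed.

Lemma res_col_bound : exists C, 0 <= C /\ lin_bounded res_col C.
Proof.
  exists (K * (Rabs (A y) + Rabs (B y)) + Rabs res_diag). pose proof C0_pos. pose proof (Rabs_pos res_diag). split; [lra|].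
  intros i. rewrite res_col_split. eapply Rle_trans; [apply Rabs_triang|].
  pose proof (res_off_bound i). pose proof (pt_ge1 i).
  assert (Rabs (res_diag * delta j i) <= Rabs res_diag).
  { unfold delta. destruct (Nat.eq_dec i j); [rewrite Rmult_1_r|rewrite Rmult_0_r, Rabs_R0]; lra. }
  nra.
Qed.

Lemma sums_AB x : 0 <= x ->
  Series (fun i => W i / (x + pt i) * numer (pt i)) = (x - c) * B y - A y - numer x.
Proof.
  intros Hx.
  rewrite (Series_ext _ (fun i => B y * (W i / (x + pt i) * A (pt i)) - A y * (W i / (x + pt i) * B (pt i))))
    by (intros i; unfold numer; ring).
  rewrite Series_minus.
  - rewrite !Series_scal_l.
    pose proof (EA x Hx). pose proof (EB x Hx).
    replace (Series (fun i => W i / (x + pt i) * A (pt i))) with (x - c - A x) by lra.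
    replace (Series (fun i => W i / (x + pt i) * B (pt i))) with (1 - B x) by lra.
    unfold numer. ring.
  - apply ex_series_scalR, ex_series_Rabs, (ex_Wdiv x (fun i => A (pt i)) K Hx). exact HAb.
  - apply ex_series_scalR, ex_series_Rabs, (ex_Wdiv x (fun i => B (pt i)) K Hx). exact HBb.
Qed.

Let p := Series (fun i => W i * res_off i).
Let p1 := Series (fun i => W i * (pt i * res_off i)).

Lemma res_off_sum x : 0 <= x ->
  (x ^ 2 - y ^ 2) * Series (fun i => W i / (x + pt i) * res_off i)
  = x * p - p1 + ((x - c) * B y - A y - numer x).
Proof.
  intros Hx. rewrite <- sums_AB by assumption. unfold p, p1.
  assert (Hs1 : ex_series (fun i => W i * res_off i)) by (apply ex_series_Rabs, (ex_W1 _ _ res_off_bound)).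
  assert (Hs2 : ex_series (fun i => W i * (pt i * res_off i))) by (apply ex_series_Rabs, (ex_Wz _ _ res_off_bound)).
  assert (Hs3 : ex_series (fun i => W i / (x + pt i) * numer (pt i)))
    by (apply ex_series_Rabs, (ex_Wdiv x (fun i => numer (pt i)) _ Hx numer_bound)).
  rewrite <- !Series_scal_l.
  rewrite <- Series_minus, <- Series_plus.
  - apply Series_ext. intros i. rewrite res_off_mul. pose proof (pt_ge1 i). field. lra.
  - apply (ex_series_minus (fun i => x * (W i * res_off i))); [apply ex_series_scalR|]; assumption.
  - exact Hs3.
  - apply ex_series_scalR; assumption.
  - assumption.
Qed.

Lemma p1_eq : p1 = y * p + (y - c) * B y - A y.
Proof.
  assert (Hy : 0 <= y) by (unfold y; pose proof (pt_ge1 j); lra).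
  pose proof (res_off_sum y Hy) as E. rewrite numer_y in E. lra.
Qed.

Lemma WKj : p + W j * res_diag = 1 - B y.
Proof. unfold p, res_diag. pose proof (HW j). field. lra. Qed.

Lemma res_col_sum x : 0 <= x ->
  Series (fun i => W i / (x + pt i) * res_col i)
  = Series (fun i => W i / (x + pt i) * res_off i) + W j / (x + y) * res_diag.
Proof.
  intros Hx.
  pose proof (is_series_delta_at j (fun i => W i / (x + pt i) * res_diag)) as H. cbv beta in H.
  pose proof (is_series_unique _ _ H) as E. change (pt j) with y in E. rewrite <- E.
  rewrite <- Series_plus.
  - apply Series_ext. intros i. rewrite res_col_split. ring.
  - apply ex_series_Rabs, (ex_Wdiv x res_off _ Hx res_off_bound).
  - eexists; exact H.
Qed.

(** Multiply by x^2 - y^2 and use (x^2 - y^2)/((x + t)(t^2 - y^2)) = (x - t)/(t^2 - y^2) + 1/(x + t): the last term is evaluated by the equations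
    for A and B, the rest is affine in x and vanishes at x = y; the choice of the diagonal entry fixes its slope. *)
Lemma off_diagonal x : 0 <= x -> x <> y ->
  numer x / (x ^ 2 - y ^ 2) + Series (fun i => W i / (x + pt i) * res_col i) = / (x + y).
Proof.
  intros Hx Hxy. assert (Hy : 1 <= y) by apply pt_ge1.
  assert (Hne : x ^ 2 - y ^ 2 <> 0).
  { replace (x ^ 2 - y ^ 2) with ((x - y) * (x + y)) by ring.
    apply Rmult_integral_contrapositive_currified; lra. }
  pose proof (res_off_sum x Hx) as E. rewrite p1_eq in E.
  rewrite (res_col_sum x Hx).
  apply Rmult_eq_reg_l with (x ^ 2 - y ^ 2); [|exact Hne].
  rewrite !Rmult_plus_distr_l, E.
  pose proof WKj as E2. assert (Ep : p = 1 - B y - W j * res_diag) by lra. rewrite Ep.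
  field. split; [lra|exact Hne].
Qed.

Definition defect : R := res_diag + Series (fun i => W i / (y + pt i) * res_col i) - / (y + y).

Lemma res_col_equation_defect i :
  res_col i + Series (fun l => W l / (pt i + pt l) * res_col l) = / (pt i + y) + defect * delta j i.
Proof.
  unfold delta. destruct (Nat.eq_dec i j) as [->|E].
  - unfold res_col at 1. destruct (Nat.eq_dec j j); [|contradiction]. unfold defect. change (pt j) with y. ring.
  - pose proof (pt_ge1 i).
    assert (Hne : pt i <> y).
    { intros E'. pose proof (pt_gap i E) as Hg. rewrite E' in Hg. rewrite Rminus_diag, Rabs_R0 in Hg. lra. }
    rewrite Rmult_0_r, Rplus_0_r, <- (off_diagonal (pt i)) by (try assumption; lra).
    unfold res_col at 1. destruct (Nat.eq_dec i j); [contradiction|]. reflexivity.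
Qed.

(** Pairing the resolvent equation, including its defect, with a solution u of u + sum W u/(x + .) = e x + r. *)
Lemma paired (u : R -> R) (r e : R) :
  (forall i, Rabs (u (pt i)) <= K * (1 + pt i)) ->
  (forall x, 0 <= x -> u x + Series (fun i => W i / (x + pt i) * u (pt i)) = e * x + r) ->
  e * (p1 + y * (W j * res_diag)) + r * (1 - B y) = (e * y + r - u y) + defect * (W j * u y).
Proof.
  intros Hu Heq. destruct res_col_bound as (C & HC & Hk).
  assert (Hub : lin_bounded (fun i => u (pt i)) K) by exact Hu.
  pose proof (pairing (fun i => u (pt i)) res_col K C HK HC Hub Hk) as HP. cbv beta in HP.
  assert (Hz : forall i, 0 <= pt i) by (intros i; pose proof (pt_ge1 i); lra).
  assert (X1 : ex_series (fun i => W i * u (pt i) * res_col i)) by (apply ex_series_Rabs, (ex_Wuv _ _ K C Hub Hk)).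
  assert (Hdl : is_series (fun i => defect * (W i * u (pt i)) * delta j i) (defect * (W j * u y))).
  { apply (is_series_delta_at j (fun i => defect * (W i * u (pt i)))). }
  assert (X2 : ex_series (fun i => W i / (y + pt i) * u (pt i))) by (apply ex_series_Rabs, (ex_Wdiv y _ K (Hz j) Hub)).
  assert (L1 : Series (fun i => W i * u (pt i) * Series (fun l => W l / (pt i + pt l) * res_col l))
     = (e * y + r - u y) + defect * (W j * u y) - Series (fun i => W i * u (pt i) * res_col i)).
  { rewrite (Series_ext _ (fun i => (W i / (y + pt i) * u (pt i) + defect * (W i * u (pt i)) * delta j i) - W i * u (pt i) * res_col i)).
    2:{ intros i. pose proof (res_col_equation_defect i) as E.
        replace (Series (fun l => W l / (pt i + pt l) * res_col l)) with (/ (pt i + y) + defect * delta j i - res_col i) by lra.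
        rewrite (Rplus_comm y). unfold Rdiv. ring. }
    rewrite Series_minus, Series_plus, (is_series_unique _ _ Hdl); try assumption.
    - pose proof (Heq y (Hz j)). lra.
    - eexists; exact Hdl.
    - apply (ex_series_plus (fun i => W i / (y + pt i) * u (pt i))); [assumption|eexists; exact Hdl]. }
  assert (X3 : ex_series (fun l => W l * res_col l)) by (apply ex_series_Rabs, (ex_W1 _ C Hk)).
  assert (X4 : ex_series (fun l => W l * (pt l * res_col l))) by (apply ex_series_Rabs, (ex_Wz _ C Hk)).
  assert (L2 : Series (fun l => W l * res_col l * Series (fun i => W i / (pt l + pt i) * u (pt i)))
     = e * Series (fun l => W l * (pt l * res_col l)) + r * Series (fun l => W l * res_col l)
       - Series (fun i => W i * u (pt i) * res_col i)).
  { rewrite <- !Series_scal_l.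
    rewrite <- Series_plus by (apply ex_series_scalR; assumption).
    rewrite <- Series_minus; [|apply (ex_series_plus (fun l => e * (W l * (pt l * res_col l)))); apply ex_series_scalR; assumption|assumption].
    apply Series_ext. intros l. pose proof (Heq (pt l) (Hz l)) as E.
    replace (Series (fun i => W i / (pt l + pt i) * u (pt i))) with (e * pt l + r - u (pt l)) by lra.
    ring. }
  assert (L3 : Series (fun l => W l * res_col l) = 1 - B y).
  { rewrite <- WKj. unfold p.
    pose proof (is_series_delta_at j (fun i => W i * res_diag)) as H. cbv beta in H.
    rewrite <- (is_series_unique _ _ H), <- Series_plus.
    - apply Series_ext. intros i. rewrite res_col_split. ring.
    - apply ex_series_Rabs, (ex_W1 _ _ res_off_bound). - eexists; exact H. }
  assert (L4 : Series (fun l => W l * (pt l * res_col l)) = p1 + y * (W j * res_diag)).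
  { unfold p1.
    pose proof (is_series_delta_at j (fun i => W i * (pt i * res_diag))) as H. cbv beta in H.
    replace (y * (W j * res_diag)) with (W j * (pt j * res_diag)) by (unfold y; ring).
    rewrite <- (is_series_unique _ _ H), <- Series_plus.
    - apply Series_ext. intros i. rewrite res_col_split. ring.
    - apply ex_series_Rabs, (ex_Wz _ _ res_off_bound). - eexists; exact H. }
  rewrite L3, L4 in L2. lra.
Qed.

(** The pairings with B and with A give defect B(y) = 0 and defect A(y) = 0. *)
Lemma defect_zero : defect = 0.
Proof.
  pose proof (paired B 1 0 HBb ltac:(intros x Hx; rewrite (EB x Hx); ring)) as E1.
  pose proof (paired A (- c) 1 HAb ltac:(intros x Hx; rewrite (EA x Hx); ring)) as E2.
  pose proof WKj as E3. rewrite p1_eq in E1, E2. pose proof (HW j) as HWj.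
  assert (D1 : defect * B y = 0).
  { apply Rmult_eq_reg_l with (W j); [|lra]. lra. }
  assert (D2 : defect * A y = 0).
  { apply Rmult_eq_reg_l with (W j); [|lra].
    assert (E4 : y * p + y * (W j * res_diag) = y * (1 - B y)) by (rewrite <- E3; ring). lra. }
  destruct (Req_dec defect 0) as [|Hne]; [assumption|exfalso].
  apply (HAB j). change (pt j) with y.
  split; apply Rmult_eq_reg_l with defect; try assumption; lra.
Qed.

Lemma res_col_equation i :
  res_col i + Series (fun l => W l / (pt i + pt l) * res_col l) = / (pt i + y).
Proof. rewrite res_col_equation_defect, defect_zero. ring. Qed.

Lemma Series_lipschitz x : 0 <= x ->
  Rabs (Series (fun i => W i / (x + pt i) * res_col i) - Series (fun i => W i / (y + pt i) * res_col i))
  <= Rabs (x - y) * Series (fun i => Rabs (W i * res_col i)).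
Proof.
  intros Hx. destruct res_col_bound as (C & HC & Hk).
  assert (Hy : 0 <= y) by (unfold y; pose proof (pt_ge1 j); lra).
  rewrite <- Series_minus by (apply ex_series_Rabs; apply (ex_Wdiv _ _ C); assumption).
  rewrite <- Series_scal_l.
  assert (Hd : forall i, Rabs (W i / (x + pt i) * res_col i - W i / (y + pt i) * res_col i) <= Rabs (x - y) * Rabs (W i * res_col i)).
  { intros i. destruct (inv_le1 x i Hx). destruct (inv_le1 y i Hy).
    replace (W i / (x + pt i) * res_col i - W i / (y + pt i) * res_col i)
      with ((x - y) * (W i * res_col i) * (- (/ (x + pt i) * / (y + pt i)))).
    2:{ pose proof (pt_ge1 i). field. split; lra. }
    rewrite Rabs_mult, Rabs_Ropp, (Rabs_mult (x - y)).
    rewrite (Rabs_pos_eq (/ _ * _)) by (apply Rmult_le_pos; lra).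
    rewrite <- (Rmult_1_r (Rabs (x - y) * Rabs (W i * res_col i))) at 2.
    apply Rmult_le_compat_l; [apply Rmult_le_pos; apply Rabs_pos|nra]. }
  assert (Hex : ex_series (fun i => Rabs (x - y) * Rabs (W i * res_col i))).
  { apply ex_series_scalR, (ex_W1 _ C Hk). }
  eapply Rle_trans; [apply Series_Rabs, (ex_series_dom _ _ Hd Hex)|].
  apply Series_le; [|exact Hex]. intros i; split; [apply Rabs_pos|apply Hd].
Qed.

(** The off-diagonal equation holds for real t near y, and its sum is a Lipschitz function of t, so the quotient has a limit;
    the equation at y itself identifies it. *)
Lemma quotient_limit : forall eps, 0 < eps -> exists d, 0 < d /\ forall t, 0 <= t -> t <> y ->
  Rabs (t - y) < d -> Rabs (numer t / (t ^ 2 - y ^ 2) - res_diag) < eps.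
Proof.
  intros eps He. set (S0 := Series (fun i => Rabs (W i * res_col i))).
  assert (HS0 : 0 <= S0).
  { destruct res_col_bound as (C & HC & Hk). eapply Rle_trans; [apply (Rabs_pos (W O * res_col O))|].
    apply (term_le_series (fun i => Rabs (W i * res_col i)) O); [intros; apply Rabs_pos|apply (ex_W1 _ C Hk)]. }
  assert (Hy : 1 <= y) by apply pt_ge1.
  exists (eps / (S0 + 1)). split; [apply Rdiv_lt_0_compat; lra|]. intros t Ht Hty Hd.
  pose proof (off_diagonal t Ht Hty) as E1.
  pose proof defect_zero as E2. unfold defect in E2.
  pose proof (Series_lipschitz t Ht) as HL. fold S0 in HL.
  set (s1 := Series (fun i => W i / (t + pt i) * res_col i)) in *.
  set (s2 := Series (fun i => W i / (y + pt i) * res_col i)) in *.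
  replace (numer t / (t ^ 2 - y ^ 2) - res_diag) with ((/ (t + y) - / (y + y)) + - (s1 - s2)) by lra.
  eapply Rle_lt_trans; [apply Rabs_triang|]. rewrite Rabs_Ropp.
  assert (H1 : Rabs (/ (t + y) - / (y + y)) <= Rabs (t - y)).
  { replace (/ (t + y) - / (y + y)) with ((t - y) * - (/ (t + y) * / (y + y))) by (field; lra).
    rewrite Rabs_mult, Rabs_Ropp.
    assert (0 < / (t + y) <= 1) by (split; [apply Rinv_0_lt_compat; lra|rewrite <- Rinv_1; apply Rinv_le_contravar; lra]).
    assert (0 < / (y + y) <= 1) by (split; [apply Rinv_0_lt_compat; lra|rewrite <- Rinv_1; apply Rinv_le_contravar; lra]).
    rewrite (Rabs_pos_eq (/ _ * _)) by nra. rewrite <- (Rmult_1_r (Rabs (t - y))) at 2.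
    apply Rmult_le_compat_l; [apply Rabs_pos|nra]. }
  assert (H2 : Rabs (t - y) * (S0 + 1) < eps).
  { apply Rlt_le_trans with (eps / (S0 + 1) * (S0 + 1)); [apply Rmult_lt_compat_r; lra|right; field; lra]. }
  lra.
Qed.

End Resolvent.

(** * Injectivity of 1 + L *)

Lemma is_derive_sum (F f : nat -> R -> R) N t :
  (forall i, is_derive (F i) t (f i t)) ->
  is_derive (fun t => sum_f_R0 (fun i => F i t) N) t (sum_f_R0 (fun i => f i t) N).
Proof.
  intros H; induction N as [|N IH]; [apply H|]. simpl.
  apply (is_derive_plus (fun t => sum_f_R0 (fun i => F i t) N)); [exact IH|apply H].
Qed.

(** 1/(x + y) is the integral of t^(x+y-1) over [0,1]; here the integral is replaced by the mean value theorem for the function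
    with derivative t (sum of a_i t^i)^2. *)
Lemma cauchy_form_pos (a : nat -> R) N :
  0 <= sum_f_R0 (fun i => sum_f_R0 (fun l => a i * a l / (pt i + pt l)) N) N.
Proof.
  set (F := fun i l t => a i * a l / (pt i + pt l) * t ^ (S (S (i + l)))).
  set (f := fun i l (t : R) => a i * a l * t ^ (S (i + l))).
  assert (HD : forall t, is_derive (fun t => sum_f_R0 (fun i => sum_f_R0 (fun l => F i l t) N) N) t
                           (sum_f_R0 (fun i => sum_f_R0 (fun l => f i l t) N) N)).
  { intros t. apply (is_derive_sum (fun i t => sum_f_R0 (fun l => F i l t) N) (fun i t => sum_f_R0 (fun l => f i l t) N)). intros i.
    apply is_derive_sum. intros l. unfold F, f.
    replace (a i * a l * t ^ S (i + l)) with (a i * a l / (pt i + pt l) * (INR (S (S (i + l))) * 1 * t ^ (Nat.pred (S (S (i + l)))))).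
    - apply is_derive_scal. apply is_derive_pow. apply (is_derive_id t).
    - unfold pt. simpl Nat.pred. pose proof (pos_INR i). pose proof (pos_INR l).
      rewrite !S_INR, plus_INR. field. lra. }
  assert (Hf : forall t, sum_f_R0 (fun i => sum_f_R0 (fun l => f i l t) N) N = t * (sum_f_R0 (fun i => a i * t ^ i) N) ^ 2).
  { intros t. set (S0 := sum_f_R0 (fun i => a i * t ^ i) N).
    transitivity ((t * S0) * S0); [|ring]. unfold S0 at 2. rewrite <- sumR_scal.
    apply sumR_ext. intros i.
    transitivity ((t * (a i * t ^ i)) * S0); [|ring]. unfold S0. rewrite <- sumR_scal.
    apply sumR_ext. intros l. unfold f. simpl pow. rewrite pow_add. ring. }
  (* The form is the value at 1 of a function that vanishes at 0. *)
  destruct (MVT_gen (fun t => sum_f_R0 (fun i => sum_f_R0 (fun l => F i l t) N) N) 0 1 (fun t => t * (sum_f_R0 (fun i => a i * t ^ i) N) ^ 2)) as (c & Hc & E).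
  - intros t _. rewrite <- Hf. apply HD.
  - intros t _. eapply is_derive_continuity_pt. apply HD.
  - rewrite Rmin_left, Rmax_right in Hc by lra.
    assert (E0 : sum_f_R0 (fun i => sum_f_R0 (fun l => F i l 0) N) N = 0).
    { rewrite (sumR_ext _ (fun _ => 0 * 0)); [rewrite sumR_scal; ring|]. intros i.
      rewrite (sumR_ext _ (fun _ => 0 * 0)); [rewrite sumR_scal; ring|]. intros l. unfold F. simpl; ring. }
    assert (E1 : sum_f_R0 (fun i => sum_f_R0 (fun l => F i l 1) N) N
       = sum_f_R0 (fun i => sum_f_R0 (fun l => a i * a l / (pt i + pt l)) N) N).
    { apply sumR_ext; intros i; apply sumR_ext; intros l. unfold F. rewrite pow1; ring. }
    rewrite <- E1. cbv beta in E. rewrite E0 in E.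
    match goal with |- 0 <= ?v => replace v with (c * (sum_f_R0 (fun i => a i * c ^ i) N) ^ 2 * (1 - 0)) by lra end.
    rewrite Rminus_0_r, Rmult_1_r. apply Rmult_le_pos; [lra|apply pow2_ge_0].
Qed.

Lemma tail_bound (f b : nat -> R) N : (forall l, Rabs (f l) <= b l) -> ex_series b ->
  Rabs (Series f - sum_f_R0 f N) <= Series b - sum_f_R0 b N.
Proof.
  intros H Hb.
  assert (Hf : ex_series f) by (apply ex_series_Rabs, (ex_series_dom f b H Hb)).
  assert (H1 : sum_f_R0 (fun l => b l + f l) N <= Series (fun l => b l + f l)).
  { apply sum_le_series; [|apply (ex_series_plus b f Hb Hf)].
    intros l. specialize (H l). apply Rabs_le_between in H. lra. }
  assert (H2 : sum_f_R0 (fun l => b l - f l) N <= Series (fun l => b l - f l)).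
  { apply sum_le_series; [|apply (ex_series_minus b f Hb Hf)].
    intros l. specialize (H l). apply Rabs_le_between in H. lra. }
  rewrite Series_plus, sumR_plus in H1 by assumption.
  rewrite Series_minus, sumR_minus in H2 by assumption.
  apply Rabs_le. lra.
Qed.

(** Pair v + L v = 0 with v over the first N points: the square block of L contributes a nonnegative number and the rest is bounded by a tail. *)
Lemma cauchy_injective (s v : nat -> R) :
  ex_series (fun i => s i ^ 2) -> ex_series (fun i => v i ^ 2) ->
  (forall i, v i + Series (fun l => s i * s l / (pt i + pt l) * v l) = 0) ->
  forall i, v i = 0.
Proof.
  intros Hs Hv Heq i0.
  set (a := fun i => s i * v i).
  assert (Ha : ex_series (fun i => Rabs (a i))).
  { apply (ex_series_dom a (fun i => s i ^ 2 + v i ^ 2)); [|apply (ex_series_plus (fun i => s i ^ 2)); assumption].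
    intros i. unfold a. rewrite Rabs_mult.
    rewrite <- (pow2_abs (s i)), <- (pow2_abs (v i)).
    pose proof (Rabs_pos (s i)). pose proof (Rabs_pos (v i)). nra. }
  (* f i l is the summand of L v at the point i, up to a factor; it is bounded by |a l| because both points are at least 1. *)
  set (S0 := Series (fun i => Rabs (a i))).
  set (f := fun i l => a l / (pt i + pt l)).
  assert (Hf : forall i l, Rabs (f i l) <= Rabs (a l)).
  { intros i l. unfold f, Rdiv. rewrite Rabs_mult. pose proof (pt_ge1 i). pose proof (pt_ge1 l).
    assert (0 < / (pt i + pt l) <= 1).
    { split; [apply Rinv_0_lt_compat; lra|]. rewrite <- Rinv_1. apply Rinv_le_contravar; lra. }
    rewrite (Rabs_pos_eq (/ _)) by lra. pose proof (Rabs_pos (a l)). nra. }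
  assert (Hvv : forall i, v i ^ 2 = - (a i * Series (f i))).
  { intros i. pose proof (Heq i) as E.
    rewrite (Series_ext _ (fun l => s i * f i l)) in E by (intros l; unfold f, a; field; pose proof (pt_ge1 i); pose proof (pt_ge1 l); lra).
    rewrite Series_scal_l in E.
    transitivity (v i * v i); [ring|]. replace (v i) with (- (s i * Series (f i))) at 2 by lra. unfold a; ring. }
  assert (Hmain : forall N, (i0 <= N)%nat -> v i0 ^ 2 <= S0 * (S0 - sum_f_R0 (fun l => Rabs (a l)) N)).
  { intros N HN.
    set (tail := S0 - sum_f_R0 (fun l => Rabs (a l)) N).
    assert (Ht : 0 <= tail).
    { unfold tail, S0. pose proof (sum_le_series (fun l => Rabs (a l)) N (fun _ => Rabs_pos _) Ha). lra. }
    apply Rle_trans with (sum_f_R0 (fun i => v i ^ 2) N).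
    { assert (Hge : forall n, (i0 <= n)%nat -> v i0 ^ 2 <= sum_f_R0 (fun i => v i ^ 2) n).
      { induction 1 as [|n Hn IH].
        - destruct i0 as [|m]; [simpl; lra|]. rewrite sumR_S.
          pose proof (cond_pos_sum (fun i => v i ^ 2) m (fun _ => pow2_ge_0 _)). lra.
        - rewrite sumR_S. pose proof (pow2_ge_0 (v (S n))). lra. }
      apply Hge, HN. }
    pose proof (cauchy_form_pos a N) as Hpos.
    apply Rle_trans with (sum_f_R0 (fun i => v i ^ 2) N
       + sum_f_R0 (fun i => sum_f_R0 (fun l => a i * a l / (pt i + pt l)) N) N); [lra|].
    rewrite <- sumR_plus.
    apply Rle_trans with (sum_f_R0 (fun i => tail * Rabs (a i)) N).
    - apply sum_Rle. intros i _. rewrite Hvv.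
      rewrite (sumR_ext _ (fun l => a i * f i l)) by (intros l; unfold f; field; pose proof (pt_ge1 i); pose proof (pt_ge1 l); lra).
      rewrite sumR_scal.
      pose proof (tail_bound (f i) (fun l => Rabs (a l)) N (Hf i) Ha) as HT. fold S0 in HT. fold tail in HT.
      replace (- (a i * Series (f i)) + a i * sum_f_R0 (f i) N) with (a i * - (Series (f i) - sum_f_R0 (f i) N)) by ring.
      eapply Rle_trans; [apply Rle_abs|]. rewrite Rabs_mult, Rabs_Ropp, Rmult_comm.
      apply Rmult_le_compat_r; [apply Rabs_pos|exact HT].
    - rewrite sumR_scal, Rmult_comm. apply Rmult_le_compat_r; [exact Ht|].
      apply sum_le_series; [intros; apply Rabs_pos|exact Ha]. }
  assert (Hlim : is_lim_seq (fun N => S0 * (S0 - sum_f_R0 (fun l => Rabs (a l)) N)) 0).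
  { replace (Finite 0) with (Finite (S0 * (S0 - S0))) by (f_equal; ring).
    apply is_lim_seq_mult'; [apply is_lim_seq_const|].
    apply is_lim_seq_minus'; [apply is_lim_seq_const|].
    apply is_lim_seq_ext with (sum_n (fun l => Rabs (a l))); [intros; apply sum_n_Reals|].
    apply (Series_correct _ Ha). }
  assert (H0 : v i0 ^ 2 <= 0).
  { apply (is_lim_seq_le_loc (fun _ => v i0 ^ 2) (fun N => S0 * (S0 - sum_f_R0 (fun l => Rabs (a l)) N)) (v i0 ^ 2) 0).
    - exists i0. exact Hmain. - apply is_lim_seq_const. - exact Hlim. }
  pose proof (pow2_ge_0 (v i0)). assert (E : v i0 * v i0 = 0) by (simpl in *; lra).
  apply Rmult_integral in E. tauto.
Qed.

Lemma cauchy_unique (s r u v : nat -> R) :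
  ex_series (fun i => s i ^ 2) -> ex_series (fun i => u i ^ 2) -> ex_series (fun i => v i ^ 2) ->
  (forall i, u i + Series (fun l => s i * s l / (pt i + pt l) * u l) = r i) ->
  (forall i, v i + Series (fun l => s i * s l / (pt i + pt l) * v l) = r i) ->
  forall i, u i = v i.
Proof.
  intros Hs Hu Hv Eu Ev i.
  assert (Hsum : forall w i, ex_series (fun i => w i ^ 2) -> ex_series (fun l => s i * s l / (pt i + pt l) * w l)).
  { intros w k Hw. apply ex_series_Rabs.
    apply (ex_series_dom _ (fun l => Rabs (s k) * (s l ^ 2 + w l ^ 2))).
    2:{ apply ex_series_scalR, (ex_series_plus (fun i => s i ^ 2)); assumption. }
    intros l. pose proof (pt_ge1 k). pose proof (pt_ge1 l).
    assert (0 < / (pt k + pt l) <= 1).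
    { split; [apply Rinv_0_lt_compat; lra|]. rewrite <- Rinv_1. apply Rinv_le_contravar; lra. }
    unfold Rdiv. rewrite !Rabs_mult, (Rabs_pos_eq (/ _)), !Rmult_assoc by lra.
    apply Rmult_le_compat_l; [apply Rabs_pos|].
    rewrite <- (pow2_abs (s l)), <- (pow2_abs (w l)).
    pose proof (Rabs_pos (s l)). pose proof (Rabs_pos (w l)).
    apply Rle_trans with (Rabs (s l) * Rabs (w l)); [|nra].
    apply Rmult_le_compat_l; [assumption|]. nra. }
  apply Rminus_diag_uniq.
  apply (cauchy_injective s (fun i => u i - v i) Hs).
  - apply (ex_series_leR _ (fun i => 2 * (u i ^ 2 + v i ^ 2))).
    2:{ apply ex_series_scalR, (ex_series_plus (fun i => u i ^ 2)); assumption. }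
    intros n. change (Rabs ((u n - v n) ^ 2) <= 2 * (u n ^ 2 + v n ^ 2)).
    rewrite Rabs_pos_eq by apply pow2_ge_0. pose proof (pow2_ge_0 (u n + v n)). nra.
  - intros k. rewrite (Series_ext _ (fun l => s k * s l / (pt k + pt l) * u l - s k * s l / (pt k + pt l) * v l)) by (intros; ring).
    rewrite Series_minus by (apply Hsum; assumption).
    pose proof (Eu k). pose proof (Ev k). lra.
Qed.

(** * The entries of K *)

Section Kernel.
Variables (nu : C) (xi : R).
Hypothesis Hnu : admissible nu.
Hypothesis Hxi : 0 < xi < 1.
Let beta := nu_beta nu.
Let W := weight beta xi.
Let Hb : 0 < beta := admissible_beta nu Hnu.
Let sqw (i : nat) : R := sqrt (W i).
Let kerq (j i : nat) : R := res_col W (Aser beta xi) (Bser beta xi) j i.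

Lemma W_pos i : 0 < W i.
Proof. apply weight_pos; [exact Hb|exact Hxi]. Qed.

Lemma sqw_sq i : sqw i * sqw i = W i.
Proof. apply sqrt_sqrt. left; apply W_pos. Qed.

Lemma two_z_psi i : 2 * (INR (S i) * psi nu xi (S i)) = W i.
Proof.
  rewrite psi_eval by exact Hnu. unfold W, weight, weight_coef. fold beta.
  replace (S i - 1)%nat with i by lia.
  rewrite fact_simpl, mult_INR. pose proof (INR_fact_neq_0 i).
  assert (INR (S i) <> 0) by (apply not_0_INR; lia).
  field. auto.
Qed.

Lemma L_kernel_eval i l : L_kernel nu xi (S i) (S l) = sqw i * sqw l / (pt i + pt l).
Proof.
  unfold L_kernel. fold (pt i) (pt l).
  replace (pt i * pt l * psi nu xi (S i) * psi nu xi (S l)) with ((W i * W l) / 2 ^ 2).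
  2:{ rewrite <- (two_z_psi i), <- (two_z_psi l). unfold pt. field. }
  pose proof (W_pos i). pose proof (W_pos l).
  rewrite sqrt_div_alt, sqrt_pow2, sqrt_mult by lra. unfold sqw.
  pose proof (pt_ge1 i). pose proof (pt_ge1 l). field. lra.
Qed.

Lemma AB_bound : exists K, 0 <= K /\ (forall i, Rabs (Bser beta xi (pt i)) <= K * (1 + pt i)) /\
   (forall i, Rabs (Aser beta xi (pt i)) <= K * (1 + pt i)).
Proof.
  destruct (AB_bounds beta xi Hb Hxi) as (M & HM & H). exists M. split; [exact HM|].
  split; intros i; pose proof (pt_ge1 i) as Hz; destruct (H (pt i) ltac:(lra)) as [[H1 H2] [H3 H4]].
  - eapply Rle_trans; [apply Series_Rabs, H1|]. nra.
  - rewrite <- (is_series_unique _ _ (Aser_series beta xi (pt i) Hb Hxi ltac:(lra))).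
    eapply Rle_trans; [apply Series_Rabs, H3|exact H4].
Qed.

Lemma kerq_equation j i : kerq j i + Series (fun l => W l / (pt i + pt l) * kerq j l) = / (pt i + pt j).
Proof.
  destruct AB_bound as (K & HK & HB & HA). destruct (A_equation beta xi Hb Hxi) as (c & Hc).
  apply (res_col_equation W (Aser beta xi) (Bser beta xi) c K).
  - exact W_pos. - apply weight_summable; [exact Hb|exact Hxi]. - exact HK. - exact HB. - exact HA.
  - intros x Hx; apply B_equation; assumption. - exact Hc.
  - intros k; apply AB_not_both_zero; assumption.
Qed.

Lemma kerq_bound j : exists C, 0 <= C /\ lin_bounded (kerq j) C.
Proof.
  destruct AB_bound as (K & HK & HB & HA).
  apply (res_col_bound W (Aser beta xi) (Bser beta xi) K); assumption.
Qed.

Lemma kerq_limit j : forall eps, 0 < eps -> exists d, 0 < d /\ forall t, 0 <= t -> t <> pt j ->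
  Rabs (t - pt j) < d ->
  Rabs (numer (Aser beta xi) (Bser beta xi) j t / (t ^ 2 - pt j ^ 2) - kerq j j) < eps.
Proof.
  destruct AB_bound as (K & HK & HB & HA). destruct (A_equation beta xi Hb Hxi) as (c & Hc).
  intros eps He.
  replace (kerq j j) with (res_diag W (Aser beta xi) (Bser beta xi) j).
  2:{ unfold kerq, res_col. destruct (Nat.eq_dec j j); [reflexivity|contradiction]. }
  apply (quotient_limit W (Aser beta xi) (Bser beta xi) c K); try assumption.
  - exact W_pos. - apply weight_summable; [exact Hb|exact Hxi].
  - intros x Hx; apply B_equation; assumption.
  - intros k; apply AB_not_both_zero; assumption.
Qed.

Let inv_col (j i : nat) : R := delta j i - sqw i * sqw j * kerq j i.

Lemma sqw_summable : ex_series (fun i => sqw i ^ 2).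
Proof.
  apply (ex_series_leR _ (fun i => W i * (1 + pt i) ^ 2)); [|apply weight_summable; [exact Hb|exact Hxi]].
  intros i. cbv beta.
  rewrite Rabs_pos_eq by apply pow2_ge_0. simpl. rewrite Rmult_1_r, sqw_sq.
  pose proof (W_pos i). pose proof (pt_ge1 i). nra.
Qed.

Lemma inv_col_summable j : ex_series (fun i => inv_col j i ^ 2).
Proof.
  destruct (kerq_bound j) as (C & HC & Hk).
  apply (ex_series_leR _
    (fun i => 2 * (1 * delta j i + W j * Rabs (W i * kerq j i * kerq j i)))).
  - intros i. cbv beta.
    rewrite Rabs_pos_eq by apply pow2_ge_0. unfold inv_col.
    assert (Hd : delta j i ^ 2 = 1 * delta j i) by (unfold delta; destruct (Nat.eq_dec i j); ring).
    assert (E : W j * Rabs (W i * kerq j i * kerq j i) = (sqw i * sqw j * kerq j i) ^ 2).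
    { rewrite Rmult_assoc, Rabs_mult, (Rabs_pos_eq (W i)), (Rabs_pos_eq (kerq j i * kerq j i)).
      - rewrite <- (sqw_sq i), <- (sqw_sq j). ring.
      - apply Rle_0_sqr. - left; apply W_pos. }
    rewrite E, <- Hd. pose proof (pow2_ge_0 (delta j i + sqw i * sqw j * kerq j i)). nra.
  - apply ex_series_scalR.
    apply (ex_series_plus (fun i => 1 * delta j i)).
    + eexists. apply (is_series_delta_at j (fun _ => 1)).
    + apply ex_series_scalR. apply (ex_Wuv W) with C C; try assumption.
      * exact W_pos. * apply weight_summable; [exact Hb|exact Hxi].
Qed.

Lemma inv_col_equation j i :
  inv_col j i + Series (fun l => sqw i * sqw l / (pt i + pt l) * inv_col j l) = delta j i.
Proof.
  destruct (kerq_bound j) as (C & HC & Hk).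
  assert (Hz : 0 <= pt i) by (pose proof (pt_ge1 i); lra).
  pose proof (is_series_delta_at j (fun l => sqw i * sqw l / (pt i + pt l))) as H1. cbv beta in H1.
  assert (X : ex_series (fun l => W l / (pt i + pt l) * kerq j l)).
  { apply ex_series_Rabs, (ex_Wdiv W) with C; try assumption. exact W_pos. apply weight_summable; [exact Hb|exact Hxi]. }
  rewrite (Series_ext _ (fun l => sqw i * sqw l / (pt i + pt l) * delta j l - (sqw i * sqw j) * (W l / (pt i + pt l) * kerq j l))).
  2:{ intros l. unfold inv_col. rewrite <- (sqw_sq l). unfold Rdiv. ring. }
  rewrite Series_minus, (is_series_unique _ _ H1), Series_scal_l; [|eexists; exact H1|apply ex_series_scalR, X].
  pose proof (kerq_equation j i) as E.
  replace (Series (fun l => W l / (pt i + pt l) * kerq j l)) with (/ (pt i + pt j) - kerq j i) by lra.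
  unfold inv_col, Rdiv. ring.
Qed.

Lemma matrix_op_eval (u : nat -> C) i :
  matrix_op (L_kernel nu xi) u (S i)
  = (Series (fun l => sqw i * sqw l / (pt i + pt l) * Re (u (S l))),
     Series (fun l => sqw i * sqw l / (pt i + pt l) * Im (u (S l)))).
Proof.
  unfold matrix_op, Csum_pos. f_equal; apply Series_ext; intros l; rewrite L_kernel_eval.
  - destruct (u (S l)); unfold Re; simpl; ring.
  - destruct (u (S l)); unfold Im; simpl; ring.
Qed.

Lemma basis_vec_S j i : basis_vec (S j) (S i) = RtoC (delta j i).
Proof.
  unfold basis_vec, delta. destruct (Nat.eq_dec (S i) (S j)), (Nat.eq_dec i j); try reflexivity; lia.
Qed.

(** The column delta - sqrt(W_x W_y) k solves (1 + L) u = e_y, and by injectivity it is the one chosen in the definition of the inverse. *)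
Lemma K_kernel_eval i j : K_kernel nu xi (S i) (S j) = RtoC (sqw i * sqw j * kerq j i).
Proof.
  set (U := inverse_op (one_plus (L_kernel nu xi)) (basis_vec (S j))).
  assert (HU : in_l2 U /\ forall x : nat, (1 <= x)%nat ->
              one_plus (L_kernel nu xi) U x = basis_vec (S j) x).
  { unfold U, inverse_op. apply epsilon_spec.
    exists (fun n => RtoC (inv_col j (n - 1))). split.
    - unfold in_l2. eapply ex_series_ext; [|apply (inv_col_summable j)].
      intros n. replace (S n - 1)%nat with n by lia. rewrite Cmod_R, pow2_abs. reflexivity.
    - intros [|k] Hk; [lia|]. unfold one_plus. rewrite matrix_op_eval, basis_vec_S.
      replace (S k - 1)%nat with k by lia.
      rewrite <- (inv_col_equation j k). unfold Cplus, RtoC. simpl. f_equal.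
      + f_equal. apply Series_ext; intros l. replace (l - 0)%nat with l by lia. reflexivity.
      + rewrite (Series_ext _ (fun _ => 0 * 0)) by (intros l; unfold Im; simpl; ring).
        rewrite Series_scal_l. ring. }
  destruct HU as [HU1 HU2].
  assert (Hre : ex_series (fun n => Re (U (S n)) ^ 2)).
  { apply (ex_series_leR _ (fun n => Cmod (U (S n)) ^ 2)); [|exact HU1].
    intros n. cbv beta.
    rewrite Rabs_pos_eq, <- pow2_abs by apply pow2_ge_0. apply pow_incr. split; [apply Rabs_pos|apply Re_le_Cmod]. }
  assert (Him : ex_series (fun n => Im (U (S n)) ^ 2)).
  { apply (ex_series_leR _ (fun n => Cmod (U (S n)) ^ 2)); [|exact HU1].
    intros n. cbv beta.
    rewrite Rabs_pos_eq, <- pow2_abs by apply pow2_ge_0. apply pow_incr. split; [apply Rabs_pos|apply Im_le_Cmod]. }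
  assert (Heq : forall k, (U (S k) + matrix_op (L_kernel nu xi) U (S k))%C = RtoC (delta j k)).
  { intros k. rewrite <- basis_vec_S. apply HU2. lia. }
  assert (EqRe : forall k, Re (U (S k)) = inv_col j k).
  { apply (cauchy_unique sqw (delta j)); [apply sqw_summable|exact Hre|apply inv_col_summable| |apply inv_col_equation].
    intros k. pose proof (f_equal Re (Heq k)) as E. rewrite matrix_op_eval in E. exact E. }
  assert (EqIm : forall k, Im (U (S k)) = 0).
  { apply (cauchy_unique sqw (fun _ => 0)); [apply sqw_summable|exact Him| | |].
    - apply ex_series_ext with (fun i => 0 * sqw i ^ 2); [intros n; as_R; ring|]. apply ex_series_scalR, sqw_summable.
    - intros k. pose proof (f_equal Im (Heq k)) as E. rewrite matrix_op_eval in E. exact E.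
    - intros k. rewrite (Series_ext _ (fun _ => 0 * 0)) by (intros; ring). rewrite Series_scal_l. ring. }
  unfold K_kernel. fold U.
  assert (EU : U (S i) = RtoC (inv_col j i)).
  { rewrite <- EqRe. specialize (EqIm i). destruct (U (S i)) as [a b]. unfold Im in EqIm. simpl in EqIm. rewrite EqIm. reflexivity. }
  pose proof (Heq i) as E. rewrite EU in E.
  transitivity (RtoC (inv_col j i) + matrix_op (L_kernel nu xi) U (S i) - RtoC (inv_col j i))%C; [ring|].
  rewrite E, <- RtoC_minus. f_equal. unfold inv_col. ring.
Qed.

Lemma prefactor_eval i j :
  cos_pi nu / PI
    * (Rpower xi ((INR (S i) + INR (S j)) / 2) * Xi nu (S i) (S j)
       / sqrt (INR (fact (S i)) * INR (fact (S j)) * INR (fact (S i - 1)) * INR (fact (S j - 1))))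
  = sqw i * sqw j.
Proof.
  pose proof (cos_pi_pos nu Hnu) as Hc. pose proof PI_RGT_0 as HPI.
  pose proof (quad_poch_pos beta (S i) Hb) as Pi. pose proof (quad_poch_pos beta (S j) Hb) as Pj.
  assert (HX : Xi nu (S i) (S j) = PI / cos_pi nu * sqrt (quad_poch beta (S i) * quad_poch beta (S j))).
  { unfold Xi. rewrite !Gamma_prod_eval by exact Hnu. fold beta.
    assert (Hpc : 0 < PI / cos_pi nu) by (apply Rdiv_lt_0_compat; lra).
    replace (PI / cos_pi nu * quad_poch beta (S i) * (PI / cos_pi nu * quad_poch beta (S j)))
      with ((PI / cos_pi nu) ^ 2 * (quad_poch beta (S i) * quad_poch beta (S j))) by ring.
    rewrite sqrt_mult_alt, sqrt_pow2 by (try apply pow2_ge_0; lra). reflexivity. }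
  assert (HR : Rpower xi ((INR (S i) + INR (S j)) / 2) = sqrt (xi ^ S i * xi ^ S j)).
  { symmetry. apply sqrt_lem_1.
    - apply Rmult_le_pos; apply pow_le; lra.
    - left. apply exp_pos.
    - rewrite <- Rpower_plus.
      replace ((INR (S i) + INR (S j)) / 2 + (INR (S i) + INR (S j)) / 2) with (INR (S i) + INR (S j)) by field.
      rewrite Rpower_plus, !Rpower_pow by lra. reflexivity. }
  replace (S i - 1)%nat with i by lia. replace (S j - 1)%nat with j by lia.
  set (D := INR (fact (S i)) * INR (fact (S j)) * INR (fact i) * INR (fact j)).
  assert (HD : 0 < D) by (unfold D; repeat apply Rmult_lt_0_compat; apply INR_fact_lt_0).
  assert (Hx : 0 < xi ^ S i * xi ^ S j) by (apply Rmult_lt_0_compat; apply pow_lt; lra).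
  assert (HP : 0 < quad_poch beta (S i) * quad_poch beta (S j)) by (apply Rmult_lt_0_compat; assumption).
  pose proof (W_pos i) as Wi. pose proof (W_pos j) as Wj.
  unfold sqw. rewrite <- sqrt_mult by lra.
  replace (W i * W j) with ((xi ^ S i * xi ^ S j) * (quad_poch beta (S i) * quad_poch beta (S j)) / D).
  2:{ unfold W, weight, weight_coef, D. replace (S i - 1)%nat with i by lia. replace (S j - 1)%nat with j by lia.
      pose proof (INR_fact_neq_0 i). pose proof (INR_fact_neq_0 j).
      pose proof (INR_fact_neq_0 (S i)). pose proof (INR_fact_neq_0 (S j)). field. auto. }
  rewrite sqrt_div_alt, sqrt_mult by lra. rewrite HX, HR.
  assert (0 < sqrt D) by (apply sqrt_lt_R0, HD). field. repeat split; lra.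
Qed.

Lemma quotient_eval (A : R -> C) : A = A1_fun nu xi \/ A = A2_fun nu xi ->
  forall x t, 0 < x -> 0 < t -> x <> t ->
  quotient A (B_fun nu xi) x t
  = RtoC ((Aser beta xi x * Bser beta xi t - Bser beta xi x * Aser beta xi t) / (x ^ 2 - t ^ 2)).
Proof.
  intros HA x t Hx Ht Hxt.
  pose proof (admissible_sq nu Hnu) as Hsq. fold beta in Hsq.
  assert (Hne : x ^ 2 - t ^ 2 <> 0).
  { replace (x ^ 2 - t ^ 2) with ((x - t) * (x + t)) by ring.
    apply Rmult_integral_contrapositive_currified; lra. }
  assert (HneC : RtoC (x ^ 2 - t ^ 2) <> 0) by (intros E; apply RtoC_inj in E; auto).
  unfold quotient.
  rewrite !(B_fun_eval nu beta Hsq Hb xi Hxi) by lra.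
  destruct HA as [-> | ->].
  - rewrite !(A1_fun_eval nu beta Hsq Hb xi Hxi) by lra.
    rewrite (RtoC_div _ (x ^ 2 - t ^ 2)), (RtoC_minus (_ * _)), !RtoC_mult by assumption. reflexivity.
  - rewrite !(A2_fun_eval nu beta Hsq Hb xi Hxi) by lra.
    rewrite (RtoC_div _ (x ^ 2 - t ^ 2)), (RtoC_minus (_ * _)), !RtoC_mult by assumption.
    unfold Cdiv. ring.
Qed.

Lemma is_quotient_kerq (A : R -> C) : A = A1_fun nu xi \/ A = A2_fun nu xi ->
  forall i j, is_quotient A (B_fun nu xi) (pt i) (pt j) (RtoC (kerq j i)).
Proof.
  intros HA i j. pose proof (pt_ge1 i) as Hi. pose proof (pt_ge1 j) as Hj. split.
  - intros Hij. rewrite (quotient_eval A HA) by lra.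
    f_equal. unfold kerq, res_col. destruct (Nat.eq_dec i j) as [->|_]; [contradiction|].
    unfold numer. reflexivity.
  - intros Eij. assert (i = j) by (unfold pt in Eij; apply INR_eq in Eij; lia). subst i. clear Eij Hi.
    intros Q [eps HQ].
    destruct (kerq_limit j eps (cond_pos eps)) as (d & Hd & Hlim).
    assert (Hd' : 0 < Rmin d 1) by (apply Rmin_glb_lt; lra).
    pose proof (Rmin_l d 1). pose proof (Rmin_r d 1).
    exists (mkposreal _ Hd'). intros t Ht Hne. change (Rabs (t - pt j) < Rmin d 1) in Ht.
    assert (Ht0 : 0 < t) by (apply Rabs_def2 in Ht; lra).
    apply HQ. rewrite (quotient_eval A HA) by (auto; lra).
    assert (Hne2 : t ^ 2 - pt j ^ 2 <> 0).
    { replace (t ^ 2 - pt j ^ 2) with ((t - pt j) * (t + pt j)) by ring.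
      apply Rmult_integral_contrapositive_currified; lra. }
    specialize (Hlim t ltac:(lra) Hne ltac:(lra)).
    replace (numer (Aser beta xi) (Bser beta xi) j t / (t ^ 2 - pt j ^ 2))
      with ((Aser beta xi (pt j) * Bser beta xi t - Bser beta xi (pt j) * Aser beta xi t) / (pt j ^ 2 - t ^ 2)) in Hlim.
    2:{ unfold numer. field. split; lra. }
    split.
    + exact Hlim.
    + change (Rabs (0 - 0) < eps). rewrite Rminus_diag, Rabs_R0. apply cond_pos.
Qed.

End Kernel.

Theorem theorem2p2 :
  forall (xi : R) (nu : C),
    0 < xi < 1 ->
    (Im nu = 0 /\ 0 <= Re nu < 1/2) \/ Re nu = 0 ->
    forall A : R -> C,
      A = A1_fun nu xi \/ A = A2_fun nu xi ->
      forall x y : nat,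
        (1 <= x)%nat -> (1 <= y)%nat ->
        exists q : C,
          is_quotient A (B_fun nu xi) (INR x) (INR y) q /\
          K_kernel nu xi x y =
            ((cos_pi nu / PI
              * (Rpower xi ((INR x + INR y) / 2) * Xi nu x y
                 / sqrt (INR (fact x) * INR (fact y)
                         * INR (fact (x - 1)) * INR (fact (y - 1)))))%R * q)%C.
Proof.
  intros xi nu Hxi Hnu A HA [|i] [|j] Hx Hy; try lia.
  eexists. split; [exact (is_quotient_kerq nu xi Hnu Hxi A HA i j)|].
  rewrite (prefactor_eval nu xi Hnu Hxi), <- RtoC_mult.
  exact (K_kernel_eval nu xi Hnu Hxi i j).
Qed.
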